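(* Let $\mathfrak{O}=\mathfrak{O}^K_{((r,s),\mu)}$ be the $K$-orbit of $\mathfrak{E}$ corresponding to the element $((r,s),\mu)\in\Pi_2^k$. (a) If $((r,s),\mu)$ is of type (I), (II)$^0$, or (III), then there is a unique irreducible component $\mathcal{C}_{\mathfrak{O}}$ of $\mathcal{Y}$ such that $\mathcal{C}_{\mathfrak{O}}\subset\overline{\pi^{-1}(\mathfrak{O})}$. (b) If $((r,s),\mu)$ is of type (II)$^*$, then there are exactly two irreducible components $\mathcal{C}^1_{\mathfrak{O}}$ and $\mathcal{C}^2_{\mathfrak{O}}$ of $\mathcal{Y}$ such that $\mathcal{C}^i_{\mathfrak{O}}\subset\overline{\pi^{-1}(\mathfrak{O})}$ for $i\in\{1,2\}$. (c) Every irreducible component of the conormal variety $\mathcal{Y}$ is of the form $\mathcal{C}_{\mathfrak{O}}$, $\mathcal{C}^1_{\mathfrak{O}}$, or $\mathcal{C}^2_{\mathfrak{O}}$ for a unique $K$-orbit $\mathfrak{O}$ of the exotic nilpotent cone $\mathfrak{E}$.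
   Context: Everything is over $\mathbb{C}$. Let $V=\mathbb{C}^n$ ($n\ge 1$), $p+q=n$, $V_1=\mathbb{C}^p\times\{0\}^q$, $V_2=\{0\}^p\times\mathbb{C}^q$, so $V=V_1\oplus V_2$. Let $K=\mathrm{GL}(V_1)\times\mathrm{GL}(V_2)\subset\mathrm{GL}(V)$. Let $k\in\{0,\ldots,n\}$; $\mathrm{Gr}_k(V)$ is the Grassmann variety of $k$-dimensional subspaces of $V$ and $\mathbb{P}(V_1)$ is the variety of lines $L\subset V_1$. $\mathcal{L}(V)$ is the space of linear endomorphisms of $V$. For $x=\begin{pmatrix} x_1 & x_{12} \\ x_{21} & x_2 \end{pmatrix}\in\mathcal{L}(V)$ (blocks with respect to $V=V_1\oplus V_2$) put $x^{\theta}=\begin{pmatrix} x_1 & 0 \\ 0 & x_2 \end{pmatrix}$ and $x^{-\theta}=\begin{pmatrix} 0 & x_{12} \\ x_{21} & 0 \end{pmatrix}$. Let $\mathfrak{s}=\{x\in\mathcal{L}(V): x^\theta=0\}$. The conormal variety is $$\mathcal{Y}=\{(W,L,x)\in\mathrm{Gr}_k(V)\times\mathbb{P}(V_1)\times\mathcal{L}(V):\ \mathrm{Im}\,x\subset W\subset\ker x,\ \mathrm{Im}\,x^\theta\subset L\subset\ker x^\theta\},$$ and the exotic nilpotent cone is $\mathfrak{E}=\mathbb{P}(V_1)\times\mathcal{N}(\mathfrak{s})_2^k$, where $\mathcal{N}(\mathfrak{s})_2^k=\{x\in\mathfrak{s}: x^2=0,\ \mathrm{rk}\,x\le\min\{k,n-k\}\}$.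 The map $\pi:\mathcal{Y}\to\mathfrak{E}$, $(W,L,x)\mapsto(L,x^{-\theta})$, is well defined, surjective and $K$-equivariant ($K$ acts naturally on subspaces and by conjugation on $\mathcal{L}(V)$). Parameters. $\Pi_2$ is the set of pairs $((r,s),\mu)$ where $r,s\ge 0$ are integers with $r+s\le\min\{p,q\}$ and $\mu=(\mu_1,\ldots,\mu_{n-(r+s)})$ is a sequence such that: $\mu_1=\cdots=\mu_r=1$; $\mu_{r+1}=\cdots=\mu_{r+s}\in\{0,2\}$; $\mu_{r+s+1}=\cdots=\mu_p\in\{-1,1\}$; $\mu_{p+1}=\cdots=\mu_{n-(r+s)}=0$; at least one $\mu_i$ is $\ge 1$; and $\{-1,2\}\not\subset\{\mu_1,\ldots,\mu_{n-(r+s)}\}$. The element $((r,s),\mu)$ is of type (I) if $\mu_{r+1},\ldots,\mu_p\le 0$; of type (II) if $r+s\ne p$, $\mu_{r+1}=\cdots=\mu_{r+s}=0$ and $\mu_{r+s+1}=\cdots=\mu_p=1$; of type (III) if $s\neq 0$ and $\mu_{r+1}=\cdots=\mu_{r+s}=2$. Let $\Pi_2^k=\{((r,s),\mu)\in\Pi_2: r+s\le\min\{k,n-k\}\}$. An element of $\Pi_2^k$ is of type (II)$^*$ if it is of type (II) and satisfies $q=r+s\le p-2$ and $q<\min\{k,n-k\}$; it is of type (II)$^0$ if it is of type (II) but does not satisfy these relations. For $((r,s),\mu)\in\Pi_2^k$, $\mathfrak{O}^K_{((r,s),\mu)}$ is the set of pairs $\left(L,\begin{pmatrix} 0 & a \\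 b & 0 \end{pmatrix}\right)$ with $L\in\mathbb{P}(V_1)$, $ab=0$, $ba=0$, $\mathrm{rk}\,a=r$, $\mathrm{rk}\,b=s$ and: $L\subset\mathrm{Im}\,a$ if the type is (I); $L\subset\ker b$, $L\not\subset\mathrm{Im}\,a$ if the type is (II); $L\not\subset\ker b$ if the type is (III). It is known that these sets are exactly the $K$-orbits of $\mathfrak{E}$, each arising from a unique element of $\Pi_2^k$. *)

(* Defs.v *)
(* MathComp with MathComp-Analysis.  The field of complex numbers is R[i],
   for R : realType. *)
From HB Require Import structures.
From mathcomp Require Import all_boot all_order all_algebra.
From mathcomp Require Import all_classical all_reals topology.
From mathcomp Require Import complex.
(* The notations of mpoly clash with those of topology. *)
From mathcomp Require Import(canonicals) mpoly.

Set Implicit Arguments.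
Unset Strict Implicit.
Unset Printing Implicit Defensive.

Import Order.TTheory GRing.Theory Num.Theory.
Local Open Scope classical_set_scope.
Local Open Scope ring_scope.

(** * Irreducible components *)

Definition irreducible_set (T : topologicalType) (Z : set T) : Prop :=
  Z !=set0 /\ forall A B : set T, closed A -> closed B ->
    Z `<=` A `|` B -> Z `<=` A \/ Z `<=` B.

Definition irreducible_component (T : topologicalType) (Y Z : set T) : Prop :=
  [/\ Z `<=` Y, irreducible_set Z
    & forall Z' : set T, irreducible_set Z' -> Z' `<=` Y -> Z `<=` Z' ->
        Z' = Z].

(** * Subspaces of V = C^p (+) C^q; vectors are columns *)

Definition mxHom (R : realType) m n (x : 'M[R[i]]_(m, n)) :
    'Hom('cV[R[i]]_n, 'cV[R[i]]_m) := linfun (mulmx x).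

Definition imgV (R : realType) m n (x : 'M[R[i]]_(m, n)) :
  {vspace 'cV[R[i]]_m} := limg (mxHom x).

Definition kerV (R : realType) m n (x : 'M[R[i]]_(m, n)) :
  {vspace 'cV[R[i]]_n} := lker (mxHom x).

(* The inclusion of C^p into V, u |-> (u, 0), with image V_1. *)
Definition incl1 (R : realType) p q : 'M[R[i]]_(p + q, p) := col_mx 1%:M 0.

Definition V1 (R : realType) p q : {vspace 'cV[R[i]]_(p + q)} :=
  imgV (incl1 R p q).

Definition Gr (R : realType) (n k : nat) : Type :=
  {W : {vspace 'cV[R[i]]_n} | \dim W == k}.

Definition PV1 (R : realType) (p q : nat) : Type :=
  {L : {vspace 'cV[R[i]]_(p + q)} | (\dim L == 1)%N && (L <= V1 R p q)%VS}.

(** * The Zariski topology on Gr_k(V) x P(V_1) x L(V) *)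

Definition flag_triple (R : realType) (p q k : nat) : Type :=
  (Gr R (p + q) k * PV1 R p q * 'M[R[i]]_(p + q))%type.

Definition ncoord (p q k : nat) : nat :=
  ((p + q) * k + (p + q) * 1 + (p + q) * (p + q))%N.

Definition coords (R : realType) (p q k : nat) (A : 'M[R[i]]_(p + q, k))
    (v : 'cV[R[i]]_(p + q)) (x : 'M[R[i]]_(p + q)) :
    'I_(ncoord p q k) -> R[i] :=
  row_mx (row_mx (mxvec A) (mxvec v)) (mxvec x) 0.

(* Homogeneous coordinates of (W, L, x) are (A, v, x), where the k columns of A
   form a basis of W and v is a generator of L (as dim W = k and dim L = 1,
   this amounts to imgV A = W and imgV v = L).  A set of triples is closed if
   its inverse image in the space of all such (A, v, x), which is locally closed
   in an affine space, is cut out by polynomials: Gr_k(V) x P(V_1) x L(V) has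
   the quotient topology for the actions of GL_k on A and of GL_1 on v.  This is
   finer than the product of the topologies of the factors. *)
Definition zariski_closed (R : realType) (p q k : nat)
    (Z : set (flag_triple R p q k)) : Prop :=
  exists S : set (mpoly.mpoly (ncoord p q k) R[i]),
    forall (W : Gr R (p + q) k) (L : PV1 R p q) (x : 'M[R[i]]_(p + q))
           (A : 'M[R[i]]_(p + q, k)) (v : 'cV[R[i]]_(p + q)),
      imgV A = val W -> imgV v = val L ->
      (Z (W, L, x) <->
       forall f, S f -> mpoly.meval (coords A v x) f = 0).

Lemma zariski_closed0 (R : realType) (p q k : nat) :
  zariski_closed (@set0 (flag_triple R p q k)).
Proof.
exists (fun f => f = 1) => W L x A v _ _; split => // /(_ 1 erefl) /eqP.
by rewrite mpoly.meval1 oner_eq0.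
Qed.

Lemma zariski_closedU (R : realType) (p q k : nat)
    (Y Z : set (flag_triple R p q k)) :
  zariski_closed Y -> zariski_closed Z -> zariski_closed (Y `|` Z).
Proof.
move=> [S SP] [T TP].
exists [set h | exists f g, [/\ S f, T g & h = f * g]] => W L x A v AW vL.
have {}SP := SP W L x A v AW vL; have {}TP := TP W L x A v AW vL.
split=> [[/SP Y0|/TP Z0] _ [f [g [Sf Tg ->]]]|ST0].
- by rewrite mpoly.mevalM (Y0 f Sf) mul0r.
- by rewrite mpoly.mevalM (Z0 g Tg) mulr0.
have [?|nY] := pselect (Y (W, L, x)); first by left.
right; apply/TP => g Tg; apply: contrapT => g0; apply/nY/SP => f Sf.
have /eqP := ST0 (f * g) (ex_intro _ f (ex_intro _ g (And3 Sf Tg erefl))).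
by rewrite mpoly.mevalM mulf_eq0 => /orP[/eqP|/eqP].
Qed.

Lemma zariski_closed_bigcap (R : realType) (p q k : nat) (I : Type)
    (Z : I -> set (flag_triple R p q k)) :
  (forall i, zariski_closed (Z i)) -> zariski_closed (\bigcap_i Z i).
Proof.
move=> /choice[S SP].
exists (\bigcup_i S i) => W L x A v AW vL; split=> [ZP f [i _]|S0 i _].
  by have /(SP i W L x A v AW vL) := ZP i Logic.I; apply.
by apply/(SP i W L x A v AW vL) => f Sf; apply: S0; exists i.
Qed.

Definition zariski_open (R : realType) (p q k : nat)
  (U : set (flag_triple R p q k)) : Prop := zariski_closed (~` U).

Lemma zariski_openT (R : realType) (p q k : nat) :
  zariski_open (@setT (flag_triple R p q k)).
Proof. by rewrite /zariski_open setCT; exact: zariski_closed0. Qed.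

Lemma zariski_openI (R : realType) (p q k : nat) :
  setI_closed (@zariski_open R p q k).
Proof.
by move=> U U' oU oU'; rewrite /zariski_open setCI; exact: zariski_closedU.
Qed.

Lemma zariski_open_bigU (R : realType) (p q k : nat) (I : Type)
    (U : I -> set (flag_triple R p q k)) :
  (forall i, zariski_open (U i)) -> zariski_open (\bigcup_i U i).
Proof.
by move=> oU; rewrite /zariski_open setC_bigcup; exact: zariski_closed_bigcap.
Qed.

HB.instance Definition _ (R : realType) (p q k : nat) :=
  Choice.on (flag_triple R p q k).
HB.instance Definition _ (R : realType) (p q k : nat) :=
  isOpenTopological.Build (flag_triple R p q k) (@zariski_openT R p q k)
    (@zariski_openI R p q k) (@zariski_open_bigU R p q k).

Lemma closed_zariskiE (R : realType) (p q k : nat)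
    (Z : set (flag_triple R p q k)) :
  closed Z = zariski_closed Z.
Proof. by rewrite -openC /open /= /zariski_open setCK. Qed.

(** * The conormal variety and the exotic nilpotent cone *)

Definition theta (R : realType) (p q : nat) (x : 'M[R[i]]_(p + q)) :
    'M[R[i]]_(p + q) := block_mx (ulsubmx x) 0 0 (drsubmx x).

Definition mtheta (R : realType) (p q : nat) (x : 'M[R[i]]_(p + q)) :
    'M[R[i]]_(p + q) := block_mx 0 (ursubmx x) (dlsubmx x) 0.

Definition conormal (R : realType) (p q k : nat) : set (flag_triple R p q k) :=
  [set t | let: (W, L, x) := t in
    [/\ (imgV x <= val W)%VS, (val W <= kerV x)%VS,
        (imgV (theta x) <= val L)%VS & (val L <= kerV (theta x))%VS]].

Definition exotic_cone (R : realType) (p q k : nat) :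
    set (PV1 R p q * 'M[R[i]]_(p + q)) :=
  [set e | [/\ theta e.2 = 0, e.2 *m e.2 = 0
             & (\rank e.2 <= minn k (p + q - k))%N]].

Definition pi_map (R : realType) (p q k : nat) (t : flag_triple R p q k) :
    PV1 R p q * 'M[R[i]]_(p + q) :=
  let: (W, L, x) := t in (L, mtheta x).

(* The inverse image under the restriction of pi_map to the conormal variety. *)
Definition pi_inv (R : realType) (p q k : nat)
    (O : set (PV1 R p q * 'M[R[i]]_(p + q))) : set (flag_triple R p q k) :=
  @conormal R p q k `&` @pi_map R p q k @^-1` O.

Definition groupK (R : realType) (p q : nat) : set 'M[R[i]]_(p + q) :=
  [set g | exists g1 g2,
    [/\ g1 \in unitmx, g2 \in unitmx & g = block_mx g1 0 0 g2]].

Definition orbitK (R : realType) (p q : nat)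
    (e : PV1 R p q * 'M[R[i]]_(p + q)) : set (PV1 R p q * 'M[R[i]]_(p + q)) :=
  [set e' | exists2 g, @groupK R p q g &
    val e'.1 = (mxHom g @: val e.1)%VS /\ e'.2 = g *m e.2 *m invmx g].

Definition is_orbitK (R : realType) (p q k : nat)
    (O : set (PV1 R p q * 'M[R[i]]_(p + q))) : Prop :=
  exists2 e, @exotic_cone R p q k e & O = orbitK e.

(** * The parameters ((r, s), mu) *)

(* The terms of the sequence mu are numbered from 1. *)
Definition mu_at (mu : seq int) (i : nat) : int := nth 0 mu i.-1.

Definition Pi2 (p q r s : nat) (mu : seq int) : Prop :=
  [/\ (r + s <= minn p q)%N, size mu = (p + q - (r + s))%N,
      [/\ forall i, (1 <= i <= r)%N -> mu_at mu i = 1,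
          exists2 c : int, c = 0 \/ c = 2 &
            forall i, (r + 1 <= i <= r + s)%N -> mu_at mu i = c,
          exists2 c : int, c = -1 \/ c = 1 &
            forall i, (r + s + 1 <= i <= p)%N -> mu_at mu i = c
        & forall i, (p + 1 <= i <= p + q - (r + s))%N -> mu_at mu i = 0],
      exists2 m : int, m \in mu & 1 <= m
    & ~ ((-1 : int) \in mu /\ (2 : int) \in mu)].

Definition typeI (p r : nat) (mu : seq int) : Prop :=
  forall i, (r + 1 <= i <= p)%N -> mu_at mu i <= 0.

Definition typeII (p r s : nat) (mu : seq int) : Prop :=
  [/\ (r + s)%N <> p, forall i, (r + 1 <= i <= r + s)%N -> mu_at mu i = 0
    & forall i, (r + s + 1 <= i <= p)%N -> mu_at mu i = 1].

Definition typeIII (r s : nat) (mu : seq int) : Prop :=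
  s <> 0%N /\ forall i, (r + 1 <= i <= r + s)%N -> mu_at mu i = 2.

Definition Pi2k (p q k r s : nat) (mu : seq int) : Prop :=
  Pi2 p q r s mu /\ (r + s <= minn k (p + q - k))%N.

(* q = r + s <= p - 2, with an integer subtraction, and q < min{k, n - k} *)
Definition star_condition (p q k r s : nat) : Prop :=
  [/\ q = (r + s)%N, (r + s + 2 <= p)%N & (q < minn k (p + q - k))%N].

Definition typeIIstar (p q k r s : nat) (mu : seq int) : Prop :=
  typeII p r s mu /\ star_condition p q k r s.

Definition typeII0 (p q k r s : nat) (mu : seq int) : Prop :=
  typeII p r s mu /\ ~ star_condition p q k r s.

(* For a : C^q -> C^p and b : C^p -> C^q, Im a and ker b are subspaces of C^p,
   viewed in V through incl1. *)
Definition orbit_of (R : realType) (p q r s : nat) (mu : seq int) :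
    set (PV1 R p q * 'M[R[i]]_(p + q)) :=
  [set e | exists (a : 'M[R[i]]_(p, q)) (b : 'M[R[i]]_(q, p)),
    let Ima := (mxHom (incl1 R p q) @: imgV a)%VS in
    let Kerb := (mxHom (incl1 R p q) @: kerV b)%VS in
    [/\ e.2 = block_mx 0 a b 0,
        a *m b = 0 /\ b *m a = 0,
        \rank a = r /\ \rank b = s
      & [/\ typeI p r mu -> (val e.1 <= Ima)%VS,
            typeII p r s mu ->
              (val e.1 <= Kerb)%VS /\ ~~ (val e.1 <= Ima)%VS
          & typeIII r s mu -> ~~ (val e.1 <= Kerb)%VS]]].

(* For an orbit O, the components C_O, C^1_O, C^2_O are the sets C satisfying
   this predicate. *)
Definition component_over (R : realType) (p q k : nat)
    (O : set (PV1 R p q * 'M[R[i]]_(p + q))) (C : set (flag_triple R p q k)) :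
    Prop :=
  irreducible_component (@conormal R p q k) C /\
  C `<=` closure (@pi_inv R p q k O).

(* Main.v *)
Require Import Defs.
From mathcomp Require Import all_boot all_order all_algebra.
From mathcomp Require Import all_classical all_reals topology.
From mathcomp Require Import complex zify.
From mathcomp Require Import(canonicals) mpoly.

(** The group K has finitely many orbits on Gr_k(V) x P(V_1), and the conormal
    variety Y is the disjoint union of the conormal bundles of these orbits. The
    orbit of (W, L) is determined by i = dim (W cap V_1), j = dim (W cap V_2) and
    by the position of L, which lies inside W, or in the projection p_1(W) of W
    to V_1 but not in W, or outside p_1(W). The conormal bundle of the orbit with
    index o = (i, j, position) is called the stratum of o.

    Every stratum is irreducible: K is transitive on the flags (W, L) of given
    index (flag_transitive) and the conormal vectors at (W, L) form a linear space,
    so that two points of a stratum are joined by a rational curve in the stratum,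
    which moves the flag by (1 - s) + s g with g in K and interpolates the conormal
    vectors linearly (irreducible_by_curves, stratum_irreducible).

    No stratum lies in the closure of another one. This is usually seen from
    dimensions, since conormal bundles are Lagrangian. Here it follows from the
    semicontinuity of ranks: if the entries of a matrix Q are polynomials in the
    coordinates of (W, L, x), the condition rk Q <= c is closed (closed_rank_le).
    For a basis (A1, A2) of W, a generator v of L and the blocks x1, a, b of x,
    the ranks of A1, A2, a, b, (a | v), (x1 ; b), x1 A1, x1, b v and the position of
    L have upper bounds on each stratum, and these bounds are attained at an
    explicit point of it (generic_bounds, generic_point). Comparing the bounds of
    two strata shows that they are incomparable (strata_incomparable). So the
    irreducible components of Y are exactly the closures of the strata, one for
    each admissible index (stratum_components, conormal_stratified).

    On the side of the exotic nilpotent cone, the orbit of (L, a, b) is determined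
    by the four ranks of a, b, (a | v), b v (locus_orbit, which rests on
    pair_transitive), and the types (I), (II), (III) correspond to the values
    (r, s, r, 0), (r, s, r + 1, 0), (r, s, r + 1, 1) (type_data). On a stratum these
    four ranks reach their bounds on a nonempty relatively open subset. Hence the
    closure of the stratum of o lies in the closure of the inverse image of an orbit
    if and only if the ranks of this orbit are the bounds generic_data o
    (stratum_pi_dense, component_over_locus).

    The theorem is then a computation with natural numbers: the equation
    generic_data o = type_data T r s has one admissible solution o, except in type
    (II)^*, when q < k < p and r + s = q. Then there is the further solution
    o = (r + k - q, s, Inside) with W = (W cap V_1) + (W cap V_2)
    (strata_I, strata_II, strata_III). *)

Set Implicit Arguments.
Unset Strict Implicit.
Unset Printing Implicit Defensive.

Import Order.TTheory GRing.Theory Num.Theory.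
Local Open Scope classical_set_scope.
Local Open Scope ring_scope.

(** * Matrices of full column rank *)

Lemma row_full_inj (F : fieldType) m n l (X : 'M[F]_(m, n)) (u : 'M[F]_(n, l)) :
  row_full X -> X *m u = 0 -> u = 0.
Proof. by move=> /row_fullP[Y YX] /(congr1 (mulmx Y)); rewrite mulmxA YX mul1mx mulmx0. Qed.

Lemma inj_row_full (F : fieldType) m n (X : 'M[F]_(m, n)) :
  (forall u : 'cV[F]_n, X *m u = 0 -> u = 0) -> row_full X.
Proof.
move=> inj; rewrite /row_full -mxrank_tr -[_ == n]/(row_free X^T) -kermx_eq0.
apply/eqP/row_matrixP => l; rewrite row0; apply: trmx_inj; rewrite trmx0.
apply: inj; apply: trmx_inj.
by rewrite trmx_mul trmxK trmx0 -row_mul mulmx_ker row0.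
Qed.

Lemma row_full_cV (F : fieldType) n (v : 'cV[F]_n) : v != 0 -> row_full v.
Proof.
move=> v0; rewrite /row_full eqn_leq rank_leq_col lt0n.
by apply: contraNneq v0 => /eqP; rewrite mxrank_eq0.
Qed.

(** Gaussian elimination writes X as an invertible matrix times the first m
    columns of the identity; the other columns of that matrix complete X. *)
Lemma complete_basis (F : fieldType) m d (X : 'M[F]_(m + d, m)) :
  row_full X -> exists Z : 'M[F]_(m + d, d), row_mx X Z \in unitmx.
Proof.
move=> /eqP rX.
have XE : X = (col_ebase X *m block_mx (row_ebase X) 0 0 1%:M) *m col_mx 1%:M 0.
  rewrite -{1}[X]mulmx_ebase rX -!mulmxA; congr (_ *m _).
  rewrite mul_block_col !mulmx0 mulmx1 !mul0mx !addr0.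
  rewrite [pid_mx m](_ : _ = col_mx 1%:M 0) ?mul_col_mx ?mul1mx ?mul0mx //.
  by rewrite pid_mx_col.
set g := _ *m block_mx _ _ _ _ in XE.
have gu : g \in unitmx.
  by rewrite unitmx_mul col_ebase_unit unitmxE det_ublock det1 mulr1 -unitmxE row_ebase_unit.
exists (rsubmx g); suff -> : X = lsubmx g by rewrite hsubmxK.
by rewrite {1}XE -{1}[g]hsubmxK mul_row_col mulmx1 mulmx0 addr0.
Qed.

(** GL_n is transitive on linearly independent m-tuples. All the transitivity
    statements below are reduced to this one by choosing adapted bases. *)
Lemma extend_iso (F : fieldType) n m (X Y : 'M[F]_(n, m)) :
  row_full X -> row_full Y -> exists2 g, g \in unitmx & g *m X = Y.
Proof.
move=> fX fY; have le_mn : (m <= n)%N by move: fX => /eqP <-; exact: rank_leq_row.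
move: X Y fX fY; rewrite -(subnKC le_mn) => X Y fX fY.
have [Z uX] := complete_basis fX; have [Z' uY] := complete_basis fY.
exists (row_mx Y Z' *m invmx (row_mx X Z)); first by rewrite unitmx_mul uY unitmx_inv.
have XE : X = row_mx X Z *m col_mx 1%:M 0 by rewrite mul_row_col mulmx1 mulmx0 addr0.
by rewrite [X in _ *m X = Y]XE -mulmxA mulKmx // mul_row_col mulmx1 mulmx0 addr0.
Qed.

Lemma kernel_basis (F : fieldType) m n d (M : 'M[F]_(m, n)) :
  (d + \rank M)%N = n ->
  exists N : 'M[F]_(n, d), [/\ row_full N, M *m N = 0 &
    forall l (u : 'M[F]_(n, l)), M *m u = 0 -> exists c, u = N *m c].
Proof.
move=> dE; have rk : \rank (kermx M^T) = d by rewrite mxrank_ker mxrank_tr; lia.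
move: (row_base (kermx M^T)) (row_base_free (kermx M^T)) (eq_row_base (kermx M^T)).
rewrite rk => B fB eqB; exists B^T; split.
- by rewrite /row_full mxrank_tr.
- apply: trmx_inj; rewrite trmx_mul trmxK trmx0; apply/sub_kermxP; rewrite eqB; exact: submx_refl.
- move=> l u Mu; have /submxP[c ucB] : (u^T <= B)%MS.
    by rewrite eqB; apply/sub_kermxP; rewrite -trmx_mul Mu trmx0.
  by exists c^T; rewrite -trmx_mul -ucB trmxK.
Qed.

Lemma rank_row_mx_mul (F : fieldType) m n l (A : 'M[F]_(m, n)) (U : 'M[F]_(n, l)) :
  \rank (row_mx A (A *m U)) = \rank A.
Proof.
apply/eqP; rewrite eqn_leq; apply/andP; split.
  have -> : row_mx A (A *m U) = A *m row_mx 1%:M U by rewrite mul_mx_row mulmx1.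
  exact: mxrankM_maxl.
have {1}-> : A = row_mx A (A *m U) *m col_mx 1%:M 0.
  by rewrite mul_row_col mulmx1 mulmx0 addr0.
exact: mxrankM_maxl.
Qed.

Lemma rank_row_mx_le (F : fieldType) m n l (A : 'M[F]_(m, n)) (B : 'M[F]_(m, l)) :
  (\rank A <= \rank (row_mx A B))%N.
Proof.
have {1}-> : A = row_mx A B *m col_mx 1%:M 0.
  by rewrite mul_row_col mulmx1 mulmx0 addr0.
exact: mxrankM_maxl.
Qed.

Lemma rank_row_mx_sub (F : fieldType) m n l (A : 'M[F]_(m, n)) (B : 'M[F]_(m, l)) :
  (\rank (row_mx A B) <= \rank A)%N -> exists U, B = A *m U.
Proof.
rewrite -mxrank_tr -[\rank A]mxrank_tr tr_row_mx => le_r.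
have sA : (A^T <= col_mx A^T B^T)%MS by rewrite -addsmxE addsmxSl.
have /submxP[U BU] : (B^T <= A^T)%MS.
  have: (col_mx A^T B^T <= A^T)%MS by rewrite -(geq_leqif (mxrank_leqif_sup sA)).
  by rewrite col_mx_sub => /andP[].
by exists U^T; rewrite -[B]trmxK BU trmx_mul trmxK.
Qed.

Lemma rank_row_cV_le (F : fieldType) m n (A : 'M[F]_(m, n)) (v : 'cV[F]_m) :
  (\rank (row_mx A v) <= (\rank A).+1)%N.
Proof.
rewrite -mxrank_tr tr_row_mx -addsmxE; apply: leq_trans (mxrank_adds_leqif _ _) _.
by rewrite !mxrank_tr -(addn1 (\rank A)) leq_add2l rank_leq_col.
Qed.

Lemma rank_row_cV (F : fieldType) m n (A : 'M[F]_(m, n)) (v : 'cV[F]_m) :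
  (forall u, v <> A *m u) -> \rank (row_mx A v) = (\rank A).+1.
Proof.
move=> nv; apply/eqP; rewrite eqn_leq rank_row_cV_le ltnNge /=.
by apply/negP => /rank_row_mx_sub[u /nv].
Qed.

Lemma rank_col_mx_le (F : fieldType) p q k (A1 : 'M[F]_(p, k)) (A2 : 'M[F]_(q, k)) :
  (\rank (col_mx A1 A2) <= \rank A1 + \rank A2)%N.
Proof. by rewrite -addsmxE; exact: mxrank_adds_leqif. Qed.

Lemma rank_mul_le (F : fieldType) m n m' n' (P : 'M[F]_(m', m)) (M : 'M[F]_(m, n)) (Q : 'M[F]_(n, n')) :
  (\rank (P *m M *m Q) <= \rank M)%N.
Proof. exact: leq_trans (mxrankM_maxl _ _) (mxrankM_maxr _ _). Qed.

Lemma rank_le_mul (F : fieldType) m n m' n' (P : 'M[F]_(m', m)) (M : 'M[F]_(m, n)) (Q : 'M[F]_(n, n'))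
    (X : 'M[F]_(m', n')) : X = P *m M *m Q -> (\rank X <= \rank M)%N.
Proof. by move->; exact: rank_mul_le. Qed.

Lemma rank_col_mx_l (F : fieldType) m m' n (A : 'M[F]_(m, n)) (B : 'M[F]_(m', n)) :
  (\rank A <= \rank (col_mx A B))%N.
Proof. by rewrite -mxrank_tr -[leqRHS]mxrank_tr tr_col_mx rank_row_mx_le. Qed.

Lemma rank_row_mx_r (F : fieldType) m n n' (A : 'M[F]_(m, n)) (B : 'M[F]_(m, n')) :
  (\rank B <= \rank (row_mx A B))%N.
Proof.
apply: (@rank_le_mul _ _ _ _ _ 1%:M _ (col_mx 0 1%:M)).
by rewrite mul1mx mul_row_col mulmx0 mulmx1 add0r.
Qed.

Lemma rank_unit_mul (F : fieldType) m n (g : 'M[F]_m) (A : 'M[F]_(m, n)) :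
  g \in unitmx -> \rank (g *m A) = \rank A.
Proof. by move=> gu; rewrite -mxrank_tr trmx_mul mxrankMfree ?mxrank_tr // row_free_unit unitmx_tr. Qed.

Lemma rank_mul_unit (F : fieldType) m n (A : 'M[F]_(m, n)) (G : 'M[F]_n) :
  G \in unitmx -> \rank (A *m G) = \rank A.
Proof. by move=> Gu; rewrite mxrankMfree // row_free_unit. Qed.

Lemma rV_split (F : fieldType) n (c : 'rV[F]_n) : c != 0 -> exists y, c *m y = 1%:M.
Proof.
move=> c0; apply/row_freeP; rewrite /row_free eqn_leq rank_leq_row lt0n.
by apply: contraNneq c0 => /eqP; rewrite mxrank_eq0.
Qed.

Lemma rank_add1 (F : fieldType) m n (A : 'M[F]_(m, n)) (u : 'cV[F]_m) (c : 'rV[F]_n) :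
  (\rank (A + u *m c)%R <= (\rank A).+1)%N.
Proof.
rewrite (leq_trans (mxrank_add A (u *m c))) // -(addn1 (\rank A)) leq_add2l.
exact: leq_trans (mxrankM_maxl u c) (rank_leq_col u).
Qed.

(** The minors of a matrix are replaced by the determinants of its products
    with all constant matrices P and Q, which avoids the choice of rows and
    columns. *)
Lemma rank_gt_minor (F : fieldType) m n c (M : 'M[F]_(m, n)) : (c < \rank M)%N ->
  exists P Q, \det (P *m M *m Q : 'M[F]_c.+1) != 0.
Proof.
move=> lt_c; exists (pid_mx c.+1 *m invmx (col_ebase M)), (invmx (row_ebase M) *m pid_mx c.+1).
rewrite -[X in _ *m X *m _]mulmx_ebase !mulmxA mulmxKV ?col_ebase_unit //.
rewrite mulmxK ?row_ebase_unit // !mul_pid_mx.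
rewrite (_ : minn _ _ = c.+1); last by have := rank_leq_row M; have := rank_leq_col M; lia.
by rewrite pid_mx_1 det1 oner_neq0.
Qed.

(** * Relative position of a subspace and a line *)

Lemma mulmx_row_full (F : fieldType) m n l (X : 'M[F]_(m, n)) (U : 'M[F]_(n, l)) :
  row_full X -> row_full U -> row_full (X *m U).
Proof.
move=> fX fU; apply: inj_row_full => u; rewrite -mulmxA => /(row_full_inj fX).
exact: row_full_inj.
Qed.

Lemma row_full_row_mx (F : fieldType) m n l (X : 'M[F]_(m, n)) (Y : 'M[F]_(m, l)) :
  row_full X -> row_full Y ->
  (forall (c : 'cV[F]_n) (d : 'cV[F]_l), X *m c + Y *m d = 0 -> X *m c = 0) ->
  row_full (row_mx X Y).
Proof.
move=> fX fY dXY; apply: inj_row_full => u; rewrite -[u]vsubmxK mul_row_col => XY0.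
have Xc := dXY _ _ XY0; move: XY0; rewrite Xc add0r => /(row_full_inj fY) ->.
by rewrite (row_full_inj fX Xc) col_mx0.
Qed.

Lemma row_full_lr (F : fieldType) m n l (X : 'M[F]_(m, n)) (Y : 'M[F]_(m, l)) :
  row_full (row_mx X Y) -> row_full X /\ row_full Y.
Proof.
move=> fXY; split; apply: inj_row_full => u Xu.
  have : row_mx X Y *m col_mx u 0 = 0 by rewrite mul_row_col Xu mulmx0 addr0.
  by move=> /(row_full_inj fXY)/(congr1 usubmx); rewrite col_mxKu raddf0.
have : row_mx X Y *m col_mx 0 u = 0 by rewrite mul_row_col Xu mulmx0 addr0.
by move=> /(row_full_inj fXY)/(congr1 dsubmx); rewrite col_mxKd raddf0.
Qed.

Lemma row_full_row_mxA (F : fieldType) m n1 n2 n3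
    (X : 'M[F]_(m, n1)) (Y : 'M[F]_(m, n2)) (Z : 'M[F]_(m, n3)) :
  row_full (row_mx (row_mx X Y) Z) -> row_full (row_mx X (row_mx Y Z)).
Proof.
move=> fXYZ; apply: inj_row_full => u; rewrite -[u]vsubmxK -[dsubmx u]vsubmxK.
move: (usubmx u) (usubmx _) (dsubmx _) => c d e; rewrite !mul_row_col addrA.
rewrite -mul_row_col -[in X in X -> _]mul_row_col => /(row_full_inj fXYZ) cde0.
have /eqP := cde0; rewrite col_mx_eq0 => /andP[/eqP/eqP]; rewrite col_mx_eq0.
by move=> /andP[/eqP-> /eqP->] /eqP->; rewrite !col_mx0.
Qed.

Lemma extend_free (F : fieldType) k n d (X : 'M[F]_(k, n)) :
  (n + d)%N = k -> row_full X -> exists Z : 'M[F]_(k, d), row_full (row_mx X Z).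
Proof.
move=> Ek; subst k => /complete_basis[Z uZ].
by exists Z; rewrite row_full_unit.
Qed.

Lemma ones_neq0 (F : fieldType) n : (0 < n)%N -> (const_mx 1 : 'cV[F]_n) != 0.
Proof.
case: n => // n _; apply/negP => /eqP/matrixP/(_ ord0 ord0)/eqP.
by rewrite !mxE oner_eq0.
Qed.

(** In the span of the independent columns of X, any nonzero vector is the sum
    of the vectors of a suitable basis. This normal form, coordinates all
    equal to 1, makes sense in every dimension without singling out an index.
    *)
Lemma basis_through (F : fieldType) m n (X : 'M[F]_(m, n)) (c : 'cV[F]_n) :
  row_full X -> c != 0 -> (0 < n)%N /\
  exists2 h : 'M[F]_n, h \in unitmx & X *m c = X *m h *m const_mx 1.
Proof.
move=> fX c0; have n0 : (0 < n)%N.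
  by case: n c {X fX} c0 => // c; rewrite flatmx0 eqxx.
split=> //; have [h hu hc] := extend_iso (row_full_cV (ones_neq0 F n0)) (row_full_cV c0).
by exists h => //; rewrite -hc mulmxA.
Qed.

Lemma row_mx3_inj (F : fieldType) m n1 n2 n3 (X : 'M[F]_(m, n1)) (Y : 'M[F]_(m, n2))
    (Z : 'M[F]_(m, n3)) (c : 'cV[F]_n1) (d : 'cV[F]_n2) (e : 'cV[F]_n3) :
  row_full (row_mx X (row_mx Y Z)) -> X *m c + (Y *m d + Z *m e) = 0 ->
  [/\ c = 0, d = 0 & e = 0].
Proof.
move=> fXYZ; rewrite -!mul_row_col => /(row_full_inj fXYZ)/eqP.
by rewrite !col_mx_eq0 => /and3P[/eqP-> /eqP-> /eqP->].
Qed.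

Lemma row_full_mx3 (F : fieldType) m n1 n2 n3 (X : 'M[F]_(m, n1)) (Y : 'M[F]_(m, n2))
    (Z : 'M[F]_(m, n3)) :
  (forall (c : 'cV[F]_n1) (d : 'cV[F]_n2) (e : 'cV[F]_n3),
    X *m c + (Y *m d + Z *m e) = 0 -> [/\ c = 0, d = 0 & e = 0]) ->
  row_full (row_mx X (row_mx Y Z)).
Proof.
move=> inj; apply: inj_row_full => u; rewrite -[u]vsubmxK -[dsubmx u]vsubmxK.
rewrite !mul_row_col => /inj[-> -> ->]; by rewrite !col_mx0.
Qed.

(** With W spanned by the columns of col_mx A1 A2, the intersection of W with
    V_1 is A1 (ker A2), its intersection with V_2 is A2 (ker A1), and N0 spans
    a complement: W is the sum of these two intersections and of the graph of
    an isomorphism from the span of A1 N0 to the span of A2 N0. *)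
Definition frame (F : fieldType) p q k i j t (A1 : 'M[F]_(p, k)) (A2 : 'M[F]_(q, k))
    (N2 : 'M[F]_(k, i)) (N1 : 'M[F]_(k, j)) (N0 : 'M[F]_(k, t)) : Prop :=
  [/\ A2 *m N2 = 0, A1 *m N1 = 0, row_full (row_mx N2 (row_mx N1 N0)),
      forall u : 'cV[F]_k, A2 *m u = 0 -> exists c, u = N2 *m c
    & forall u : 'cV[F]_k, A1 *m u = 0 -> exists c, u = N1 *m c].

(** The kernels of A1 and A2 are independent because W has dimension k; their
    dimensions are j and i. *)
Lemma adapted_frame (F : fieldType) p q k i j t (A1 : 'M[F]_(p, k)) (A2 : 'M[F]_(q, k)) :
  row_full (col_mx A1 A2) -> (i + \rank A2)%N = k -> (j + \rank A1)%N = k ->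
  (i + (j + t))%N = k ->
  exists (N2 : 'M[F]_(k, i)) (N1 : 'M[F]_(k, j)) (N0 : 'M[F]_(k, t)), frame A1 A2 N2 N1 N0.
Proof.
move=> fA Ei Ej Et; have [N2 [f2 A20 ker2]] := kernel_basis Ei.
have [N1 [f1 A10 ker1]] := kernel_basis Ej.
have f21 : row_full (row_mx N2 N1).
  apply: row_full_row_mx => // c d /eqP; rewrite addr_eq0 => /eqP E.
  have E1 : A1 *m (N2 *m c) = 0 by rewrite E mulmxN mulmxA A10 mul0mx oppr0.
  have E2 : A2 *m (N2 *m c) = 0 by rewrite mulmxA A20 mul0mx.
  by apply: (row_full_inj fA); rewrite mul_col_mx E1 E2 col_mx0.
have [|N0 fN] := @extend_free _ _ _ t _ _ f21; first by lia.
exists N2, N1, N0; split=> //; first exact: row_full_row_mxA.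
- exact: ker2.
- exact: ker1.
Qed.

Lemma frame_free (F : fieldType) p q k i j t (A1 : 'M[F]_(p, k)) (A2 : 'M[F]_(q, k))
    (N2 : 'M[F]_(k, i)) (N1 : 'M[F]_(k, j)) (N0 : 'M[F]_(k, t)) : frame A1 A2 N2 N1 N0 ->
  row_full (row_mx (A1 *m N2) (A1 *m N0)) /\ row_full (row_mx (A2 *m N1) (A2 *m N0)).
Proof.
move=> [A20 A10 fN ker2 ker1]; split; apply: inj_row_full => u;
  rewrite -[u]vsubmxK mul_row_col -!mulmxA -mulmxDr.
- move=> /ker1[c /eqP]; rewrite -subr_eq0 addrAC -addrA -mulmxN => /eqP.
  by case/(row_mx3_inj fN) => -> _ ->; rewrite col_mx0.
- move=> /ker2[c /eqP]; rewrite -subr_eq0 addrC -mulmxN => /eqP.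
  by case/(row_mx3_inj fN) => _ -> ->; rewrite col_mx0.
Qed.

(** The shadow of W is its projection to V_1 along V_2. *)
Inductive position := Inside | InShadow | Outside.

Definition in_subspace (F : fieldType) p q k (A1 : 'M[F]_(p, k)) (A2 : 'M[F]_(q, k))
    (v : 'cV[F]_p) : Prop := exists u, v = A1 *m u /\ A2 *m u = 0.

Definition in_shadow (F : fieldType) p k (A1 : 'M[F]_(p, k)) (v : 'cV[F]_p) : Prop :=
  exists u, v = A1 *m u.

Definition has_position (F : fieldType) p q k (pos : position)
    (A1 : 'M[F]_(p, k)) (A2 : 'M[F]_(q, k)) (v : 'cV[F]_p) : Prop :=
  match pos with
  | Inside => in_subspace A1 A2 v
  | InShadow => in_shadow A1 v /\ ~ in_subspace A1 A2 v
  | Outside => ~ in_shadow A1 v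
  end.

(** In addition to a frame, a normal form for the generator v of L: the sum of
    the basis vectors of W cap V_1, or of the part N0 of the frame, or a new
    independent vector. *)
Lemma placed_frame (F : fieldType) p q k i j t pos
    (A1 : 'M[F]_(p, k)) (A2 : 'M[F]_(q, k)) (v : 'cV[F]_p) :
  row_full (col_mx A1 A2) -> (i + \rank A2)%N = k -> (j + \rank A1)%N = k ->
  (i + (j + t))%N = k -> v != 0 -> has_position pos A1 A2 v ->
  exists (N2 : 'M[F]_(k, i)) (N1 : 'M[F]_(k, j)) (N0 : 'M[F]_(k, t)),
    frame A1 A2 N2 N1 N0 /\
    match pos with
    | Inside => (0 < i)%N /\ v = A1 *m N2 *m const_mx 1
    | InShadow => (0 < t)%N /\ v = A1 *m N0 *m const_mx 1
    | Outside => row_full (row_mx (row_mx (A1 *m N2) (A1 *m N0)) v)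
    end.
Proof.
move=> fA Ei Ej Et v0.
have [N2 [N1 [N0 frN]]] := adapted_frame fA Ei Ej Et.
have [A20 A10 fN ker2 ker1] := frN.
have [f2 /row_full_lr[f1 f0]] := row_full_lr fN.
case: pos => /=.
- move=> [u [vu /ker2[c uc]]].
  have c0 : c != 0 by apply: contraNneq v0 => c0; rewrite vu uc c0 !mulmx0.
  have [i0 [h hu hc]] := basis_through f2 c0.
  exists (N2 *m h), N1, N0; split; last by rewrite -mulmxA -hc vu uc.
  split=> //; first by rewrite mulmxA A20 mul0mx.
  + apply: row_full_mx3 => c' d e; rewrite -mulmxA => /(row_mx3_inj fN)[hc0 -> ->].
    by split=> //; rewrite -[c'](mulKmx hu) hc0 mulmx0.
  + by move=> w /ker2[c' ->]; exists (invmx h *m c'); rewrite -mulmxA mulKVmx.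
- move=> [[u vu] nin].
  have /row_freeP[N' NN'] : row_free (row_mx N2 (row_mx N1 N0)).
    by rewrite /row_free (eqP fN) Et.
  have [c [d [e uE]]] : exists c d e, u = N2 *m c + (N1 *m d + N0 *m e).
    exists (usubmx (N' *m u)), (usubmx (dsubmx (N' *m u))), (dsubmx (dsubmx (N' *m u))).
    by rewrite -!mul_row_col !vsubmxK mulmxA NN' mul1mx.
  have vE : v = A1 *m (N2 *m c + N0 *m e).
    by rewrite vu uE !mulmxDr (mulmxA A1 N1) A10 mul0mx add0r.
  have e0 : e != 0.
    apply/negP => /eqP e0; apply: nin; exists (N2 *m c).
    by split; [rewrite {1}vE e0 mulmx0 addr0 | rewrite mulmxA A20 mul0mx].
  have [t0 [h hu he]] := basis_through f0 e0.
  have /row_fullP[Y Y1] := row_full_cV (ones_neq0 F t0).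
  exists N2, N1, (N0 *m h + N2 *m (c *m Y)); split; last first.
    split=> //; rewrite -mulmxA mulmxDl -he -!mulmxA Y1 mulmx1 addrC.
    by rewrite {1}vE.
  split=> //; apply: row_full_mx3 => c' d' e'.
  rewrite mulmxDl -!mulmxA => E.
  have : N2 *m (c' + c *m (Y *m e')) + (N1 *m d' + N0 *m (h *m e')) = 0.
    by rewrite -E mulmxDr -!addrA; congr (_ + _); rewrite addrC -!addrA.
  move=> /(row_mx3_inj fN)[+ -> he'].
  have -> : e' = 0 by rewrite -[e'](mulKmx hu) he' mulmx0.
  by rewrite !mulmx0 addr0 => ->.
- move=> nsh; exists N2, N1, N0; split=> //.
  have [f20 _] := frame_free frN.
  apply: row_full_row_mx => //; first exact: row_full_cV.
  move=> c d E; have [d0|d0] := eqVneq (d 0 0) 0.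
    by move: E; rewrite [d]mx11_scalar d0 mul_mx_scalar scale0r addr0.
  case: nsh; exists (- (d 0 0)^-1 *: (N2 *m usubmx c + N0 *m dsubmx c)).
  rewrite -scalemxAr mulmxDr !mulmxA -mul_row_col vsubmxK.
  move/eqP: E; rewrite addr_eq0 => /eqP ->.
  by rewrite [d]mx11_scalar mul_mx_scalar mxE scalerN scaleNr opprK scalerA mulVf ?scale1r.
Qed.

(** K acts transitively on the flags of given index: g_1 and g_2 map a placed
    frame of the first flag to one of the second. *)
Lemma flag_transitive (F : fieldType) p q k pos
    (A1 B1 : 'M[F]_(p, k)) (A2 B2 : 'M[F]_(q, k)) (v w : 'cV[F]_p) :
  row_full (col_mx A1 A2) -> row_full (col_mx B1 B2) -> v != 0 -> w != 0 ->
  \rank A1 = \rank B1 -> \rank A2 = \rank B2 ->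
  has_position pos A1 A2 v -> has_position pos B1 B2 w ->
  exists g1 g2 G, [/\ g1 \in unitmx, g2 \in unitmx,
    g1 *m A1 = B1 *m G, g2 *m A2 = B2 *m G & g1 *m v = w].
Proof.
move=> fA fB v0 w0 r1 r2 pA pB.
have le1 := rank_leq_col A1; have le2 := rank_leq_col A2.
have le12 : (k <= \rank A1 + \rank A2)%N by rewrite -{1}(eqP fA) rank_col_mx_le.
pose i := (k - \rank A2)%N; pose j := (k - \rank A1)%N; pose t := (k - (i + j))%N.
have Et : (i + (j + t))%N = k by rewrite /t /i /j; lia.
have EiA : (i + \rank A2)%N = k by rewrite /i; lia.
have EjA : (j + \rank A1)%N = k by rewrite /j; lia.
have EiB : (i + \rank B2)%N = k by rewrite -r2.
have EjB : (j + \rank B1)%N = k by rewrite -r1.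
have [N2 [N1 [N0 [frN plN]]]] := placed_frame fA EiA EjA Et v0 pA.
have [M2 [M1 [M0 [frM plM]]]] := placed_frame fB EiB EjB Et w0 pB.
have [fN20 fN10] := frame_free frN; have [fM20 fM10] := frame_free frM.
have [g2 g2u g2E] := extend_iso fN10 fM10.
have [g1 [g1u g1E g1v]] : exists g1, [/\ g1 \in unitmx,
    g1 *m row_mx (A1 *m N2) (A1 *m N0) = row_mx (B1 *m M2) (B1 *m M0) & g1 *m v = w].
  have [g1 g1u g1E] := extend_iso fN20 fM20.
  move: (g1E); rewrite mul_mx_row => /eq_row_mx[E2 E0].
  case: pos {pA pB} plN plM => [[_ vE] [_ wE]|[_ vE] [_ wE]|fv fw].
  - by exists g1; rewrite {1}vE wE mulmxA E2.
  - by exists g1; rewrite {1}vE wE mulmxA E0.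
  have [h hu] := extend_iso fv fw.
  by rewrite mul_mx_row => /eq_row_mx[hE hv]; exists h.
have [A20 A10 fN _ _] := frN; have [B20 B10 fM _ _] := frM.
have /row_freeP[N' NN'] : row_free (row_mx N2 (row_mx N1 N0)).
  by rewrite /row_free (eqP fN) Et.
have fromN l (X : 'M[F]_(l, k)) : X = X *m row_mx N2 (row_mx N1 N0) *m N'.
  by rewrite -mulmxA NN' mulmx1.
move: g1E g2E; rewrite !mul_mx_row => /eq_row_mx[E2 E0] /eq_row_mx[E1' E0'].
exists g1, g2, (row_mx M2 (row_mx M1 M0) *m N'); split=> //.
- rewrite [LHS]fromN mulmxA !mul_mx_row -!mulmxA E2 E0.
  by rewrite A10 B10 mulmx0.
- rewrite [LHS]fromN mulmxA !mul_mx_row -!mulmxA E1' E0'.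
  by rewrite A20 B20 mulmx0.
Qed.

(** * Pairs (a, b) with ab = ba = 0, together with a line *)

Inductive line_type := In_image | In_kernel | Off_kernel.

(** Since ba = 0, Im a is contained in ker b, so that a line lies in Im a, or
    in ker b but not in Im a, or outside ker b. *)
Definition has_type (F : fieldType) p q (T : line_type) (a : 'M[F]_(p, q)) (b : 'M[F]_(q, p))
    (v : 'cV[F]_p) : Prop :=
  match T with
  | In_image => exists y, v = a *m y
  | In_kernel => b *m v = 0 /\ ~ exists y, v = a *m y
  | Off_kernel => b *m v <> 0
  end.

Lemma image_lift (F : fieldType) m n r (a : 'M[F]_(m, n)) : \rank a = r ->
  exists Y : 'M[F]_(n, r), row_full (a *m Y) /\ forall u : 'cV[F]_n, exists c, a *m u = a *m Y *m c.
Proof.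
move=> ra; subst r; have /row_freeP[D RD] := row_base_free a.
have E : a *m D = col_base a by rewrite -[X in X *m D]mulmx_base -mulmxA RD mulmx1.
exists D; rewrite E; split; first exact: col_base_full.
by move=> u; exists (row_base a *m u); rewrite mulmxA mulmx_base.
Qed.

(** Bases of V_1 and V_2 adapted to Im a <= ker b <= V_1 and Im b <= ker a <=
    V_2, such that a and b map basis vectors to basis vectors or to 0. *)
Definition pair_frame (F : fieldType) p q r s l m (a : 'M[F]_(p, q)) (b : 'M[F]_(q, p))
    (Y : 'M[F]_(q, r)) (X : 'M[F]_(p, s)) (Z : 'M[F]_(p, l)) (Z' : 'M[F]_(q, m)) : Prop :=
  [/\ row_full (row_mx (a *m Y) (row_mx Z X)), row_full (row_mx (b *m X) (row_mx Z' Y)),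
      b *m Z = 0 & a *m Z' = 0].

(** A complement of the span of U in ker b, where X spans a complement of ker
    b. *)
Lemma extend_in_kernel (F : fieldType) p q r s l (b : 'M[F]_(q, p))
    (U : 'M[F]_(p, r)) (X : 'M[F]_(p, s)) :
  row_full U -> row_full (b *m X) -> b *m U = 0 -> \rank b = s -> (r + l + s)%N = p ->
  exists Z : 'M[F]_(p, l), b *m Z = 0 /\ row_full (row_mx U (row_mx Z X)).
Proof.
move=> fU fX bU rb Ep.
have [|N [fN bN kerN]] := @kernel_basis _ _ _ (r + l) b; first by rewrite rb.
have [c Uc] := kerN _ _ bU.
have [|d fcd] := @extend_free _ _ _ l c erefl.
  by apply: inj_row_full => u cu; apply: (row_full_inj fU); rewrite Uc -mulmxA cu mulmx0.
exists (N *m d); rewrite mulmxA bN mul0mx; split=> //.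
apply: row_full_mx3 => u1 u2 u3; rewrite Uc => E.
have u30 : u3 = 0.
  apply: (row_full_inj fX); move/(congr1 (mulmx b)): E.
  by rewrite !mulmxDr !mulmxA bN !mul0mx !add0r mulmx0.
move: E; rewrite u30 mulmx0 addr0 -!mulmxA -mulmxDr => /(row_full_inj fN).
rewrite -mul_row_col => /(row_full_inj fcd)/eqP.
by rewrite col_mx_eq0 => /andP[/eqP-> /eqP->].
Qed.

(** The three cases put v into the part of the basis of V_1 which spans Im a,
    the rest of ker b, or the rest of V_1. *)
Lemma pair_placed_frame (F : fieldType) p q r s l m T (a : 'M[F]_(p, q)) (b : 'M[F]_(q, p))
    (v : 'cV[F]_p) :
  a *m b = 0 -> b *m a = 0 -> \rank a = r -> \rank b = s ->
  (r + l + s)%N = p -> (s + m + r)%N = q -> v != 0 -> has_type T a b v ->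
  exists (Y : 'M[F]_(q, r)) (X : 'M[F]_(p, s)) (Z : 'M[F]_(p, l)) (Z' : 'M[F]_(q, m)),
    pair_frame a b Y X Z Z' /\
    match T with
    | In_image => (0 < r)%N /\ v = a *m Y *m const_mx 1
    | In_kernel => (0 < l)%N /\ v = Z *m const_mx 1
    | Off_kernel => (0 < s)%N /\ v = X *m const_mx 1
    end.
Proof.
move=> ab ba ra rb Ep Eq v0 hT.
have [Y [fY imY]] := image_lift ra; have [X [fX imX]] := image_lift rb.
have baY : b *m (a *m Y) = 0 by rewrite mulmxA ba mul0mx.
have abX : a *m (b *m X) = 0 by rewrite mulmxA ab mul0mx.
case: T hT => /=.
- move=> [y vy]; have [c yc] := imY y.
  have c0 : c != 0 by apply: contraNneq v0 => c0; rewrite vy yc c0 mulmx0.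
  have [r0 [h hu hc]] := basis_through fY c0.
  have fYh : row_full (a *m (Y *m h)).
    by rewrite mulmxA mulmx_row_full // row_full_unit.
  have baYh : b *m (a *m (Y *m h)) = 0 by rewrite mulmxA ba mul0mx.
  have [Z [bZ fZ]] := extend_in_kernel fYh fX baYh rb Ep.
  have [Z' [aZ' fZ']] := extend_in_kernel fX fYh abX ra Eq.
  exists (Y *m h), X, Z, Z'; split; first by [].
  by rewrite mulmxA -hc vy yc.
- move=> [bv nv].
  have fYv : row_full (row_mx (a *m Y) v).
    apply: row_full_row_mx => //; first exact: row_full_cV.
    move=> c d E; have [d0|d0] := eqVneq (d 0 0) 0.
      by move: E; rewrite [d]mx11_scalar d0 mul_mx_scalar scale0r addr0.
    case: nv; exists (- (d 0 0)^-1 *: (Y *m c)).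
    rewrite -scalemxAr mulmxA; move/eqP: E; rewrite addr_eq0 => /eqP ->.
    by rewrite [d]mx11_scalar mul_mx_scalar mxE scalerN scaleNr opprK scalerA mulVf ?scale1r.
  have bYv : b *m row_mx (a *m Y) v = 0 by rewrite mul_mx_row baY bv row_mx0.
  have l0 : (0 < l)%N.
    have := mulmx0_rank_max bYv; rewrite (eqP fYv) rb; lia.
  have [l' lE] : exists l', l = (1 + l')%N by exists l.-1; lia.
  subst l; have [|Z1 [bZ1 fZ1]] := @extend_in_kernel _ _ _ _ _ l' _ _ _ fYv fX bYv rb.
    by lia.
  have [Z' [aZ' fZ']] := extend_in_kernel fX fY abX ra Eq.
  have [Z [bZ fZ [c vc]]] : exists Z : 'M[F]_(p, 1 + l'), [/\ b *m Z = 0,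
      row_full (row_mx (a *m Y) (row_mx Z X)) & exists c, v = Z *m c].
    exists (row_mx v Z1); rewrite mul_mx_row bv bZ1 row_mx0; split=> //.
      apply: row_full_mx3 => u1 u2 u3; rewrite -[u2]vsubmxK mul_row_col.
      rewrite -(addrA (v *m _)) (addrA (a *m Y *m u1)) -(mul_row_col (a *m Y)) => /(row_mx3_inj fZ1)[/eqP + -> ->].
      by rewrite col_mx_eq0 => /andP[/eqP-> /eqP->]; rewrite col_mx0.
    by exists (col_mx 1%:M 0); rewrite mul_row_col mulmx1 mulmx0 addr0.
  have [fZl _] : row_full Z /\ row_full X by have [_ /row_full_lr] := row_full_lr fZ.
  have c0 : c != 0 by apply: contraNneq v0 => c0; rewrite vc c0 mulmx0.
  have [_ [h hu hc]] := basis_through fZl c0.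
  exists Y, X, (Z *m h), Z'; split; last by rewrite -hc.
  split=> //; last by rewrite mulmxA bZ mul0mx.
  apply: row_full_mx3 => u1 u2 u3; rewrite -(mulmxA Z) => /(row_mx3_inj fZ)[-> hu2 ->].
  by split=> //; rewrite -[u2](mulKmx hu) hu2 mulmx0.
- move=> /eqP bv; have [c vc] := imX v.
  have c0 : c != 0 by apply: contraNneq bv => c0; rewrite vc c0 mulmx0.
  have [s0 [h hu hc]] := basis_through fX c0.
  have /row_fullP[R R1] := row_full_cV (ones_neq0 F s0).
  (* The columns of X h represent a basis of V_1 / ker b whose sum is v modulo
     ker b; adding a vector of ker b corrects the sum to v. *)
  pose X' := X *m h + (v - X *m h *m const_mx 1) *m R.
  have bX' : b *m X' = b *m X *m h.
    rewrite mulmxDr !mulmxA mulmxBr vc !mulmxA hc -(mulmxA b) -(mulmxA b) subrr.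
    by rewrite mul0mx addr0 !mulmxA.
  have vX' : v = X' *m const_mx 1.
    by rewrite mulmxDl -mulmxA -[_ *m R *m _]mulmxA R1 mulmx1 mulmxA addrC subrK.
  have fX' : row_full (b *m X') by rewrite bX' mulmx_row_full // row_full_unit.
  have abX' : a *m (b *m X') = 0 by rewrite mulmxA ab mul0mx.
  have [Z [bZ fZ]] := extend_in_kernel fY fX' baY rb Ep.
  have [Z' [aZ' fZ']] := extend_in_kernel fX' fY abX' ra Eq.
  by exists Y, X', Z, Z'.
Qed.

(** The maps g_1 and g_2 between two adapted bases intertwine a with a' and b
    with b', since this can be checked on basis vectors. *)
Lemma pair_transitive (F : fieldType) p q T (a a' : 'M[F]_(p, q)) (b b' : 'M[F]_(q, p))
    (v v' : 'cV[F]_p) :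
  a *m b = 0 -> b *m a = 0 -> a' *m b' = 0 -> b' *m a' = 0 ->
  \rank a = \rank a' -> \rank b = \rank b' -> v != 0 -> v' != 0 ->
  has_type T a b v -> has_type T a' b' v' ->
  exists g1 g2, [/\ g1 \in unitmx, g2 \in unitmx, g1 *m a = a' *m g2,
    g2 *m b = b' *m g1 & g1 *m v = v'].
Proof.
move=> ab ba ab' ba' ra rb v0 v0' hT hT'.
have le1 := mulmx0_rank_max ab; have le2 := mulmx0_rank_max ba.
pose l := (p - (\rank a + \rank b))%N; pose m := (q - (\rank a + \rank b))%N.
have Ep : (\rank a + l + \rank b)%N = p by rewrite /l; lia.
have Eq : (\rank b + m + \rank a)%N = q by rewrite /m; lia.
have [Y [X [Z [Z' [[f1 f2 bZ aZ'] plY]]]]] := pair_placed_frame ab ba erefl erefl Ep Eq v0 hT.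
have [Y' [X' [W [W' [[f1' f2' bW aW'] plY']]]]] :=
  pair_placed_frame ab' ba' (esym ra) (esym rb) Ep Eq v0' hT'.
have [g1 g1u g1E] := extend_iso f1 f1'; have [g2 g2u g2E] := extend_iso f2 f2'.
have /row_freeP[P1 PK1] : row_free (row_mx (a *m Y) (row_mx Z X)).
  by rewrite /row_free (eqP f1); lia.
have /row_freeP[P2 PK2] : row_free (row_mx (b *m X) (row_mx Z' Y)).
  by rewrite /row_free (eqP f2); lia.
have from1 n (M : 'M[F]_(n, p)) : M = M *m row_mx (a *m Y) (row_mx Z X) *m P1.
  by rewrite -mulmxA PK1 mulmx1.
have from2 n (M : 'M[F]_(n, q)) : M = M *m row_mx (b *m X) (row_mx Z' Y) *m P2.
  by rewrite -mulmxA PK2 mulmx1.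
move: (g1E) (g2E); rewrite !mul_mx_row.
move=> /eq_row_mx[g1Y /eq_row_mx[g1Z g1X]] /eq_row_mx[g2X /eq_row_mx[g2Z g2Y]].
exists g1, g2; split=> //.
- rewrite [LHS]from2 [RHS]from2 -2!(mulmxA _ _ (row_mx _ _)); congr (_ *m _).
  rewrite g2E !mul_mx_row !(mulmxA a) ab aZ' !mul0mx !mulmx0 g1Y.
  by rewrite (mulmxA a' b') ab' aW' !mul0mx.
- rewrite [LHS]from1 [RHS]from1 -2!(mulmxA _ _ (row_mx _ _)); congr (_ *m _).
  rewrite g1E !mul_mx_row !(mulmxA b) ba bZ !mul0mx !mulmx0 g2X.
  by rewrite (mulmxA b' a') ba' bW !mul0mx.
- case: T {hT hT'} plY plY' => -[_ ->] [_ ->]; rewrite !mulmxA; first by rewrite -(mulmxA g1) g1Y.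
  + by rewrite g1Z.
  + by rewrite g1X.
Qed.

(** * Conormal vectors in coordinates *)

(** The conditions Im x <= W <= ker x and Im x^theta <= L <= ker x^theta for x
    with blocks x1, a, b, 0. The block V_2 -> V_2 of x vanishes because its
    image lies in the intersection of L with V_2. *)
Definition conormal_blocks (F : fieldType) p q k (A1 : 'M[F]_(p, k)) (A2 : 'M[F]_(q, k))
    (v : 'cV[F]_p) (x1 : 'M[F]_p) (a : 'M[F]_(p, q)) (b : 'M[F]_(q, p)) : Prop :=
  exists (C1 : 'M[F]_(k, p)) (C2 : 'M[F]_(k, q)) (c : 'rV[F]_p),
    [/\ x1 = A1 *m C1 /\ b = A2 *m C1, a = A1 *m C2 /\ A2 *m C2 = 0,
        x1 *m A1 + a *m A2 = 0 /\ b *m A1 = 0, x1 = v *m c & c *m v = 0].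

(** The image of x1 lies in L and, as Im x <= W, in p_1(W). *)
Lemma conormal_outside (F : fieldType) p q k (A1 : 'M[F]_(p, k)) (A2 : 'M[F]_(q, k))
    (v : 'cV[F]_p) x1 a b : conormal_blocks A1 A2 v x1 a b ->
  ~ in_shadow A1 v -> x1 = 0.
Proof.
move=> [C1 [C2 [c [[x1A _] _ _ x1v _]]]] nsh; rewrite x1v.
have [->|c0] := eqVneq c 0; first exact: mulmx0.
have [y cy] := rV_split c0; case: nsh; exists (C1 *m y).
by rewrite mulmxA -x1A x1v -mulmxA cy mulmx1.
Qed.

(** As x kills W, the image of p_1(W) under x1 is contained in a(V_2), hence
    in W, as well as in L. *)
Lemma conormal_not_inside (F : fieldType) p q k (A1 : 'M[F]_(p, k)) (A2 : 'M[F]_(q, k))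
    (v : 'cV[F]_p) x1 a b : conormal_blocks A1 A2 v x1 a b ->
  ~ in_subspace A1 A2 v -> x1 *m A1 = 0.
Proof.
move=> [C1 [C2 [c [_ [aA A20] [E _] x1v _]]]] nin.
move: E; rewrite x1v -mulmxA; have [->|cA0] := eqVneq (c *m A1) 0.
  by rewrite mulmx0.
have [y cy] := rV_split cA0 => /eqP; rewrite addr_eq0 => /eqP E.
case: nin; exists (- (C2 *m (A2 *m y))); split;
  last by rewrite mulmxN (mulmxA A2) A20 mul0mx oppr0.
rewrite mulmxN (mulmxA A1) -aA (mulmxA a) -mulNmx -E.
by rewrite -[LHS]mulmx1 -cy !mulmxA.
Qed.

(** If W = (W cap V_1) + (W cap V_2), then p_1(W) is contained in W, which x
    kills. *)
Lemma conormal_split (F : fieldType) p q k (A1 : 'M[F]_(p, k)) (A2 : 'M[F]_(q, k))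
    (v : 'cV[F]_p) x1 a b : conormal_blocks A1 A2 v x1 a b ->
  row_full (col_mx A1 A2) -> (\rank A1 + \rank A2)%N = k -> x1 *m A1 = 0.
Proof.
move=> [C1 [C2 [c [_ _ [E _] _ _]]]] fA rA.
have [||| N2 [N1 [N0 [A20 A10 fN _ _]]]] :=
  @adapted_frame _ _ _ _ (k - \rank A2) (k - \rank A1) 0 _ _ fA; try lia.
have /row_freeP[N' NN'] : row_free (row_mx N2 (row_mx N1 N0)).
  by rewrite /row_free (eqP fN); lia.
rewrite -[LHS]mulmx1 -NN' mulmxA (thinmx0 N0) !mul_mx_row !mulmx0.
rewrite -(mulmxA x1 A1 N1) A10 mulmx0.
move/eqP: E; rewrite addr_eq0 => /eqP ->.
by rewrite mulNmx -mulmxA A20 mulmx0 oppr0 !row_mx0 mul0mx.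
Qed.

Lemma conormal_rank (F : fieldType) p q k (A1 : 'M[F]_(p, k)) (A2 : 'M[F]_(q, k))
    (v : 'cV[F]_p) x1 a b : conormal_blocks A1 A2 v x1 a b ->
  (\rank a + \rank A2 <= k)%N /\ (\rank b + \rank A1 <= p)%N.
Proof.
move=> [C1 [C2 [c [_ [aA A20] [_ bA] _ _]]]]; split.
  by rewrite aA addnC; apply: leq_trans (mulmx0_rank_max A20); rewrite leq_add2l mxrankM_maxr.
exact: mulmx0_rank_max bA.
Qed.

(** If x1 kills p_1(W), then a kills p_2(W), and both x1 and b kill p_1(W). *)
Lemma conormal_flat (F : fieldType) p q k (A1 : 'M[F]_(p, k)) (A2 : 'M[F]_(q, k))
    (v : 'cV[F]_p) x1 a b : conormal_blocks A1 A2 v x1 a b -> x1 *m A1 = 0 ->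
  (\rank a + \rank A2 <= q)%N /\ (\rank (col_mx x1 b) + \rank A1 <= p)%N.
Proof.
move=> [C1 [C2 [c [_ [aA A20] [E bA] _ _]]]] xA; split; apply: mulmx0_rank_max.
  by move: E; rewrite xA add0r.
by rewrite mul_col_mx xA bA col_mx0.
Qed.

(** The first bound holds because Im a and L are in W cap V_1; the second
    because (a | v) kills the image of col_mx A2 (c A1); the third because L
    <= W allows to change x by a map into L and to put Im b into W cap V_2. *)
Lemma conormal_inside (F : fieldType) p q k (A1 : 'M[F]_(p, k)) (A2 : 'M[F]_(q, k))
    (v : 'cV[F]_p) x1 a b : conormal_blocks A1 A2 v x1 a b -> in_subspace A1 A2 v ->
  [/\ (\rank (row_mx a v) + \rank A2 <= k)%N, (\rank (row_mx a v) + \rank A2 <= q.+1)%N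
    & (\rank b + \rank A1 <= k)%N].
Proof.
move=> [C1 [C2 [c [[x1A bA] [aA A20] [E bA1] x1v _]]]] [d [vd A2d]]; split.
- have -> : row_mx a v = A1 *m row_mx C2 d by rewrite mul_mx_row -aA vd.
  rewrite addnC; apply: leq_trans (_ : \rank A2 + \rank (row_mx C2 d) <= _)%N.
    by rewrite leq_add2l mxrankM_maxr.
  by apply: mulmx0_rank_max; rewrite mul_mx_row A20 A2d row_mx0.
- rewrite -(addn1 q); apply: leq_trans (_ : \rank (row_mx a v) + \rank (col_mx A2 (c *m A1)) <= _)%N.
    by rewrite leq_add2l -mxrank_tr -[leqRHS]mxrank_tr tr_col_mx rank_row_mx_le.
  by apply: mulmx0_rank_max; rewrite mul_row_col addrC mulmxA -x1v.
- have A1Cd : A1 *m (C1 - d *m c) = 0 by rewrite mulmxBr -x1A mulmxA -vd -x1v subrr.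
  have -> : b = A2 *m (C1 - d *m c) by rewrite mulmxBr -bA mulmxA A2d mul0mx subr0.
  rewrite addnC; apply: leq_trans (mulmx0_rank_max A1Cd).
  by rewrite leq_add2l mxrankM_maxr.
Qed.

(** Up to a map of rank one, x maps V_1 to W cap V_2. *)
Lemma conormal_shadow (F : fieldType) p q k (A1 : 'M[F]_(p, k)) (A2 : 'M[F]_(q, k))
    (v : 'cV[F]_p) x1 a b : conormal_blocks A1 A2 v x1 a b -> in_shadow A1 v ->
  b *m v = 0 /\ (\rank (col_mx x1 b) + \rank A1 <= k.+1)%N.
Proof.
move=> [C1 [C2 [c [[x1A bA] [aA A20] [E bA1] x1v _]]]] [d vd]; split.
  by rewrite vd mulmxA bA1 mul0mx.
have A1Cd : A1 *m (C1 - d *m c) = 0 by rewrite mulmxBr -x1A mulmxA -vd -x1v subrr.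
have -> : col_mx x1 b = col_mx A1 A2 *m (C1 - d *m c + d *m c).
  by rewrite subrK mul_col_mx -x1A -bA.
rewrite addnC; apply: leq_trans (_ : (\rank A1 + \rank (C1 - d *m c)%R).+1 <= _)%N; last first.
  by rewrite ltnS; exact: mulmx0_rank_max A1Cd.
by rewrite -addnS leq_add2l (leq_trans (mxrankM_maxr _ _)) // rank_add1.
Qed.

Lemma conormal_x1_zero (F : fieldType) p q k (A1 : 'M[F]_(p, k)) (A2 : 'M[F]_(q, k))
    (v : 'cV[F]_p) a b : conormal_blocks A1 A2 v 0 a b -> (\rank b + \rank A1 <= k)%N.
Proof.
move=> [C1 [C2 [c [[x1A bA] _ _ _ _]]]]; rewrite bA addnC.
apply: leq_trans (mulmx0_rank_max (esym x1A)); by rewrite leq_add2l mxrankM_maxr.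
Qed.

(** * Generic ranks *)

(** The largest rank of a on a stratum: a maps the quotient V_2 / p_2(W), of
    dimension q + i - k, to W cap V_1, of dimension i, except that for L
    inside W it may also be nonzero on the diagonal part of W, with values in
    L. *)
Definition generic_a q k i j pos : nat :=
  if pos is Inside then minn (q + i - k + (i + j < k)) i else minn (q + i - k) i.

(** As for generic_a: V_1 / p_1(W) has dimension p + j - k and W cap V_2 has
    dimension j; in the shadow case b takes values in the sum of W cap V_2 and
    one more line. *)
Definition generic_b p k j pos : nat :=
  if pos is InShadow then minn (p + j - k) j.+1 else minn (p + j - k) j.

Definition generic_av q k i pos : nat :=
  if pos is Inside then minn (q + i - k).+1 i else (minn (q + i - k) i).+1.

Definition generic_bv j pos : nat := if pos is Outside then (0 < j)%N : nat else 0%N.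

(** The upper bounds are sharp by generic_point. *)
Lemma generic_bounds (F : fieldType) p q k i j pos (A1 : 'M[F]_(p, k)) (A2 : 'M[F]_(q, k))
    (v : 'cV[F]_p) x1 a b : row_full (col_mx A1 A2) ->
  (i + \rank A2)%N = k -> (j + \rank A1)%N = k ->
  has_position pos A1 A2 v -> conormal_blocks A1 A2 v x1 a b ->
  [/\ (\rank a <= generic_a q k i j pos)%N, (\rank b <= generic_b p k j pos)%N,
      (\rank (row_mx a v) <= generic_av q k i pos)%N
    & (\rank (b *m v) <= generic_bv j pos)%N].
Proof.
move=> fA Ei Ej hp cn; have [ra rb] := conormal_rank cn.
have rav := rank_row_cV_le a v; have rav' := rank_row_mx_le a v.
have rbv := mxrankM_maxl b v; have rbv1 := rank_leq_col (b *m v).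
have le12 : (k <= \rank A1 + \rank A2)%N by rewrite -{1}(eqP fA) rank_col_mx_le.
rewrite /generic_a /generic_b /generic_av /generic_bv.
case: pos hp => /= [hin|[hsh nin]|nsh].
- have [r1 r2 r3] := conormal_inside cn hin.
  have [bv _] : b *m v = 0 /\ _ := conormal_shadow cn (let: ex_intro u (conj E _) := hin in ex_intro _ u E).
  rewrite bv mxrank0; split=> //; try lia.
  have [lt|] := ltnP (i + j) k; first by lia.
  move=> ge; have E12 : (\rank A1 + \rank A2)%N = k by lia.
  have [r4 _] := conormal_flat cn (conormal_split cn fA E12); lia.
- have [bv r1] := conormal_shadow cn hsh; rewrite bv mxrank0.
  have [r4 r5] := conormal_flat cn (conormal_not_inside cn nin).
  have r6 : (\rank b <= \rank (col_mx x1 b))%N.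
    have {1}-> : b = row_mx 0 1%:M *m col_mx x1 b by rewrite mul_row_col mul0mx add0r mul1mx.
    exact: mxrankM_maxr.
  by split=> //; lia.
- have x10 := conormal_outside cn nsh; rewrite x10 in cn.
  have r1 := conormal_x1_zero cn; have [r4 r5] := conormal_flat cn (mul0mx _ _).
  by split=> //; lia.
Qed.

(** * A point with generic ranks *)

(** The model is W = W_1 + W_2 + graph(T = T) inside V_1 = W_1 + T + E and V_2
    = W_2 + T + E', where W_1, W_2, T, E, E' have the dimensions i, j, t, e,
    e'. *)
Definition model_W1 (F : fieldType) i j t e : 'M[F]_(i + (t + e), i + (j + t)) :=
  col_mx (row_mx 1%:M 0) (col_mx (row_mx 0 (row_mx 0 1%:M)) 0).

Definition model_W2 (F : fieldType) i j t e : 'M[F]_(j + (t + e), i + (j + t)) :=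
  col_mx (row_mx 0 (row_mx 1%:M 0)) (col_mx (row_mx 0 (row_mx 0 1%:M)) 0).

(** All matrices of the model depend on the components vW, vT of v, on a
    linear form (0, xT, xE) on V_1 with x1 = v (0, xT, xE), and on two maps s
    : E' -> W_1 and r : E -> W_2. *)
Definition model_x1 (F : fieldType) i t e (vW : 'cV[F]_i) (vT : 'cV[F]_t)
    (xT : 'rV[F]_t) (xE : 'rV[F]_e) : 'M[F]_(i + (t + e)) :=
  col_mx (row_mx 0 (row_mx (vW *m xT) (vW *m xE))) (col_mx (row_mx 0 (row_mx 0 (vT *m xE))) 0).

Definition model_a (F : fieldType) i j t e e' (vW : 'cV[F]_i) (xT : 'rV[F]_t)
    (s : 'M[F]_(i, e')) : 'M[F]_(i + (t + e), j + (t + e')) :=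
  col_mx (row_mx 0 (row_mx (- (vW *m xT)) s)) 0.

Definition model_b (F : fieldType) i j t e e' (vT : 'cV[F]_t) (xE : 'rV[F]_e)
    (r : 'M[F]_(j, e)) : 'M[F]_(j + (t + e'), i + (t + e)) :=
  col_mx (row_mx 0 (row_mx 0 r)) (col_mx (row_mx 0 (row_mx 0 (vT *m xE))) 0).

Definition mx_blockE := (mul_col_mx, mul_row_col, mul_mx_row, mulmx0, mul0mx, mulmx1, mul1mx,
  addr0, add0r, row_mx0, col_mx0, add_row_mx, add_col_mx).

Lemma model_conormal (F : fieldType) i j t e e' (vW : 'cV[F]_i) (vT : 'cV[F]_t)
    (vE : 'cV[F]_e) (xT : 'rV[F]_t) (xE : 'rV[F]_e) (s : 'M[F]_(i, e')) (r : 'M[F]_(j, e)) :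
  vT *m xT = 0 -> vE *m xT = 0 -> vE *m xE = 0 -> xT *m vT = 0 -> xE *m vE = 0 ->
  conormal_blocks (model_W1 F i j t e) (model_W2 F i j t e') (col_mx vW (col_mx vT vE))
    (model_x1 vW vT xT xE) (model_a j e vW xT s) (model_b i e' vT xE r).
Proof.
move=> TT ET EE TT' EE'.
exists (col_mx (row_mx 0 (row_mx (vW *m xT) (vW *m xE)))
  (col_mx (row_mx 0 (row_mx 0 r)) (row_mx 0 (row_mx 0 (vT *m xE))))).
exists (col_mx (row_mx 0 (row_mx (- (vW *m xT)) s)) 0), (row_mx 0 (row_mx xT xE)).
rewrite /model_W1 /model_W2 /model_x1 /model_a /model_b.
split; [split|split|split| |]; rewrite ?mx_blockE ?TT ?ET ?EE ?TT' ?EE' ?mx_blockE ?subrr ?mx_blockE //.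
Qed.

Lemma model_full (F : fieldType) i j t e e' :
  row_full (col_mx (model_W1 F i j t e) (model_W2 F i j t e')).
Proof.
apply: inj_row_full => u; rewrite -[u]vsubmxK -[dsubmx u]vsubmxK.
move: (usubmx u) (usubmx _) (dsubmx _) => c d f.
rewrite /model_W1 /model_W2 !mx_blockE => /eqP; rewrite !col_mx_eq0.
by move=> /andP[/and3P[/eqP-> /eqP-> _] /andP[/eqP-> _]]; rewrite !col_mx0.
Qed.

Lemma rank_model_W1 (F : fieldType) i j t e :
  (j + \rank (model_W1 F i j t e))%N = (i + (j + t))%N.
Proof.
pose N : 'M[F]_(i + (j + t), j) := col_mx 0 (col_mx 1%:M 0).
have fN : row_full N by apply: inj_row_full => u; rewrite /N !mx_blockE => /eqP;
  rewrite !col_mx_eq0 => /and3P[_ /eqP-> _].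
have N0 : model_W1 F i j t e *m N = 0 by rewrite /model_W1 /N !mx_blockE.
have le1 := mulmx0_rank_max N0; rewrite (eqP fN) in le1.
pose P : 'M[F]_(i + t, i + (t + e)) := block_mx 1%:M 0 0 (row_mx 1%:M 0).
pose Q : 'M[F]_(i + (j + t), i + t) := block_mx 1%:M 0 0 (col_mx 0 1%:M).
have PQ : P *m model_W1 F i j t e *m Q = 1%:M.
  by rewrite /P /Q /model_W1 /block_mx !mx_blockE [RHS]scalar_mx_block.
have := rank_mul_le P (model_W1 F i j t e) Q; rewrite PQ mxrank1; lia.
Qed.

Lemma rank_model_W2 (F : fieldType) i j t e :
  (i + \rank (model_W2 F i j t e))%N = (i + (j + t))%N.
Proof.
pose N : 'M[F]_(i + (j + t), i) := col_mx 1%:M 0.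
have fN : row_full N by apply: inj_row_full => u; rewrite /N !mx_blockE => /eqP;
  rewrite !col_mx_eq0 => /andP[/eqP-> _].
have N0 : model_W2 F i j t e *m N = 0 by rewrite /model_W2 /N !mx_blockE.
have le1 := mulmx0_rank_max N0; rewrite (eqP fN) in le1.
pose P : 'M[F]_(j + t, j + (t + e)) := block_mx 1%:M 0 0 (row_mx 1%:M 0).
pose Q : 'M[F]_(i + (j + t), j + t) := col_mx 0 1%:M.
have PQ : P *m model_W2 F i j t e *m Q = 1%:M.
  by rewrite /P /Q /model_W2 /block_mx !mx_blockE [RHS]scalar_mx_block.
have := rank_mul_le P (model_W2 F i j t e) Q; rewrite PQ mxrank1; lia.
Qed.

(** The sum of all basis vectors is outside the span of the first e of them if
    e < i. *)
Lemma rank_pid_ones (F : fieldType) i e : (0 < i)%N ->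
  (minn e.+1 i <= \rank (row_mx (pid_mx (minn i e) : 'M[F]_(i, e)) (const_mx 1%R : 'cV[F]_i)))%N.
Proof.
move=> i0; have [le_ie|lt_ei] := leqP i e.
  apply: leq_trans (rank_row_mx_le _ _); rewrite rank_pid_mx; lia.
rewrite rank_row_cV ?rank_pid_mx ?(ltnW lt_ei) //; first by lia.
move=> u /matrixP/(_ (Ordinal lt_ei) 0)/eqP; rewrite !mxE big1 ?oner_eq0 // => l _.
by rewrite !mxE /= ltnn andbF mul0r.
Qed.

Lemma rank_pid_ones_tr (F : fieldType) j e : (0 < e)%N ->
  (minn e j.+1 <= \rank (col_mx (pid_mx (minn j e) : 'M[F]_(j, e)) (const_mx 1%R : 'rV[F]_e)))%N.
Proof.
move=> e0; rewrite -mxrank_tr tr_col_mx tr_pid_mx trmx_const minnC [minn j e]minnC.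
exact: rank_pid_ones.
Qed.

Lemma pid_ones_neq0 (F : fieldType) j e : (0 < j)%N -> (0 < e)%N ->
  (pid_mx (minn j e) : 'M[F]_(j, e)) *m (const_mx 1 : 'cV[F]_e) != 0.
Proof.
case: j e => [//|j] [//|e] _ _; apply/negP => /eqP/matrixP/(_ 0 0)/eqP.
rewrite !mxE big_ord_recl big1 ?addr0 => [|l _]; last by rewrite !mxE /= mul0r.
by rewrite !mxE /= minnSS mulr1 oner_eq0.
Qed.

Lemma rank_model_a (F : fieldType) i j t e e' (vW : 'cV[F]_i) (xT : 'rV[F]_t)
    (s : 'M[F]_(i, e')) : (\rank (row_mx (- (vW *m xT))%R s) <= \rank (model_a j e vW xT s))%N.
Proof.
apply: (@rank_le_mul _ _ _ _ _ (row_mx 1%:M 0) _ (col_mx 0 1%:M)).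
by rewrite /model_a !mx_blockE.
Qed.

Lemma rank_model_b (F : fieldType) i j t e e' (vT : 'cV[F]_t) (xE : 'rV[F]_e)
    (r : 'M[F]_(j, e)) : (\rank (col_mx r (vT *m xE)) <= \rank (model_b i e' vT xE r))%N.
Proof.
apply: (@rank_le_mul _ _ _ _ _ (row_mx (col_mx 1%:M 0) (row_mx (col_mx 0 1%:M) 0)) _
  (col_mx 0 (col_mx 0 1%:M))).
by rewrite /model_b !mx_blockE.
Qed.

Lemma ones_row_neq0 (F : fieldType) n : (0 < n)%N -> (const_mx 1 : 'rV[F]_n) != 0.
Proof. by move/(ones_neq0 F); apply: contraNneq => E; rewrite -trmx_const E trmx0. Qed.

(** The last three conditions are the ranks that separate pairs of strata
    which the first four ranks do not separate. *)
Lemma generic_point (F : fieldType) i j t e e' pos :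
  match pos with Inside => 0 < i | InShadow => 0 < t | Outside => 0 < e end%N ->
  exists (v : 'cV[F]_(i + (t + e))) (x1 : 'M[F]_(i + (t + e)))
    (a : 'M[F]_(i + (t + e), j + (t + e'))) (b : 'M[F]_(j + (t + e'), i + (t + e))),
  let A1 := model_W1 F i j t e in let A2 := model_W2 F i j t e' in
  [/\ conormal_blocks A1 A2 v x1 a b, v != 0, has_position pos A1 A2 v,
   [/\ (generic_a (j + (t + e')) (i + (j + t)) i j pos <= \rank a)%N,
       (generic_b (i + (t + e)) (i + (j + t)) j pos <= \rank b)%N,
       (generic_av (j + (t + e')) (i + (j + t)) i pos <= \rank (row_mx a v))%N
     & (generic_bv j pos <= \rank (b *m v))%N]
   & [/\ (pos = Inside -> 0 < t -> 0 < \rank (x1 *m A1))%N,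
         (pos = Inside -> t = 0 -> minn e j.+1 <= \rank (col_mx x1 b))%N
       & (pos <> Outside -> 0 < e -> 0 < \rank x1)%N]].
Proof.
rewrite /generic_a /generic_b /generic_av /generic_bv.
pose s : 'M[F]_(i, e') := pid_mx (minn i e'); pose r : 'M[F]_(j, e) := pid_mx (minn j e).
have rs : \rank s = minn i e' by rewrite rank_pid_mx ?geq_minl ?geq_minr.
have rr : \rank r = minn j e by rewrite rank_pid_mx ?geq_minl ?geq_minr.
case: pos => pos0.
- pose vW : 'cV[F]_i := const_mx 1; pose xT : 'rV[F]_t := const_mx 1.
  pose xE : 'rV[F]_e := const_mx 1; have vW0 : vW != 0 := ones_neq0 F pos0.
  have /row_fullP[R R1] := row_full_cV vW0.
  exists (col_mx vW (col_mx 0 0)), (model_x1 vW 0 xT xE), (model_a j e vW xT s),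
    (model_b i e' 0 xE r).
  set A1 := model_W1 F i j t e; set A2 := model_W2 F i j t e'.
  have rav : (minn e'.+1 i <= \rank (row_mx (model_a j e vW xT s) (col_mx vW (col_mx 0 0))))%N.
    apply: leq_trans (rank_pid_ones F e' pos0) _.
    apply: (@rank_le_mul _ _ _ _ _ (row_mx 1%:M 0) _ (block_mx (col_mx 0 (col_mx 0 1%:M)) 0 0 1%:M)).
    by rewrite /model_a /block_mx !mx_blockE.
  split.
  + by apply: model_conormal; rewrite ?mul0mx ?mulmx0.
  + by rewrite col_mx_eq0 negb_and vW0.
  + exists (col_mx vW 0); rewrite /A1 /A2 /model_W1 /model_W2 !mx_blockE; split=> //.
  + split=> //.
    * have le1 := leq_trans (rank_row_mx_r (- (vW *m xT))%R s) (rank_model_a j e vW xT s).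
      case: (ltnP (i + j) (i + (j + t))) => lt; last by rewrite rs in le1; lia.
      have t0 : (0 < t)%N by lia.
      have [y xy] := rV_split (ones_row_neq0 F t0).
      apply: leq_trans (_ : minn e'.+1 i <= _)%N; first by rewrite /=; lia.
      apply: leq_trans (rank_pid_ones F e' pos0) _.
      apply: leq_trans (_ : \rank (row_mx (- (vW *m xT))%R s) <= _)%N; last exact: rank_model_a.
      apply: (@rank_le_mul _ _ _ _ _ 1%:M _ (block_mx 0 (- y) 1%:M 0)).
      rewrite /block_mx !mx_blockE mulmxN mulNmx opprK -mulmxA xy mulmx1.
      by [].
    * apply: leq_trans (rank_model_b _ _ _ _ _).
      by apply: leq_trans (rank_col_mx_l _ _); rewrite rr; lia.
    * by apply: leq_trans rav; lia.
  + split=> [_ t0|_ t0|_ e0].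
    * rewrite lt0n mxrank_eq0; apply/negP => /eqP/(congr1 usubmx).
      rewrite /A1 /model_x1 /model_W1 !mx_blockE col_mxKu raddf0 => /(congr1 rsubmx).
      rewrite row_mxKr raddf0 => /(congr1 rsubmx); rewrite row_mxKr raddf0.
      move=> /(congr1 (mulmx R)); rewrite mulmxA R1 mul1mx mulmx0 => /eqP.
      by apply/negP; exact: ones_row_neq0.
    * have [e0|e0] := posnP e; first by apply: leq_trans (leq0n _); lia.
      apply: leq_trans (rank_pid_ones_tr F j e0) _.
      apply: (@rank_le_mul _ _ _ _ _ (block_mx 0 (row_mx 1%:M 0) (row_mx R 0) 0) _ (col_mx 0 (col_mx 0 1%:M))).
      by rewrite /block_mx /model_x1 /model_b !mx_blockE mulmxA R1 !mx_blockE.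
    * rewrite lt0n mxrank_eq0; apply/negP => /eqP/(congr1 usubmx).
      rewrite /model_x1 col_mxKu raddf0 => /(congr1 rsubmx).
      rewrite row_mxKr raddf0 => /(congr1 rsubmx); rewrite row_mxKr raddf0.
      move=> /(congr1 (mulmx R)); rewrite mulmxA R1 mul1mx mulmx0 => /eqP.
      by apply/negP; exact: ones_row_neq0.
- pose vT : 'cV[F]_t := const_mx 1.
  pose xE : 'rV[F]_e := const_mx 1; have vT0 : vT != 0 := ones_neq0 F pos0.
  have /row_fullP[R R1] := row_full_cV vT0.
  exists (col_mx 0 (col_mx vT 0)), (model_x1 0 vT 0 xE), (model_a j e 0 0 s),
    (model_b i e' vT xE r).
  set A1 := model_W1 F i j t e; set A2 := model_W2 F i j t e'.
  have ra : (minn i e' <= \rank (model_a j e (0 : 'cV[F]_i) (0 : 'rV[F]_t) s))%N.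
    by apply: leq_trans (rank_model_a _ _ _ _ _); rewrite -rs rank_row_mx_r.
  split.
  + by apply: model_conormal; rewrite ?mul0mx ?mulmx0.
  + by rewrite !col_mx_eq0 !negb_and vT0 orbT.
  + split.
      by exists (col_mx 0 (col_mx 0 vT)); rewrite /A1 /model_W1 !mx_blockE.
    move=> [u]; rewrite -[u]vsubmxK -[dsubmx u]vsubmxK.
    rewrite /A1 /A2 /model_W1 /model_W2 !mx_blockE => -[/eq_col_mx[_ /eq_col_mx[E _]]].
    by move=> /eqP; rewrite !col_mx_eq0 => /and3P[_ /eqP E']; rewrite E E' eqxx in vT0.
  + split=> //; first by apply: leq_trans ra; lia.
    * apply: leq_trans (rank_model_b _ _ _ _ _).
      have [e0|e0] := posnP e; first by apply: leq_trans (leq0n _); lia.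
      apply: leq_trans (_ : minn e j.+1 <= _)%N; first by lia.
      apply: leq_trans (rank_pid_ones_tr F j e0) _.
      apply: (@rank_le_mul _ _ _ _ _ (block_mx 1%:M 0 0 R) _ 1%:M).
      by rewrite /block_mx !mx_blockE mulmxA R1 !mx_blockE.
    * rewrite rank_row_cV; first by apply: leq_trans (_ : (minn i e').+1 <= _)%N => //; lia.
      move=> u; rewrite /model_a !mx_blockE => /eq_col_mx[_ /eqP].
      by rewrite col_mx_eq0 (negbTE vT0).
  + split=> [//|//|_ e0].
    rewrite lt0n mxrank_eq0; apply/negP => /eqP/(congr1 dsubmx).
    rewrite /model_x1 col_mxKd raddf0 => /(congr1 usubmx);
      rewrite col_mxKu raddf0 => /(congr1 rsubmx).
    rewrite row_mxKr raddf0 => /(congr1 rsubmx); rewrite row_mxKr raddf0.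
    move=> /(congr1 (mulmx R)); rewrite mulmxA R1 mul1mx mulmx0 => /eqP.
    by apply/negP; exact: ones_row_neq0.
- pose vE : 'cV[F]_e := const_mx 1; have vE0 : vE != 0 := ones_neq0 F pos0.
  exists (col_mx 0 (col_mx 0 vE)), (model_x1 0 0 0 0), (model_a j e 0 0 s),
    (model_b i e' 0 0 r).
  set A1 := model_W1 F i j t e; set A2 := model_W2 F i j t e'.
  have ra : (minn i e' <= \rank (model_a j e (0 : 'cV[F]_i) (0 : 'rV[F]_t) s))%N.
    by apply: leq_trans (rank_model_a _ _ _ _ _); rewrite -rs rank_row_mx_r.
  split.
  + by apply: model_conormal; rewrite ?mul0mx ?mulmx0.
  + by rewrite !col_mx_eq0 !negb_and vE0 !orbT.
  + move=> [u]; rewrite -[u]vsubmxK -[dsubmx u]vsubmxK.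
    rewrite /A1 /A2 /model_W1 /model_W2 !mx_blockE => /eq_col_mx[_ /eq_col_mx[_ E]].
    by rewrite E eqxx in vE0.
  + split=> //; first by apply: leq_trans ra; lia.
    * apply: leq_trans (rank_model_b _ _ _ _ _).
      by apply: leq_trans (rank_col_mx_l _ _); rewrite rr; lia.
    * rewrite rank_row_cV; first by apply: leq_trans (_ : (minn i e').+1 <= _)%N => //; lia.
      move=> u; rewrite /model_a !mx_blockE => /eq_col_mx[_ /esym/eqP].
      by rewrite eq_sym col_mx_eq0 (negbTE vE0) andbF.
    * have [//|j0] := posnP j; rewrite lt0n mxrank_eq0.
      apply/negP; rewrite /model_b !mx_blockE col_mx_eq0 => /andP[E _].
      by move: E; apply/negP; exact: pid_ones_neq0.
  + by split.
Qed.

(** * Irreducible components of a stratified space *)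

Lemma closure_min (T : topologicalType) (A F : set T) :
  closed F -> A `<=` F -> closure A `<=` F.
Proof. by move=> cF AF; rewrite ((closure_id F).1 cF); exact: closure_subset. Qed.

Lemma closed_finite_union (T : topologicalType) (I : Type) (s : seq I) (F : I -> set T) :
  (forall o, closed (F o)) -> closed [set z | exists2 o, List.In o s & F o z].
Proof.
move=> cF; elim: s => [|o s IH].
  rewrite (_ : [set _ | _] = set0); first exact: closed0.
  by rewrite predeqE => z; split=> [[]|].
rewrite (_ : [set _ | _] = F o `|` [set z | exists2 o, List.In o s & F o z]).
  exact: closedU.
rewrite predeqE => z; split=> [[o' /= [<-|ro'] Fz]|[Fz|[o' ro' Fz]]].
- by left.
- by right; exists o'.
- by exists o => //=; left.
- by exists o' => //=; right.
Qed.

Lemma irreducible_cover (T : topologicalType) (Z : set T) (I : Type) (s : seq I) (F : I -> set T) :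
  irreducible_set Z -> (forall o, closed (F o)) ->
  Z `<=` [set z | exists2 o, List.In o s & F o z] -> exists o, Z `<=` F o.
Proof.
move=> [[z0 Zz0] irr] cF; elim: s => [|o s IH] cov; first by have [] := cov _ Zz0.
have [|ZF|/IH//] := irr (F o) _ (cF o) (closed_finite_union (s := s) cF).
- move=> z /cov[o' /= [<-|ro'] Fz]; first by left.
  by right; exists o'.
- by exists o.
Qed.

Lemma irreducible_between (T : topologicalType) (S Z : set T) :
  irreducible_set S -> S `<=` Z -> Z `<=` closure S -> irreducible_set Z.
Proof.
move=> [[z Sz] irr] SZ ZS; split; first by exists z; exact: SZ.
move=> A B cA cB ZAB.
by have [SA|SB] := irr A B cA cB (subset_trans SZ ZAB); [left|right];
  apply: subset_trans ZS _; exact: closure_min.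
Qed.

(** Finitely many irreducible strata, none of which lies in the closure of
    another one. The sequence s lists the possible indices and V selects those
    which occur. *)
Definition stratification (T : topologicalType) (I : Type) (Y : set T) (s : seq I)
    (V : I -> Prop) (S : I -> set T) : Prop :=
  [/\ forall z, Y z <-> exists o, V o /\ S o z,
      forall o, V o -> List.In o s, forall o, V o -> irreducible_set (S o)
    & forall o o', V o -> V o' -> S o `<=` closure (S o') -> o = o'].

(** Since X meets finitely many strata, its closure is the union of the
    closures of the intersections. *)
Lemma stratum_cover (T : topologicalType) (I : Type) (Y : set T) (s : seq I)
    (V : I -> Prop) (S : I -> set T) (Z X : set T) :
  stratification Y s V S -> irreducible_set Z -> X `<=` Y -> Z `<=` closure X ->
  exists2 o, V o & Z `<=` closure (S o `&` X).
Proof.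
move=> [YE sV _ _] irrZ XY ZX.
pose F o := closure (S o `&` X `&` [set _ | V o]).
have cF o : closed (F o) by exact: closed_closure.
have [|o ZF] := irreducible_cover (s := s) irrZ cF.
  apply: subset_trans ZX _; apply: closure_min; first exact: closed_finite_union.
  move=> z Xz; have [o [Vo Soz]] := (YE z).1 (XY _ Xz).
  by exists o; [exact: sV|exact: subset_closure].
have Vo : V o.
  have [[z /ZF Fz] _] := irrZ; apply: contrapT => nV; move: Fz; rewrite /F.
  rewrite (_ : _ `&` _ = set0) ?closure0 // predeqE => w; split=> // -[_ /nV].
  by [].
by exists o => //; apply: subset_trans ZF _; apply: closure_subset => w [].
Qed.

Lemma stratum_in_space (T : topologicalType) (I : Type) (Y : set T) (s : seq I)
    (V : I -> Prop) (S : I -> set T) o :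
  stratification Y s V S -> V o -> S o `<=` Y `&` closure (S o).
Proof.
move=> [YE _ _ _] Vo z Sz; split; last exact: subset_closure.
by apply/YE; exists o.
Qed.

Lemma stratum_components (T : topologicalType) (I : Type) (Y : set T) (s : seq I)
    (V : I -> Prop) (S : I -> set T) (C : set T) :
  stratification Y s V S ->
  irreducible_component Y C <-> exists2 o, V o & C = Y `&` closure (S o).
Proof.
move=> st; have [YE sV irrS incS] := st.
have irrC o : V o -> irreducible_set (Y `&` closure (S o)).
  move=> Vo; apply: irreducible_between (irrS o Vo) (stratum_in_space st Vo) _.
  by move=> z [].
have in_stratum Z : irreducible_set Z -> Z `<=` Y ->
    exists2 o, V o & Z `<=` Y `&` closure (S o).
  move=> irrZ ZY; have [o Vo Zo] := stratum_cover st irrZ ZY (@subset_closure _ Z).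
  exists o => // z Zz; split; first exact: ZY.
  by apply: closure_subset (Zo _ Zz) => w [].
split=> [[CY irr maxC]|[o Vo ->]].
  have [o Vo Co] := in_stratum C irr CY.
  by exists o => //; rewrite (maxC _ (irrC o Vo)) // => z [].
split; [by move=> z []|exact: irrC|move=> Z irrZ ZY sZ].
have [o' Vo' Zo'] := in_stratum Z irrZ ZY.
have oo' : o = o'.
  by apply: incS => // z Sz; have [] := Zo' z (sZ _ (stratum_in_space st Vo Sz)).
by rewrite eqEsubset; split=> //; rewrite oo'.
Qed.

Lemma stratum_closure_inj (T : topologicalType) (I : Type) (Y : set T) (s : seq I)
    (V : I -> Prop) (S : I -> set T) o o' :
  stratification Y s V S -> V o -> V o' ->
  Y `&` closure (S o) = Y `&` closure (S o') -> o = o'.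
Proof.
move=> st Vo Vo' E; have [_ _ _ incS] := st; apply: incS => // z Sz.
by have := stratum_in_space st Vo Sz; rewrite E => -[].
Qed.

(** The stratum meets X densely: otherwise it would be in the closure of the
    part of X in another stratum. *)
Lemma stratum_closure_sub (T : topologicalType) (I : Type) (Y : set T) (s : seq I)
    (V : I -> Prop) (S : I -> set T) (X : set T) o :
  stratification Y s V S -> V o -> X `<=` Y ->
  Y `&` closure (S o) `<=` closure X <-> S o `<=` closure (S o `&` X).
Proof.
move=> st Vo XY; have [_ _ irrS incS] := st; split=> [sub|sub].
  have [|o' Vo' So'] := stratum_cover st (irrS o Vo) XY.
    by apply: subset_trans sub; exact: stratum_in_space st Vo.
  suff oo' : o = o' by rewrite {2}oo'.
  apply: incS => //; apply: subset_trans So' _.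
  by apply: closure_subset => w [].
move=> z [_ Sz]; apply: closure_min (@closed_closure _ X) _ _ Sz.
by apply: subset_trans sub _; apply: closure_subset => w [].
Qed.

(** * Images and kernels of matrices *)

Lemma mxHomE (R : realType) m n (X : 'M[R[i]]_(m, n)) (u : 'cV[R[i]]_n) : mxHom X u = X *m u.
Proof. by rewrite lfunE. Qed.

Lemma memv_imgVP (R : realType) m n (X : 'M[R[i]]_(m, n)) (u : 'cV[R[i]]_m) :
  reflect (exists c, u = X *m c) (u \in imgV X).
Proof.
apply: (iffP memv_imgP) => [[c _ ->]|[c ->]].
  by exists c; rewrite mxHomE.
by exists c; rewrite ?memvf ?mxHomE.
Qed.

Lemma imgV_subP (R : realType) m n l (X : 'M[R[i]]_(m, n)) (Y : 'M[R[i]]_(m, l)) :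
  reflect (exists G, Y = X *m G) (imgV Y <= imgV X)%VS.
Proof.
apply: (iffP subvP) => [sYX|[G ->] u /memv_imgVP[c ->]]; last first.
  by apply/memv_imgVP; exists (G *m c); rewrite mulmxA.
have /choice[c cE] j : exists c, col j Y = X *m c.
  apply/memv_imgVP/sYX/memv_imgVP; exists (delta_mx j 0); exact: colE.
exists (\matrix_(i, j) c j i 0); apply/matrixP => i j.
have /matrixP/(_ i 0) := cE j; rewrite !mxE => ->.
by apply: eq_bigr => l' _; rewrite !mxE.
Qed.

Lemma sub_kerV (R : realType) m n l (X : 'M[R[i]]_(m, n)) (Y : 'M[R[i]]_(n, l)) :
  (imgV Y <= kerV X)%VS <-> X *m Y = 0.
Proof.
split=> [/subvP sub|XY]; last first.
  by apply/subvP => u /memv_imgVP[c ->]; rewrite memv_ker mxHomE mulmxA XY mul0mx.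
apply/matrixP => i j.
have : col j Y \in kerV X.
  by apply/sub/memv_imgVP; exists (delta_mx j 0); exact: colE.
by rewrite memv_ker mxHomE colE mulmxA -colE => /eqP/matrixP/(_ i 0); rewrite !mxE.
Qed.

Lemma exists_imgV (R : realType) m (W : {vspace 'cV[R[i]]_m}) d : \dim W = d ->
  exists X : 'M[R[i]]_(m, d), imgV X = W.
Proof.
move=> <-; exists (\matrix_(i, j) (vbasis W)`_j i 0).
have E c : (\matrix_(i < m, j < \dim W) (vbasis W)`_j i 0) *m c = \sum_j c j 0 *: (vbasis W)`_j.
  apply/colP => i; rewrite mxE summxE; apply: eq_bigr => j _.
  by rewrite !mxE mulrC.
apply/eqP; rewrite eqEsubv; apply/andP; split; apply/subvP => u.
  move=> /memv_imgVP[c ->]; rewrite E; apply: rpred_sum => j _; apply: rpredZ.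
  by apply: vbasis_mem; rewrite mem_nth // size_tuple.
move=> /coord_vbasis ->; apply/memv_imgVP.
by exists (\col_j coord (vbasis W) j u); rewrite E; apply: eq_bigr => j _; rewrite mxE.
Qed.

Lemma dim_imgV (R : realType) m n (X : 'M[R[i]]_(m, n)) : \dim (imgV X) = \rank X.
Proof.
have -> : imgV X = imgV (col_base X).
  apply/eqP; rewrite eqEsubv; apply/andP; split; apply/imgV_subP.
    by exists (row_base X); rewrite mulmx_base.
  have /row_freeP[D RD] := row_base_free X.
  by exists D; rewrite -[X in X *m D]mulmx_base -mulmxA RD mulmx1.
rewrite /imgV limg_dim_eq ?dimvf /dim /= ?muln1 //.
apply/eqP; rewrite -subv0; apply/subvP => u; rewrite memv_cap memvf memv_ker mxHomE /=.
by move=> /eqP/(row_full_inj (col_base_full X)) ->; rewrite mem0v.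
Qed.

(** * Polynomial functions *)

(** This is used for polynomial functions on the space of coordinates (A, v,
    x) and for polynomial functions of one variable. *)
Definition function_algebra (T : Type) (F : fieldType) (P : (T -> F) -> Prop) : Prop :=
  [/\ forall c, P (fun=> c), forall f g, P f -> P g -> P (fun z => f z + g z)
    & forall f g, P f -> P g -> P (fun z => f z * g z)].

Definition mx_in (T : Type) (F : fieldType) (P : (T -> F) -> Prop) m n
  (M : T -> 'M[F]_(m, n)) : Prop := forall i j, P (fun z => M z i j).

Lemma function_algebra_sum (T : Type) (F : fieldType) (P : (T -> F) -> Prop)
    (I : Type) (r : seq I) (f : I -> T -> F) :
  function_algebra P -> (forall i, P (f i)) -> P (fun z => \sum_(i <- r) f i z).
Proof.
move=> [Pc PD _] Pf; elim: r => [|i r IH].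
  by rewrite (_ : (fun _ => _) = fun=> 0) // funeqE => z; rewrite big_nil.
rewrite (_ : (fun _ => _) = fun z => f i z + \sum_(j <- r) f j z); first exact: PD.
by rewrite funeqE => z; rewrite big_cons.
Qed.

Lemma function_algebra_prod (T : Type) (F : fieldType) (P : (T -> F) -> Prop)
    (I : Type) (r : seq I) (f : I -> T -> F) :
  function_algebra P -> (forall i, P (f i)) -> P (fun z => \prod_(i <- r) f i z).
Proof.
move=> [Pc _ PM] Pf; elim: r => [|i r IH].
  by rewrite (_ : (fun _ => _) = fun=> 1) // funeqE => z; rewrite big_nil.
rewrite (_ : (fun _ => _) = fun z => f i z * \prod_(j <- r) f j z); first exact: PM.
by rewrite funeqE => z; rewrite big_cons.
Qed.

Lemma function_algebra_exp (T : Type) (F : fieldType) (P : (T -> F) -> Prop)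
    (f : T -> F) d : function_algebra P -> P f -> P (fun z => f z ^+ d).
Proof.
move=> [Pc _ PM] Pf; elim: d => [|d IH]; first exact: Pc.
by under eq_fun do rewrite exprS; exact: PM.
Qed.

Lemma mx_in_const (T : Type) (F : fieldType) (P : (T -> F) -> Prop) m n (M : 'M[F]_(m, n)) :
  function_algebra P -> mx_in P (fun=> M).
Proof. by move=> [Pc _ _] i j; exact: Pc. Qed.

Lemma mx_in_mul (T : Type) (F : fieldType) (P : (T -> F) -> Prop) m n l
    (M : T -> 'M[F]_(m, n)) (N : T -> 'M[F]_(n, l)) :
  function_algebra P -> mx_in P M -> mx_in P N -> mx_in P (fun z => M z *m N z).
Proof.
move=> PA PM PN i j; rewrite (_ : (fun _ => _) = fun z => \sum_l M z i l * N z l j).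
  by apply: function_algebra_sum => // l'; have [_ _] := PA; apply; [exact: PM|exact: PN].
by rewrite funeqE => z; rewrite mxE.
Qed.

Lemma mx_in_add (T : Type) (F : fieldType) (P : (T -> F) -> Prop) m n
    (M N : T -> 'M[F]_(m, n)) :
  function_algebra P -> mx_in P M -> mx_in P N -> mx_in P (fun z => M z + N z).
Proof.
move=> [_ PD _] PM PN i j; rewrite (_ : (fun _ => _) = fun z => M z i j + N z i j).
  by apply: PD; [exact: PM|exact: PN].
by rewrite funeqE => z; rewrite mxE.
Qed.

Lemma mx_in_scale (T : Type) (F : fieldType) (P : (T -> F) -> Prop) m n
    (f : T -> F) (M : T -> 'M[F]_(m, n)) :
  function_algebra P -> P f -> mx_in P M -> mx_in P (fun z => f z *: M z).
Proof.
move=> [_ _ PP] Pf PM i j; rewrite (_ : (fun _ => _) = fun z => f z * M z i j).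
  by apply: PP => //; exact: PM.
by rewrite funeqE => z; rewrite mxE.
Qed.

Lemma mx_in_row (T : Type) (F : fieldType) (P : (T -> F) -> Prop) m n n'
    (M : T -> 'M[F]_(m, n)) (N : T -> 'M[F]_(m, n')) :
  mx_in P M -> mx_in P N -> mx_in P (fun z => row_mx (M z) (N z)).
Proof.
move=> PM PN i j; case: (split_ordP j) => l ->.
  by under eq_fun do rewrite row_mxEl; exact: PM.
by under eq_fun do rewrite row_mxEr; exact: PN.
Qed.

Lemma mx_in_col (T : Type) (F : fieldType) (P : (T -> F) -> Prop) m m' n
    (M : T -> 'M[F]_(m, n)) (N : T -> 'M[F]_(m', n)) :
  mx_in P M -> mx_in P N -> mx_in P (fun z => col_mx (M z) (N z)).
Proof.
move=> PM PN i j; case: (split_ordP i) => l ->.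
  by under eq_fun do rewrite col_mxEu; exact: PM.
by under eq_fun do rewrite col_mxEd; exact: PN.
Qed.

Lemma mx_in_usubmx (T : Type) (F : fieldType) (P : (T -> F) -> Prop) m1 m2 n
    (M : T -> 'M[F]_(m1 + m2, n)) : mx_in P M -> mx_in P (fun z => usubmx (M z)).
Proof. by move=> PM i j; under eq_fun do rewrite mxE; exact: PM. Qed.

Lemma mx_in_dsubmx (T : Type) (F : fieldType) (P : (T -> F) -> Prop) m1 m2 n
    (M : T -> 'M[F]_(m1 + m2, n)) : mx_in P M -> mx_in P (fun z => dsubmx (M z)).
Proof. by move=> PM i j; under eq_fun do rewrite mxE; exact: PM. Qed.

Lemma mx_in_lsubmx (T : Type) (F : fieldType) (P : (T -> F) -> Prop) m n1 n2
    (M : T -> 'M[F]_(m, n1 + n2)) : mx_in P M -> mx_in P (fun z => lsubmx (M z)).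
Proof. by move=> PM i j; under eq_fun do rewrite mxE; exact: PM. Qed.

Lemma mx_in_rsubmx (T : Type) (F : fieldType) (P : (T -> F) -> Prop) m n1 n2
    (M : T -> 'M[F]_(m, n1 + n2)) : mx_in P M -> mx_in P (fun z => rsubmx (M z)).
Proof. by move=> PM i j; under eq_fun do rewrite mxE; exact: PM. Qed.

Lemma mx_in_mxvec (T : Type) (F : fieldType) (P : (T -> F) -> Prop) m n
    (M : T -> 'M[F]_(m, n)) : mx_in P M -> mx_in P (fun z => mxvec (M z)).
Proof.
move=> PM i j; rewrite (ord1 i); case/mxvec_indexP: j => l l'.
by under eq_fun do rewrite mxvecE; exact: PM.
Qed.

Lemma function_algebra_det (T : Type) (F : fieldType) (P : (T -> F) -> Prop) n
    (M : T -> 'M[F]_n) : function_algebra P -> mx_in P M -> P (fun z => \det (M z)).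
Proof.
move=> PA PM; apply: (function_algebra_sum _ PA) => s.
have [Pc _ PP] := PA; apply: PP; first exact: Pc.
by apply: (function_algebra_prod _ PA) => i; exact: PM.
Qed.

Lemma mx_in_adj (T : Type) (F : fieldType) (P : (T -> F) -> Prop) n
    (M : T -> 'M[F]_n) : function_algebra P -> mx_in P M -> mx_in P (fun z => \adj (M z)).
Proof.
move=> PA PM i j; under eq_fun do rewrite mxE /cofactor.
have [Pc _ PP] := PA; apply: PP; first exact: Pc.
apply: function_algebra_det => // i' j'.
by under eq_fun do rewrite !mxE; exact: PM.
Qed.

Lemma function_algebra_meval (T : Type) (F : fieldType) (P : (T -> F) -> Prop) n
    (c : T -> 'I_n -> F) (f : mpoly.mpoly n F) :
  function_algebra P -> (forall i, P (fun z => c z i)) -> P (fun z => mpoly.meval (c z) f).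
Proof.
move=> PA Pc'; under eq_fun do rewrite mpoly.mevalE.
apply: (function_algebra_sum _ PA) => m.
have [Pc _ PP] := PA; apply: PP; first exact: Pc.
apply: (function_algebra_prod _ PA) => i.
exact: function_algebra_exp.
Qed.

(** * Closed conditions on a flag and a matrix *)

Definition lift (R : realType) p q k (t : flag_triple R p q k)
    (A : 'M[R[i]]_(p + q, k)) (v : 'cV[R[i]]_(p + q)) : Prop :=
  imgV A = val t.1.1 /\ imgV v = val t.1.2.

Lemma exists_lift (R : realType) p q k (t : flag_triple R p q k) : exists A v, lift t A v.
Proof.
case: t => -[W L] x; have /eqP dW := valP W; have /andP[/eqP dL _] := valP L.
have [A AW] := exists_imgV dW; have [v vL] := exists_imgV dL.
by exists A, v.
Qed.

(** Two systems of homogeneous coordinates of a flag differ by GL_k and GL_1.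
    *)
Lemma lift_change (R : realType) p q k (t : flag_triple R p q k) A v A' v' :
  lift t A v -> lift t A' v' ->
  exists (G : 'M[R[i]]_k) (c : R[i]), [/\ G \in unitmx, c != 0, A' = A *m G & v' = c *: v].
Proof.
case: t => -[W L] x [/= AW vL] [/= AW' vL'].
have /eqP dW := valP W; have /andP[/eqP dL _] := valP L.
have [G AG] : exists G, A' = A *m G by apply/imgV_subP; rewrite AW AW'.
have [c vc] : exists c, v' = v *m c by apply/imgV_subP; rewrite vL vL'.
have rA : \rank A' = k by rewrite -dim_imgV AW' dW.
have v'0 : v' != 0.
  by rewrite -mxrank_eq0 -dim_imgV vL' dL.
exists G, (c 0 0); split=> //.
- rewrite -row_full_unit /row_full eqn_leq rank_leq_col /= -{1}rA AG.
  exact: mxrankM_maxr.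
- by apply: contraNneq v'0 => c0; rewrite vc [c]mx11_scalar c0 mul_mx_scalar scale0r.
- by rewrite vc [c]mx11_scalar mul_mx_scalar mxE eqxx mulr1n.
Qed.

Lemma lift_scale (R : realType) p q k (t : flag_triple R p q k) A v
    (G : 'M[R[i]]_k) (c : R[i]) :
  lift t A v -> G \in unitmx -> c != 0 -> lift t (A *m G) (c *: v).
Proof.
move=> [EA Ev] Gu c0; rewrite /lift -EA -Ev; split; apply/eqP; rewrite eqEsubv; apply/andP;
  split; apply/imgV_subP.
- by exists G.
- by exists (invmx G); rewrite mulmxK.
- by exists c%:M; rewrite mul_mx_scalar.
- by exists (c^-1)%:M; rewrite mul_mx_scalar scalerA mulVf ?scale1r.
Qed.

Definition polynomial_function (R : realType) p q k
    (g : 'M[R[i]]_(p + q, k) * 'cV[R[i]]_(p + q) * 'M[R[i]]_(p + q) -> R[i]) : Prop :=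
  exists f : mpoly.mpoly (ncoord p q k) R[i],
    forall z, g z = mpoly.meval (coords z.1.1 z.1.2 z.2) f.

Lemma polynomial_function_algebra (R : realType) p q k :
  function_algebra (@polynomial_function R p q k).
Proof.
split=> [c|f g [f' fE] [g' gE]|f g [f' fE] [g' gE]].
- by exists (mpoly.mpolyC _ c) => z; rewrite mpoly.mevalC.
- by exists (f' + g') => z; rewrite mpoly.mevalD fE gE.
- by exists (f' * g') => z; rewrite mpoly.mevalM fE gE.
Qed.

Lemma polynomial_entries (R : realType) p q k :
  let P := @polynomial_function R p q k in
  [/\ mx_in P (fun z => z.1.1), mx_in P (fun z => z.1.2) & mx_in P (fun z => z.2)].
Proof.
split=> i j.
- exists (mpoly.mpolyX _ (mpoly.mnm1 (lshift _ (lshift _ (mxvec_index i j))))) => z.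
  by rewrite mpoly.mevalXU /coords !row_mxEl mxvecE.
- exists (mpoly.mpolyX _ (mpoly.mnm1 (lshift _ (rshift _ (mxvec_index i j))))) => z.
  by rewrite mpoly.mevalXU /coords row_mxEl row_mxEr mxvecE.
- exists (mpoly.mpolyX _ (mpoly.mnm1 (rshift _ (mxvec_index i j)))) => z.
  by rewrite mpoly.mevalXU /coords row_mxEr mxvecE.
Qed.

Lemma mx_in_coords (R : realType) p q k (T : Type) (P : (T -> R[i]) -> Prop)
    (A : T -> 'M[R[i]]_(p + q, k)) (v : T -> 'cV[R[i]]_(p + q)) (x : T -> 'M[R[i]]_(p + q)) :
  function_algebra P -> mx_in P A -> mx_in P v -> mx_in P x ->
  forall f, P (fun s => mpoly.meval (coords (A s) (v s) (x s)) f).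
Proof.
move=> PA inA inv inx f; apply: (function_algebra_meval _ PA) => i.
by apply: (mx_in_row (mx_in_row _ _) _ 0 i); exact: mx_in_mxvec.
Qed.

(** The polynomials are the determinants of P Q P' for constant P, P', pulled
    back by the actions of GL_k and GL_1 on the homogeneous coordinates.
    Quantifying over these actions makes the condition independent of the
    choice of the coordinates, whatever Q is. *)
Lemma closed_rank_le (R : realType) p q k m n
    (Q : 'M[R[i]]_(p + q, k) * 'cV[R[i]]_(p + q) * 'M[R[i]]_(p + q) -> 'M[R[i]]_(m, n)) c :
  mx_in (@polynomial_function R p q k) Q ->
  closed [set t : flag_triple R p q k |
    forall A v, lift t A v -> (\rank (Q (A, v, t.2)) <= c)%N].
Proof.
move=> PQ; rewrite closed_zariskiE.
pose PA := @polynomial_function_algebra R p q k; have [PA1 PA2 PA3] := polynomial_entries R p q k.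
exists [set f | exists G d (B : 'M[R[i]]_(c.+1, m)) (B' : 'M[R[i]]_(n, c.+1)), [/\ G \in unitmx, d != 0 &
  forall A v x, mpoly.meval (coords A v x) f = \det (B *m Q (A *m G, d *: v, x) *m B')]].
move=> W L x A v AW vL; have lA : lift (W, L, x) A v by [].
split=> [Zt f [G [d [B [B' [Gu d0 ->]]]]]|Sf A' v' lA'].
  have := Zt _ _ (lift_scale lA Gu d0); rewrite /= => le_c.
  apply: contraTeq le_c; rewrite -ltnNge -unitfE -unitmxE -row_full_unit => /eqP rB.
  by rewrite -[c.+1]rB rank_mul_le.
have [G [d [Gu d0 -> ->]]] := lift_change lA lA'; rewrite leqNgt; apply/negP.
move=> /rank_gt_minor[B [B']]; apply/negP; rewrite negbK; apply/eqP.
have [f fE] : polynomial_function (fun z : 'M[R[i]]_(p + q, k) * 'cV[R[i]]_(p + q) * 'M[R[i]]_(p + q) =>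
    \det (B *m Q (z.1.1 *m G, d *: z.1.2, z.2) *m B')).
  apply: function_algebra_det => //; apply: mx_in_mul => //; last exact: mx_in_const.
  apply: mx_in_mul => //; first exact: mx_in_const.
  move=> i j; have [f fE] := PQ i j; under eq_fun do rewrite fE /=.
  apply: mx_in_coords => //.
  - by apply: mx_in_mul => //; exact: mx_in_const.
  - by apply: mx_in_scale => //; have [Pc _ _] := PA; exact: Pc.
have /= -> := fE (A, v, x); apply: Sf; exists G, d, B, B'; split=> // A1 v1 x1.
by have /= -> := fE (A1, v1, x1).
Qed.

(** * Irreducibility by rational curves *)

Definition poly_function (F : fieldType) (h : F -> F) : Prop :=
  exists P : {poly F}, forall s, h s = P.[s].

Lemma poly_function_algebra (F : fieldType) : function_algebra (@poly_function F).
Proof.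
split=> [c|f g [f' fE] [g' gE]|f g [f' fE] [g' gE]].
- by exists c%:P => s; rewrite hornerC.
- by exists (f' + g') => s; rewrite hornerD fE gE.
- by exists (f' * g') => s; rewrite hornerM fE gE.
Qed.

Lemma poly_nonroot (F : numFieldType) (P : {poly F}) : P != 0 -> exists s, P.[s] != 0.
Proof.
move=> P0; apply: contrapT => nex.
(* In characteristic 0, more integers than P can have roots. *)
have: all (root P) [seq n%:R | n <- iota 0 (size P)].
  apply/allP => s _; rewrite rootE; apply/negPn/negP => Ps; apply: nex.
  by exists s.
move=> /(max_poly_roots P0); rewrite map_inj_uniq ?iota_uniq; last first.
  by move=> m n /eqP; rewrite eqr_nat => /eqP.
by rewrite size_map size_iota ltnn => /(_ isT).
Qed.

(** If Z is the union of two closed sets and neither contains Z, there are f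
    and g among their equations and points t1 and t2 of Z with f(t1) and g(t2)
    nonzero. Along the curve from t1 to t2 the product of D, f and g is a
    nonzero polynomial in one variable, so it is nonzero somewhere, at a point
    of Z outside both sets. *)
Lemma irreducible_by_curves (R : realType) p q k (Z : set (flag_triple R p q k)) :
  Z !=set0 ->
  (forall t1 t2, Z t1 -> Z t2 -> exists D A v x,
    [/\ poly_function D, mx_in (@poly_function _) A, mx_in (@poly_function _) v
      & mx_in (@poly_function _) x] /\
    [/\ D 0 != 0, D 1 != 0,
        lift t1 (A 0) (v 0) /\ t1.2 = x 0, lift t2 (A 1) (v 1) /\ t2.2 = x 1
      & forall s, D s != 0 -> exists2 t, Z t & lift t (A s) (v s) /\ t.2 = x s]) ->
  irreducible_set Z.
Proof.
move=> Z0 curve; split=> // X Y; rewrite !closed_zariskiE => -[SX XE] [SY YE] ZXY.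
apply: contrapT => /not_orP[/existsNP[t1 /not_implyP[Zt1 nX]] /existsNP[t2 /not_implyP[Zt2 nY]]].
have [D [A [v [x [[PD PA Pv Px] [D0 D1 [l1 x1] [l2 x2] Zs]]]]]] := curve _ _ Zt1 Zt2.
have [f Xf f1] : exists2 f, SX f & mpoly.meval (coords (A 0) (v 0) (x 0)) f != 0.
  apply: contrapT => nf; apply: nX; case: t1 {Zt1} l1 x1 => -[W L] x' [/= AW vL] ->.
  apply/(XE _ _ _ _ _ AW vL) => f Xf; apply/eqP/negPn/negP => f0; apply: nf.
  by exists f.
have [g Yg g1] : exists2 g, SY g & mpoly.meval (coords (A 1) (v 1) (x 1)) g != 0.
  apply: contrapT => nf; apply: nY; case: t2 {Zt2} l2 x2 => -[W L] x' [/= AW vL] ->.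
  apply/(YE _ _ _ _ _ AW vL) => g Yg; apply/eqP/negPn/negP => g0; apply: nf.
  by exists g.
have PF := poly_function_algebra R[i].
have [P PE] := PD; have [Pf PfE] := mx_in_coords PF PA Pv Px f.
have [Pg PgE] := mx_in_coords PF PA Pv Px g.
have nz (h : {poly R[i]}) s : h.[s] != 0 -> h != 0.
  by apply: contraNneq => ->; rewrite horner0.
have [|s] := @poly_nonroot _ (P * Pf * Pg).
  rewrite !mulf_neq0 //; first by apply: (nz _ 0); rewrite -PE.
    by apply: (nz _ 0); rewrite -PfE.
  by apply: (nz _ 1); rewrite -PgE.
rewrite !hornerM -PE -PfE -PgE !mulf_eq0 !negb_or => /andP[/andP[Ds fs] gs].
have [t Zt [lt xt]] := Zs _ Ds.
case: t Zt lt xt => -[W L] x' Zt [/= AW vL] xE.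
have [Xt|Yt] := ZXY _ Zt.
- by move/eqP: fs; apply; rewrite -xE; apply: (XE _ _ _ _ _ AW vL).1.
- by move/eqP: gs; apply; rewrite -xE; apply: (YE _ _ _ _ _ AW vL).1.
Qed.

(** * The conormal variety in coordinates *)

Definition diag_blocks (F : fieldType) p q (g1 : 'M[F]_p) (g2 : 'M[F]_q) : 'M[F]_(p + q) :=
  block_mx g1 0 0 g2.

(** The conormal condition in homogeneous coordinates. It is linear in x,
    which is what the construction of curves in the strata needs. *)
Definition conormal_at (R : realType) p q k (A : 'M[R[i]]_(p + q, k)) (V : 'cV[R[i]]_(p + q))
    (x : 'M[R[i]]_(p + q)) : Prop :=
  [/\ exists C, x = A *m C, x *m A = 0, exists c, theta x = V *m c & theta x *m V = 0].

Lemma conormal_lift (R : realType) p q k (t : flag_triple R p q k) A V :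
  lift t A V -> conormal t <-> conormal_at A V t.2.
Proof.
case: t => -[W L] x [/= <- <-]; rewrite /conormal_at.
split=> [[/imgV_subP h1 /sub_kerV h2 /imgV_subP h3 /sub_kerV h4]|[h1 h2 h3 h4]]; first by split.
by split; [exact/imgV_subP|exact/sub_kerV|exact/imgV_subP|exact/sub_kerV].
Qed.

Lemma theta_block (R : realType) p q (x1 : 'M[R[i]]_p) a b (x2 : 'M[R[i]]_q) :
  theta (block_mx x1 a b x2) = diag_blocks x1 x2.
Proof. by rewrite /theta block_mxKul block_mxKdr. Qed.

Lemma thetaD (R : realType) p q (x y : 'M[R[i]]_(p + q)) : theta (x + y) = theta x + theta y.
Proof.
rewrite -[x]submxK -[y]submxK add_block_mx !theta_block.
by rewrite [RHS]add_block_mx !addr0.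
Qed.

Lemma thetaZ (R : realType) p q c (x : 'M[R[i]]_(p + q)) : theta (c *: x) = c *: theta x.
Proof.
by rewrite -[x]submxK scale_block_mx !theta_block [RHS]scale_block_mx !scaler0.
Qed.

Lemma theta_diag (R : realType) p q (x : 'M[R[i]]_(p + q)) g1 g2 h1 h2 :
  theta (diag_blocks g1 g2 *m x *m diag_blocks h1 h2) = diag_blocks g1 g2 *m theta x *m diag_blocks h1 h2.
Proof.
rewrite -[x]submxK theta_block /diag_blocks !mulmx_block !mul0mx !mulmx0 !add0r !addr0.
by rewrite theta_block /diag_blocks !(mul0mx, mulmx0, add0r, addr0).
Qed.

Lemma conormal_atD (R : realType) p q k (A : 'M[R[i]]_(p + q, k)) V x y :
  conormal_at A V x -> conormal_at A V y -> conormal_at A V (x + y).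
Proof.
move=> [[C CE] xA [c cE] xV] [[C' CE'] yA [c' cE'] yV]; split.
- by exists (C + C'); rewrite mulmxDr -CE -CE'.
- by rewrite mulmxDl xA yA addr0.
- by exists (c + c'); rewrite mulmxDr -cE -cE' thetaD.
- by rewrite thetaD mulmxDl xV yV addr0.
Qed.

Lemma conormal_atZ (R : realType) p q k (A : 'M[R[i]]_(p + q, k)) V d x :
  conormal_at A V x -> conormal_at A V (d *: x).
Proof.
move=> [[C CE] xA [c cE] xV]; split.
- by exists (d *: C); rewrite -scalemxAr -CE.
- by rewrite -scalemxAl xA scaler0.
- by exists (d *: c); rewrite -scalemxAr -cE thetaZ.
- by rewrite thetaZ -scalemxAl xV scaler0.
Qed.

(** Conjugation by an element of K up to the scalar d: with the adjugate
    matrix in place of the inverse, it depends polynomially on the group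
    element. *)
Lemma conormal_at_conj (R : realType) p q k (A : 'M[R[i]]_(p + q, k)) V x g1 g2 h1 h2 d :
  diag_blocks h1 h2 *m diag_blocks g1 g2 = d%:M -> conormal_at A V x ->
  conormal_at (diag_blocks g1 g2 *m A) (diag_blocks g1 g2 *m V) (diag_blocks g1 g2 *m x *m diag_blocks h1 h2).
Proof.
move=> hg [[C CE] xA [c cE] xV]; split.
- by exists (C *m diag_blocks h1 h2); rewrite {1}CE !mulmxA.
- rewrite mulmxA -(mulmxA _ (diag_blocks h1 h2)) hg mul_mx_scalar -!scalemxAl.
  by rewrite -mulmxA xA mulmx0 scaler0.
- by exists (c *m diag_blocks h1 h2); rewrite theta_diag cE !mulmxA.
- rewrite theta_diag mulmxA -(mulmxA _ (diag_blocks h1 h2)) hg mul_mx_scalar -!scalemxAl.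
  by rewrite -mulmxA xV mulmx0 scaler0.
Qed.

Lemma conormal_at_change (R : realType) p q k (A : 'M[R[i]]_(p + q, k)) V x G c :
  G \in unitmx -> c != 0 -> conormal_at (A *m G) (c *: V) x -> conormal_at A V x.
Proof.
move=> Gu c0 [[C CE] xA [d dE] xV]; split.
- by exists (G *m C); rewrite mulmxA.
- by rewrite -[LHS](mulmxK Gu) -(mulmxA x A) xA mul0mx.
- by exists (c *: d); rewrite -scalemxAr scalemxAl.
- by move/eqP: xV; rewrite -scalemxAr scaler_eq0 (negbTE c0) => /eqP.
Qed.

Lemma conormal_atP (R : realType) p q k (A : 'M[R[i]]_(p + q, k)) (v : 'cV[R[i]]_p) x :
  v != 0 ->
  conormal_at A (col_mx v 0) x <->
  conormal_blocks (usubmx A) (dsubmx A) v (ulsubmx x) (ursubmx x) (dlsubmx x) /\ drsubmx x = 0.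
Proof.
move=> v0; rewrite -{1}[A]vsubmxK -{1}[x]submxK; move: (usubmx A) (dsubmx A) => A1 A2.
move: (ulsubmx x) (ursubmx x) (dlsubmx x) (drsubmx x) => x1 a b x2.
rewrite /conormal_at /theta block_mxKul block_mxKdr; split.
- move=> [[C CE] xA [c cE] xV].
  move: CE; rewrite -[C]hsubmxK mul_col_row => /eq_block_mx[E1 E2 E3 E4].
  move: xA; rewrite mul_block_col => /eqP; rewrite col_mx_eq0 => /andP[/eqP E5 /eqP E6].
  move: cE; rewrite -[c]hsubmxK mul_col_row => /eq_block_mx[E7 _ _ E8].
  move: xV; rewrite mul_block_col !mulmx0 !addr0 {1}E7 => /eqP;
    rewrite col_mx_eq0 => /andP[/eqP E9 _].
  have x20 : x2 = 0 by rewrite E8 mul0mx.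
  split; [|exact: x20]; exists (lsubmx C), (rsubmx C), (lsubmx c); split;
    [by split| | |exact: E7|].
  + by split; rewrite // -E4 x20.
  + by rewrite E5; split=> //; move: E6; rewrite x20 mul0mx addr0.
  + apply: (row_full_inj (row_full_cV v0)).
    by rewrite mulmxA.
- move=> [[C1 [C2 [c [[E1 E2] [E3 E4] [E5 E6] E7 E8]]]] ->]; split.
  + by exists (row_mx C1 C2); rewrite mul_col_row -E1 -E2 -E3 E4.
  + by rewrite mul_block_col E5 mul0mx addr0 E6 col_mx0.
  + by exists (row_mx c 0); rewrite mul_col_row !mul0mx mulmx0 E7.
  + by rewrite mul_block_col !mulmx0 mul0mx !addr0 E7 -mulmxA E8 mulmx0 col_mx0.
Qed.

(** * The strata of the conormal variety *)

Definition stratum (R : realType) (p q k : nat) (o : nat * nat * position) :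
    set (flag_triple R p q k) :=
  [set t | conormal t /\ exists A (v : 'cV[R[i]]_p),
    [/\ lift t A (col_mx v 0), (o.1.1 + \rank (dsubmx A))%N = k,
        (o.1.2 + \rank (usubmx A))%N = k & has_position o.2 (usubmx A) (dsubmx A) v]].

Lemma lift_facts (R : realType) p q k (t : flag_triple R p q k) A V :
  lift t A V -> row_full A /\ exists2 v, V = col_mx v 0 & v != 0.
Proof.
case: t => -[W L] x [/= AW VL]; have /eqP dW := valP W; have /andP[/eqP dL LV] := valP L.
split; first by rewrite /row_full -dim_imgV AW dW.
have [v Vv] : exists v, V = incl1 R p q *m v.
  by apply/imgV_subP; rewrite VL.
rewrite /incl1 mul_col_mx mul1mx mul0mx in Vv; exists v => //.
have dV : \dim (imgV V) = 1 by rewrite VL.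
by apply/eqP => v0; move: dV; rewrite dim_imgV Vv v0 col_mx0 mxrank0.
Qed.

Lemma exists_flag (R : realType) p q k (A : 'M[R[i]]_(p + q, k)) (v : 'cV[R[i]]_p) x :
  row_full A -> v != 0 -> exists t : flag_triple R p q k, lift t A (col_mx v 0) /\ t.2 = x.
Proof.
move=> fA v0; have dW : \dim (imgV A) == k by rewrite dim_imgV.
have dL : (\dim (imgV (col_mx v (0 : 'cV[R[i]]_q))) == 1)%N &&
    (imgV (col_mx v (0 : 'cV[R[i]]_q)) <= V1 R p q)%VS.
  apply/andP; split; last first.
    by apply/imgV_subP; exists v; rewrite mul_col_mx mul1mx mul0mx.
  rewrite dim_imgV eqn_leq rank_leq_col lt0n mxrank_eq0 col_mx_eq0.
  by rewrite negb_and v0.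
by exists (exist _ (imgV A) dW, exist _ (imgV (col_mx v 0)) dL, x).
Qed.

Lemma has_position_change (F : fieldType) p q k pos (A1 : 'M[F]_(p, k)) (A2 : 'M[F]_(q, k))
    (v : 'cV[F]_p) (G : 'M[F]_k) c : G \in unitmx -> c != 0 ->
  has_position pos A1 A2 v -> has_position pos (A1 *m G) (A2 *m G) (c *: v).
Proof.
move=> Gu c0.
have sub : in_subspace A1 A2 v <-> in_subspace (A1 *m G) (A2 *m G) (c *: v).
  split=> [[u [vu A2u]]|[u [vu A2u]]].
    exists (c *: (invmx G *m u)); rewrite -!scalemxAr -!mulmxA !mulKVmx // A2u scaler0.
    by rewrite vu.
  exists (c^-1 *: (G *m u)); rewrite -!scalemxAr !mulmxA A2u scaler0 -vu scalerA.
  by rewrite mulVf // scale1r.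
have sha : in_shadow A1 v <-> in_shadow (A1 *m G) (c *: v).
  split=> [[u vu]|[u vu]].
    by exists (c *: (invmx G *m u)); rewrite -!scalemxAr -!mulmxA !mulKVmx // vu.
  exists (c^-1 *: (G *m u)); rewrite -!scalemxAr !mulmxA -vu scalerA.
  by rewrite mulVf // scale1r.
by case: pos => /=; tauto.
Qed.

Lemma has_position_act (F : fieldType) p q k pos (A1 : 'M[F]_(p, k)) (A2 : 'M[F]_(q, k))
    (v : 'cV[F]_p) (g1 : 'M[F]_p) (g2 : 'M[F]_q) : g1 \in unitmx -> g2 \in unitmx ->
  has_position pos A1 A2 v -> has_position pos (g1 *m A1) (g2 *m A2) (g1 *m v).
Proof.
move=> u1 u2.
have sub : in_subspace A1 A2 v <-> in_subspace (g1 *m A1) (g2 *m A2) (g1 *m v).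
  split=> [[u [vu A2u]]|[u [vu A2u]]]; exists u.
    by rewrite vu -!mulmxA A2u mulmx0.
  split; first by rewrite -[v](mulKmx u1) vu -mulmxA mulKmx.
  by rewrite -[LHS](mulKmx u2) (mulmxA g2) A2u mulmx0.
have sha : in_shadow A1 v <-> in_shadow (g1 *m A1) (g1 *m v).
  split=> [[u vu]|[u vu]]; exists u; first by rewrite vu mulmxA.
  by rewrite -[v](mulKmx u1) vu -mulmxA mulKmx.
by case: pos => /=; tauto.
Qed.

Lemma stratum_lift (R : realType) p q k o (t : flag_triple R p q k) A (v : 'cV[R[i]]_p) :
  stratum o t -> lift t A (col_mx v 0) ->
  [/\ row_full A /\ v != 0, (o.1.1 + \rank (dsubmx A))%N = k,
      (o.1.2 + \rank (usubmx A))%N = k, has_position o.2 (usubmx A) (dsubmx A) v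
    & conormal_blocks (usubmx A) (dsubmx A) v (ulsubmx t.2) (ursubmx t.2) (dlsubmx t.2)
      /\ drsubmx t.2 = 0].
Proof.
move=> [cn [A' [v' [lA' r2 r1 pos]]]] lA.
have [fA [w vw w0]] := lift_facts lA; have v0 : v != 0 by have [-> _] := eq_col_mx vw.
have [G [c [Gu c0 AE vE]]] := lift_change lA' lA.
have vE' : v = c *: v' by move: vE; rewrite scale_col_mx scaler0 => /eq_col_mx[].
have AE1 : usubmx A = usubmx A' *m G by rewrite AE -{1}[A']vsubmxK mul_col_mx col_mxKu.
have AE2 : dsubmx A = dsubmx A' *m G by rewrite AE -{1}[A']vsubmxK mul_col_mx col_mxKd.
split=> //; [by rewrite AE2 rank_mul_unit|by rewrite AE1 rank_mul_unit| |].
  by rewrite AE1 AE2 vE'; exact: has_position_change.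
by apply/(conormal_atP A t.2 v0)/(conormal_lift lA).
Qed.

(** The curve from t1 to t2 is s |-> g(s) (A, v, y(s)), where g(s) = (1 - s) +
    s g in K interpolates between the identity and an element g that maps the
    flag of t1 to that of t2, and y(s) interpolates between x and the preimage
    under g of x'. *)
Lemma stratum_irreducible (R : realType) p q k o :
  @stratum R p q k o !=set0 -> irreducible_set (@stratum R p q k o).
Proof.
move=> S0; apply: irreducible_by_curves => // t1 t2 S1 S2.
have [cn1 [A [v [lA _ _ _]]]] := S1; have [cn2 [B [w [lB _ _ _]]]] := S2.
have [[fA v0] rA2 rA1 pA _] := stratum_lift S1 lA.
have [[fB w0] rB2 rB1 pB _] := stratum_lift S2 lB.
have [||| |g1 [g2 [G [u1 u2 gA1 gA2 gv]]]] := flag_transitive _ _ v0 w0 _ _ pA pB.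
- by rewrite vsubmxK.
- by rewrite vsubmxK.
- by apply/eqP; rewrite -(eqn_add2l o.1.2) rA1 rB1.
- by apply/eqP; rewrite -(eqn_add2l o.1.1) rA2 rB2.
pose f1 (s : R[i]) := (1 - s)%:M + s *: g1; pose f2 (s : R[i]) := (1 - s)%:M + s *: g2.
pose d s := \det (f1 s) * \det (f2 s).
(* Conjugation by g(s) maps x to g(s) x h(s) / d(s). The factor 1 / d(s) may
   be dropped, as conormal vectors at a flag form a linear space; at s = 1 it
   is compensated in y1. *)
pose h1 s := \det (f2 s) *: \adj (f1 s); pose h2 s := \det (f1 s) *: \adj (f2 s).
pose g s := diag_blocks (f1 s) (f2 s); pose h s := diag_blocks (h1 s) (h2 s).
have hg s : h s *m g s = (d s)%:M.
  rewrite /h /g /diag_blocks mulmx_block !(mul0mx, mulmx0, addr0, add0r) -!scalemxAl !mul_adj_mx.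
  by rewrite !scale_scalar_mx [\det (f2 s) * _]mulrC -scalar_mx_block.
have gh s : g s *m h s = (d s)%:M.
  rewrite /h /g /diag_blocks mulmx_block !(mul0mx, mulmx0, addr0, add0r) -!scalemxAr !mul_mx_adj.
  by rewrite !scale_scalar_mx [\det (f2 s) * _]mulrC -scalar_mx_block.
have f10 : f1 0 = 1%:M by rewrite /f1 subr0 scale0r addr0.
have f20 : f2 0 = 1%:M by rewrite /f2 subr0 scale0r addr0.
have f11 : f1 1 = g1 by rewrite /f1 subrr scale1r raddf0 add0r.
have f21 : f2 1 = g2 by rewrite /f2 subrr scale1r raddf0 add0r.
have d0 : d 0 = 1 by rewrite /d f10 f20 !det1 mulr1.
have d1 : d 1 != 0 by rewrite /d f11 f21 mulf_neq0 // -unitfE -unitmxE.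
have g0 : g 0 = 1%:M by rewrite /g f10 f20 /diag_blocks -scalar_mx_block.
have h0 : h 0 = 1%:M by rewrite -[LHS]mulmx1 -g0 hg d0.
have gAB : g 1 *m A = B *m G.
  by rewrite /g f11 f21 -[A]vsubmxK -[B in RHS]vsubmxK /diag_blocks mul_block_col !mul0mx addr0 add0r gA1 gA2 mul_col_mx.
have gvw : g 1 *m col_mx v 0 = col_mx w 0.
  by rewrite /g f11 f21 /diag_blocks mul_block_col !mul0mx !mulmx0 !addr0 gv.
have Gu : G \in unitmx.
  have rgA : \rank (g 1 *m A) = k.
    apply/eqP; apply: inj_row_full => u; rewrite -mulmxA => /(congr1 (mulmx (h 1))).
    rewrite mulmxA hg mulmx0 mul_scalar_mx => /eqP; rewrite scaler_eq0 (negbTE d1) /=.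
    by move=> /eqP/(row_full_inj fA).
  rewrite -row_full_unit /row_full eqn_leq rank_leq_col -{1}rgA gAB.
  exact: mxrankM_maxr.
pose y1 := (d 1)^-2 *: (h 1 *m t2.2 *m g 1).
pose y s := (1 - s) *: t1.2 + s *: y1.
have cy s : conormal_at A (col_mx v 0) (y s).
  apply: conormal_atD; apply: conormal_atZ; first exact: (conormal_lift lA).1.
  apply: conormal_atZ.
  have cB := conormal_at_conj (gh 1) ((conormal_lift lB).1 cn2).
  apply: (conormal_at_change (G := d 1 *: invmx G) (c := d 1)) => //.
    by rewrite unitmxZ ?unitmx_inv // unitfE.
  move: cB; rewrite -/(h 1) -/(g 1) -gvw mulmxA hg mul_scalar_mx.
  suff -> : h 1 *m B = A *m (d 1 *: invmx G) by [].
  have -> : B = g 1 *m A *m invmx G by rewrite gAB mulmxK.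
  by rewrite !mulmxA hg mul_scalar_mx -scalemxAl -scalemxAr.
exists d, (fun s => g s *m A), (fun s => g s *m col_mx v 0), (fun s => g s *m y s *m h s).
have PF := poly_function_algebra R[i]; have [Pc PD PM] := PF.
have Pid : poly_function (fun s : R[i] => s) by exists 'X => s; rewrite hornerX.
have P1s : poly_function (fun s : R[i] => 1 - s).
  by exists (1 - 'X) => s; rewrite !hornerE.
have Pf n (M : 'M[R[i]]_n) : mx_in (@poly_function _) (fun s => (1 - s)%:M + s *: M).
  apply: mx_in_add => //; last by apply: mx_in_scale => //; exact: mx_in_const.
  move=> i j; under eq_fun do rewrite mxE -mulr_natr.
  by apply: PM => //; exact: Pc.
have Pdet n (M : 'M[R[i]]_n) := function_algebra_det PF (Pf n M).
have Padj n (M : 'M[R[i]]_n) := mx_in_adj PF (Pf n M).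
have Pblk m n (M : R[i] -> 'M[R[i]]_m) (N : R[i] -> 'M[R[i]]_n) :
    mx_in (@poly_function _) M -> mx_in (@poly_function _) N ->
    mx_in (@poly_function _) (fun s => diag_blocks (M s) (N s)).
  by move=> PM' PN'; apply: mx_in_col; apply: mx_in_row => //; exact: mx_in_const.
have Pg : mx_in (@poly_function _) g by apply: Pblk; exact: Pf.
have Ph : mx_in (@poly_function _) h by apply: Pblk;
  apply: (mx_in_scale PF (Pdet _ _) (Padj _ _)).
have Py : mx_in (@poly_function _) y.
  by apply: mx_in_add => //; apply: mx_in_scale => //; exact: mx_in_const.
split.
  split; first exact: (PM _ _ (Pdet _ _) (Pdet _ _)).
  - by apply: mx_in_mul => //; exact: mx_in_const.
  - by apply: mx_in_mul => //; exact: mx_in_const.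
  - by apply: mx_in_mul => //; exact: mx_in_mul.
split; [by rewrite d0 oner_neq0|exact: d1| | |].
- rewrite g0 h0 !mul1mx mulmx1; split=> //.
  by rewrite /y subr0 scale1r scale0r addr0.
- split; last first.
    rewrite /y subrr scale0r scale1r add0r /y1 -scalemxAr -scalemxAl.
    rewrite -!mulmxA gh !mulmxA gh mul_scalar_mx -scalemxAl mul_mx_scalar !scalerA.
    by rewrite -mulrA -expr2 mulVf ?scale1r ?expf_neq0.
  have := lift_scale lB Gu (oner_neq0 _); rewrite scale1r.
  by rewrite gAB gvw.
- move=> s ds; have us1 : f1 s \in unitmx.
    by rewrite unitmxE unitfE; apply: contraNneq ds => E; rewrite /d E mul0r.
  have us2 : f2 s \in unitmx.
    by rewrite unitmxE unitfE; apply: contraNneq ds => E; rewrite /d E mulr0.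
  have gAE : g s *m A = col_mx (f1 s *m usubmx A) (f2 s *m dsubmx A).
    by rewrite -{1}[A]vsubmxK /g /diag_blocks mul_block_col !mul0mx addr0 add0r.
  have gvE : g s *m col_mx v 0 = col_mx (f1 s *m v) 0.
    by rewrite /g /diag_blocks mul_block_col !mul0mx !mulmx0 !addr0.
  have fgA : row_full (g s *m A).
    apply: mulmx_row_full => //; rewrite row_full_unit unitmxE unitfE.
    by rewrite /g /diag_blocks det_ublock mulf_neq0 // -unitfE -unitmxE.
  have fv0 : f1 s *m v != 0.
    by apply: contraNneq v0 => E; rewrite -[v](mulKmx us1) E mulmx0.
  have [t [lt xt]] := exists_flag (g s *m y s *m h s) fgA fv0.
  exists t; last by rewrite gvE.
  split.
    apply/(conormal_lift lt); rewrite xt -gvE.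
    exact: conormal_at_conj (hg s) (cy s).
  exists (g s *m A), (f1 s *m v); split=> //.
  + by rewrite gAE col_mxKd rank_unit_mul.
  + by rewrite gAE col_mxKu rank_unit_mul.
  + by rewrite gAE col_mxKd col_mxKu; exact: has_position_act.
Qed.

(** * The closure of a stratum contains no other stratum *)

(** The indices of the nonempty strata: i + j <= k <= p + j, q + i, and the
    part of V_1 in which L has to lie is nonempty. *)
Definition admissible p q k (o : nat * nat * position) : Prop :=
  let: (i, j, pos) := o in
  [/\ i + j <= k, k <= p + j, k <= q + i &
    match pos with Inside => 0 < i | InShadow => i + j < k | Outside => k < p + j end]%N.

Definition rank_data (F : fieldType) p q (a : 'M[F]_(p, q)) (b : 'M[F]_(q, p)) (v : 'cV[F]_p) :
    nat * nat * nat * nat :=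
  (\rank a, \rank b, \rank (row_mx a v), \rank (b *m v)).

Definition generic_data p q k (o : nat * nat * position) : nat * nat * nat * nat :=
  let: (i, j, pos) := o in
  (generic_a q k i j pos, generic_b p k j pos, generic_av q k i pos, generic_bv j pos).

Definition le_data (c d : nat * nat * nat * nat) : Prop :=
  [/\ c.1.1.1 <= d.1.1.1, c.1.1.2 <= d.1.1.2, c.1.2 <= d.1.2 & c.2 <= d.2]%N.

Lemma le_data_anti c d : le_data c d -> le_data d c -> c = d.
Proof.
case: c => -[[c1 c2] c3] c4; case: d => -[[d1 d2] d3] d4 [/= l1 l2 l3 l4] [/= m1 m2 m3 m4].
by congr (_, _, _, _); lia.
Qed.

Lemma stratum_bounds (R : realType) p q k o (t : flag_triple R p q k) A v :
  stratum o t -> lift t A (col_mx v 0) ->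
  le_data (rank_data (ursubmx t.2) (dlsubmx t.2) v) (generic_data p q k o).
Proof.
case: o => -[i j] pos St lt; have [[fA v0] /= r2 r1 hp [cn _]] := stratum_lift St lt.
by have [] := generic_bounds _ r2 r1 hp cn; rewrite ?vsubmxK.
Qed.

Lemma stratum_generic (R : realType) p q k i j pos :
  admissible p q k (i, j, pos) ->
  exists (t : flag_triple R p q k) A v, [/\ stratum (i, j, pos) t, lift t A (col_mx v 0),
    rank_data (ursubmx t.2) (dlsubmx t.2) v = generic_data p q k (i, j, pos)
  & let x1 := ulsubmx t.2 in
    [/\ (pos = Inside -> i + j < k -> 0 < \rank (x1 *m usubmx A))%N,
        (pos = Inside -> i + j = k -> minn (p + j - k) j.+1 <= \rank (col_mx x1 (dlsubmx t.2)))%N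
      & (pos <> Outside -> k < p + j -> 0 < \rank x1)%N]].
Proof.
move=> [ijk kpj kqi hpos].
pose s := (k - (i + j))%N; pose e := (p + j - k)%N; pose e' := (q + i - k)%N.
have Ep : p = (i + (s + e))%N by rewrite /s /e; lia.
have Eq : q = (j + (s + e'))%N by rewrite /s /e'; lia.
have Ek : k = (i + (j + s))%N by rewrite /s; lia.
clearbody s e e'; subst p q k.
have [|v [x1 [a [b]]]] := @generic_point R[i] i j s e e' pos.
  by case: pos hpos => //; lia.
pose A : 'M[R[i]]_(_, _) := col_mx (model_W1 R[i] i j s e) (model_W2 R[i] i j s e').
move=> /= [cn v0 hp [ra rb rav rbv] [ex1 ex2 ex3]].
have fA : row_full A by exact: model_full.
have [t [lt xt]] := exists_flag (block_mx x1 a b 0) fA v0.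
have St : stratum (i, j, pos) t.
  split.
    apply/(conormal_lift lt)/(conormal_atP _ _ v0); rewrite xt.
    by rewrite block_mxKul block_mxKur block_mxKdl block_mxKdr col_mxKu col_mxKd.
  exists A, v; rewrite /A col_mxKu col_mxKd; split=> //=.
    exact: rank_model_W2.
  exact: rank_model_W1.
exists t, A, v; split=> //.
  by apply: le_data_anti (stratum_bounds St lt) _; rewrite xt block_mxKur block_mxKdl.
rewrite xt block_mxKul block_mxKdl /A col_mxKu /=; split=> [hI lts|hI Es|hI lte].
- by apply: ex1 => //; lia.
- by apply: leq_trans (ex2 hI _); lia.
- by apply: ex3 => //; lia.
Qed.

Lemma closure_rank_le (R : realType) p q k m n
    (Q : 'M[R[i]]_(p + q, k) * 'cV[R[i]]_(p + q) * 'M[R[i]]_(p + q) -> 'M[R[i]]_(m, n)) c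
    (S S' : set (flag_triple R p q k)) :
  mx_in (@polynomial_function R p q k) Q -> S `<=` closure S' ->
  (forall t A v, S' t -> lift t A (col_mx v 0) -> (\rank (Q (A, col_mx v 0, t.2)) <= c)%N) ->
  forall t A v, S t -> lift t A (col_mx v 0) -> (\rank (Q (A, col_mx v 0, t.2)) <= c)%N.
Proof.
move=> PQ SS' le' t A v St lt.
apply: (closure_min (closed_rank_le (c := c) PQ) _ (SS' _ St)) lt => t' S't' A' v' lt'.
by have [_ [w vE _]] := lift_facts lt'; rewrite vE; apply: le'; rewrite -?vE.
Qed.

Lemma in_subspace_rank (F : fieldType) p q k (A : 'M[F]_(p + q, k)) (v : 'cV[F]_p) :
  in_subspace (usubmx A) (dsubmx A) v <-> (\rank (row_mx A (col_mx v 0)) <= \rank A)%N.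
Proof.
have E u : A *m u = col_mx (usubmx A *m u) (dsubmx A *m u) by rewrite -mul_col_mx vsubmxK.
split=> [[u [-> Au0]]|/rank_row_mx_sub[u]];
  first by rewrite -[X in col_mx _ X]Au0 -E rank_row_mx_mul.
by rewrite E => /eq_col_mx[vu u0]; exists u.
Qed.

Lemma in_shadow_rank (F : fieldType) p k (A : 'M[F]_(p, k)) (v : 'cV[F]_p) :
  in_shadow A v <-> (\rank (row_mx A v) <= \rank A)%N.
Proof.
by split=> [[u ->]|/rank_row_mx_sub[u]]; [rewrite rank_row_mx_mul|exists u].
Qed.

(** Closed conditions satisfied by the stratum of o' hold at a generic point
    of the stratum of o. The dimensions of the intersections of W with V_1 and
    V_2 can only grow on the closure, whereas the generic ranks, which grow
    with these dimensions, can only drop: this leaves i = i' and j = j' if the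
    positions agree. *)
Lemma strata_incomparable (R : realType) p q k o o' :
  admissible p q k o -> admissible p q k o' ->
  @stratum R p q k o `<=` closure (stratum o') -> o = o'.
Proof.
case: o => -[i j] pos; case: o' => -[i' j'] pos' adm adm' sub.
have PA := polynomial_function_algebra R p q k.
have [PA1 PV Px] := polynomial_entries R p q k.
have Pu := mx_in_usubmx Px; have Pd := mx_in_dsubmx Px.
have Pa := mx_in_rsubmx Pu; have Pb := mx_in_lsubmx Pd; have Px1 := mx_in_lsubmx Pu.
have Pv := mx_in_usubmx PV; have PAu := mx_in_usubmx PA1; have PAd := mx_in_dsubmx PA1.
have [t [A [v [St lt dE [ex1 ex2 ex3]]]]] := stratum_generic R adm.
have [[fA v0] /= r2 r1 hp [cn _]] := stratum_lift St lt.
have le m n Q c PQ le' := @closure_rank_le R p q k m n Q c _ _ PQ sub le' t A v St lt.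
have bound (t' : flag_triple R p q k) A' v' : stratum (i', j', pos') t' -> lift t' A' (col_mx v' 0) ->
    [/\ le_data (rank_data (ursubmx t'.2) (dlsubmx t'.2) v') (generic_data p q k (i', j', pos')),
     row_full A', (i' + \rank (dsubmx A'))%N = k, (j' + \rank (usubmx A'))%N = k &
     has_position pos' (usubmx A') (dsubmx A') v' /\
     conormal_blocks (usubmx A') (dsubmx A') v' (ulsubmx t'.2) (ursubmx t'.2) (dlsubmx t'.2)].
  move=> St' lt'; have [[fA' _] r2' r1' hp' [cn' _]] := stratum_lift St' lt'.
  split; [exact: stratum_bounds St' lt'|by []|exact: r2'|exact: r1'|by split].
have [ge_i ge_j] : (i' <= i)%N /\ (j' <= j)%N.
  have := le _ _ _ (k - i')%N PAd; have := le _ _ _ (k - j')%N PAu => /= h1 h2.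
  move: adm => [? ? ? _]; move: adm' => [? ? ? _]; split.
    have : (\rank (dsubmx A) <= k - i')%N.
      by apply: h2 => t' A' v' S' l'; have [_ _ E _ _] := bound _ _ _ S' l'; lia.
    lia.
  have : (\rank (usubmx A) <= k - j')%N.
    by apply: h1 => t' A' v' S' l'; have [_ _ _ E _] := bound _ _ _ S' l'; lia.
  lia.
have [le_a le_b le_av le_bv] : le_data (generic_data p q k (i, j, pos)) (generic_data p q k (i', j', pos')).
  rewrite -dE; split.
  - by apply: (le _ _ _ _ Pa) => t' A' v' S' l'; have [[]] := bound _ _ _ S' l'.
  - by apply: (le _ _ _ _ Pb) => t' A' v' S' l'; have [[]] := bound _ _ _ S' l'.
  - have := le _ _ _ (generic_data p q k (i', j', pos')).1.2 (mx_in_row Pa Pv).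
    rewrite /= col_mxKu; apply => t' A' v' S' l'; rewrite col_mxKu.
    by have [[]] := bound _ _ _ S' l'.
  - have := le _ _ _ (generic_data p q k (i', j', pos')).2 (mx_in_mul PA Pb Pv).
    rewrite /= col_mxKu; apply => t' A' v' S' l'; rewrite col_mxKu.
    by have [[]] := bound _ _ _ S' l'.
(* Unless L is inside W, the map x1 kills p_1(W). *)
have le_flat : pos' <> Inside -> (\rank (ulsubmx t.2 *m usubmx A) <= 0)%N.
  move=> nI; apply: (le _ _ _ _ (mx_in_mul PA Px1 PAu)) => t' A' v' S' l' /=.
  have [_ _ _ _ [hp' cn']] := bound _ _ _ S' l'; rewrite leqn0 mxrank_eq0; apply/eqP.
  apply: (conormal_not_inside cn');
    case: pos' {adm' sub le bound le_a le_b le_av le_bv S'} nI hp' => //=.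
    by move=> _ [].
  by move=> _ nsh [u [E _]]; apply: nsh; exists u.
move: le_a le_b le_av le_bv adm adm'; rewrite /= /generic_a /generic_b /generic_av /generic_bv.
case: pos' sub bound le le_flat => sub bound le le_flat.
- have hI : in_subspace (usubmx A) (dsubmx A) v.
    apply/in_subspace_rank; rewrite (eqP fA).
    apply: (le _ _ _ _ (mx_in_row PA1 PV)) => t' A' v' S' l' /=.
    have [_ fA' _ _ [hp' _]] := bound _ _ _ S' l'.
    by apply: leq_trans (rank_leq_col A'); apply/in_subspace_rank.
  case: pos hp {St dE ex1 ex2 ex3 sub le bound} => /= hp; last first.
  - by case: hp; case: hI => u [E _]; exists u.
  - by case: hp.
  move=> le_a le_b le_av _ [? ? ? ?] [? ? ? ?].
  by congr (_, _, _); lia.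
(* If L is inside W at the generic point, then i + j = k as x1 kills p_1(W).
   The ranks of a and (x1 ; b) then give i <= i' and j <= j', and i' + j' = k
   contradicts admissibility. If L is outside p_1(W), then b v = 0 forces j =
   0, so that dim p_1(W) has the same value on both strata; but L + p_1(W) has
   to be p_1(W). *)
- have le0 := le_flat (fun E => ltac:(discriminate E)).
  case: pos ex1 ex2 {ex3 dE St sub} hp => /= ex1 ex2 hp le_a le_b le_av le_bv [? ? ? ?] [? ? ? ?].
  + have t0 : (i + j)%N = k.
      have [lt_k|] := ltnP (i + j) k; last by lia.
      by have := ex1 erefl lt_k; rewrite ltnNge le0.
    have : (\rank (col_mx (ulsubmx t.2) (dlsubmx t.2)) <= minn (p + j' - k) j'.+1)%N.
      apply: (le _ _ _ _ (mx_in_col Px1 Pb)) => t' A' v' S' l' /=.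
      have [_ fA' r2' r1' [[hp1 hp2] cn']] := bound _ _ _ S' l'.
      have [_ b1] := conormal_flat cn' (conormal_not_inside cn' hp2).
      have [_ b2] := conormal_shadow cn' hp1.
      have aux x r : (x + r <= p -> x + r <= k.+1 -> j' + r = k -> x <= minn (p + j' - k) j'.+1)%N.
        by lia.
      exact: aux b1 b2 r1'.
    have := ex2 erefl t0; rewrite t0 ltnn in le_a; lia.
  + by congr (_, _, _); lia.
  + have : (\rank (row_mx (usubmx A) v) <= k - j')%N.
      have := le _ _ _ (k - j')%N (mx_in_row PAu Pv).
      rewrite /= col_mxKu; apply => t' A' v' S' l'; rewrite col_mxKu.
      have [_ _ _ r1' [[/in_shadow_rank hp1 _] _]] := bound _ _ _ S' l'.
      by apply: leq_trans hp1 _; lia.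
    by move=> le_r; case: hp; apply/in_shadow_rank; apply: leq_trans le_r _; lia.
(* Outside p_1(W), x1 = 0. In the other positions x1 = 0 at a generic point
   only if p_1(W) = V_1, which is impossible since p_1(W) is not V_1 on the
   stratum of o' and is smaller still on its closure. *)
- have le0 : (\rank (ulsubmx t.2) <= 0)%N.
    apply: (le _ _ _ _ Px1) => t' A' v' S' l' /=.
    have [_ _ _ _ [hp' cn']] := bound _ _ _ S' l'.
    by rewrite leqn0 mxrank_eq0; apply/eqP; exact: conormal_outside cn' hp'.
  case: pos ex3 {ex1 ex2 dE St sub hp} => /= ex3 le_a le_b le_av le_bv [? ? ? ?] [? ? ? ?].
  + have : (0 < \rank (ulsubmx t.2))%N by apply: ex3 => //; lia.
    lia.
  + have : (0 < \rank (ulsubmx t.2))%N by apply: ex3 => //; lia.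
    lia.
  + by congr (_, _, _); lia.
Qed.

Definition all_indices k : seq (nat * nat * position) :=
  List.list_prod (List.list_prod (List.seq 0 k.+1) (List.seq 0 k.+1))
    [:: Inside; InShadow; Outside].

(** The conditions of admissibility hold for every flag because the members of
    a placed frame are independent. *)
Lemma conormal_stratified (R : realType) p q k :
  stratification (@conormal R p q k) (all_indices k) (admissible p q k) (@stratum R p q k).
Proof.
split.
- move=> t; split=> [cn|[o [_ []]]//].
  have [A [V lt]] := exists_lift t; have [fA [v vE v0]] := lift_facts lt.
  have rA1 := rank_leq_row (usubmx A); have rA2 := rank_leq_row (dsubmx A).
  have lA1 := rank_leq_col (usubmx A); have lA2 := rank_leq_col (dsubmx A).
  have fA' : row_full (col_mx (usubmx A) (dsubmx A)) by rewrite vsubmxK.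
  have le12 : (k <= \rank (usubmx A) + \rank (dsubmx A))%N.
    by rewrite -{1}(eqP fA') rank_col_mx_le.
  pose i := (k - \rank (dsubmx A))%N; pose j := (k - \rank (usubmx A))%N.
  have Ei : (i + \rank (dsubmx A))%N = k by rewrite /i; lia.
  have Ej : (j + \rank (usubmx A))%N = k by rewrite /j; lia.
  have Et : (i + (j + (k - (i + j))))%N = k by lia.
  have [pos hp] : exists pos, has_position pos (usubmx A) (dsubmx A) v.
    have [hI|nI] := pselect (in_subspace (usubmx A) (dsubmx A) v); first by exists Inside.
    have [hS|nS] := pselect (in_shadow (usubmx A) v); first by exists InShadow.
    by exists Outside.
  have [N2 [N1 [N0 [_ pl]]]] := placed_frame fA' Ei Ej Et v0 hp.
  exists (i, j, pos); split; last by split=> //; exists A, v; rewrite -vE.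
  split; [lia|lia|lia|]; case: pos pl {hp} => [[]|[]|] //.
    by lia.
  by move=> f; have := rank_leq_row (row_mx (row_mx (usubmx A *m N2) (usubmx A *m N0)) v);
    rewrite (eqP f); lia.
- move=> [[i j] pos] [ijk _ _ _]; apply: List.in_prod; last by case: pos => /=; tauto.
  by apply: List.in_prod; apply/List.in_seq; lia.
- move=> [[i j] pos] adm; apply: stratum_irreducible.
  by have [t [A [v [St _ _ _]]]] := stratum_generic R adm; exists t.
- exact: strata_incomparable.
Qed.

(** * Loci of the exotic nilpotent cone *)

(** The orbits of the exotic nilpotent cone, indexed by the ranks of a, b, (a
    | v) and b v. *)
Definition pair_locus (R : realType) p q (c : nat * nat * nat * nat) :
    set (PV1 R p q * 'M[R[i]]_(p + q)) :=
  [set e | exists a b v, [/\ imgV (col_mx v (0 : 'cV[R[i]]_q)) = val e.1, e.2 = block_mx 0 a b 0,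
    a *m b = 0 /\ b *m a = 0 & rank_data a b v = c]].

Lemma rank_dataZ (F : fieldType) p q (a : 'M[F]_(p, q)) (b : 'M[F]_(q, p)) v d : d != 0 ->
  rank_data a b (d *: v) = rank_data a b v.
Proof.
move=> d0; congr (_, _, _, _); last by rewrite -scalemxAr mxrank_scale_nz.
have -> : row_mx a (d *: v) = row_mx a v *m block_mx 1%:M 0 0 d%:M.
  by rewrite mul_row_block !mulmx1 !mulmx0 addr0 add0r mul_mx_scalar.
rewrite rank_mul_unit // unitmxE det_ublock det1 mul1r det_scalar1.
by rewrite unitfE.
Qed.

Lemma line_generator (R : realType) p q (L : PV1 R p q) (v w : 'cV[R[i]]_p) :
  imgV (col_mx v (0 : 'cV[R[i]]_q)) = val L -> imgV (col_mx w (0 : 'cV[R[i]]_q)) = val L ->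
  exists2 d, d != 0 & v = d *: w.
Proof.
move=> vL wL; have /andP[/eqP dL _] := valP L.
have [G] : exists G, col_mx v (0 : 'cV[R[i]]_q) = col_mx w 0 *m G.
  by apply/imgV_subP; rewrite vL wL.
rewrite [G]mx11_scalar mul_mx_scalar scale_col_mx => /eq_col_mx[vw _].
exists (G 0 0) => //; apply/eqP => d0.
have dv : \dim (imgV (col_mx v (0 : 'cV[R[i]]_q))) = 1 by rewrite vL.
by move: dv; rewrite dim_imgV vw d0 scale0r col_mx0 mxrank0.
Qed.

Lemma conormal_pair (F : fieldType) p q k (A1 : 'M[F]_(p, k)) (A2 : 'M[F]_(q, k)) v x1 a b :
  conormal_blocks A1 A2 v x1 a b -> a *m b = 0 /\ b *m a = 0.
Proof.
move=> [C1 [C2 [c [[E1 E2] [E3 _] [E5 E6] E7 E8]]]]; split; last by rewrite E3 mulmxA E6 mul0mx.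
rewrite {1}E2 mulmxA; move/eqP: E5; rewrite addrC addr_eq0 => /eqP ->.
by rewrite mulNmx -mulmxA -E1 E7 mulmxA -(mulmxA v c) E8 mulmx0 mul0mx oppr0.
Qed.

Lemma pi_inv_locusP (R : realType) p q k c (t : flag_triple R p q k) A v :
  lift t A (col_mx v 0) ->
  Defs.pi_inv (pair_locus c) t <-> conormal t /\ rank_data (ursubmx t.2) (dlsubmx t.2) v = c.
Proof.
move=> lt; have [fA [w /eq_col_mx[<- _] v0]] := lift_facts lt.
split=> -[cn]; last first.
  move=> dE; split=> //; have [cx x2] := (conormal_atP A t.2 v0).1 ((conormal_lift lt).1 cn).
  exists (ursubmx t.2), (dlsubmx t.2), v; case: t lt cn dE cx x2 => -[W L] x [/= _ vL] _ dE cx _.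
  by split=> //; exact: conormal_pair cx.
move: cn lt; case: t => -[W L] x /= cn [/= _ vL] [a [b [u [uL xE _ dE]]]]; split=> //.
have [d d0 ud] := line_generator uL vL; rewrite -dE ud rank_dataZ //.
by move: xE; rewrite /mtheta /= => /eq_block_mx[_ -> -> _].
Qed.

Lemma closed_rank_lt (R : realType) p q k m n
    (Q : 'M[R[i]]_(p + q, k) * 'cV[R[i]]_(p + q) * 'M[R[i]]_(p + q) -> 'M[R[i]]_(m, n)) c :
  mx_in (@polynomial_function R p q k) Q ->
  closed [set t : flag_triple R p q k |
    forall A v, lift t A v -> (\rank (Q (A, v, t.2)) < c)%N].
Proof.
move=> PQ; case: c => [|c]; last exact: closed_rank_le.
rewrite (_ : [set _ | _] = set0); first exact: closed0.
rewrite predeqE => t; split=> // Ht; have [A [v lt]] := exists_lift t.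
by have := Ht _ _ lt.
Qed.

(** The four ranks are lower semicontinuous and bounded by generic_data on the
    stratum. They take these values at a generic point, hence on a nonempty
    relatively open subset, which is dense. *)
Lemma stratum_pi_dense (R : realType) p q k o c : admissible p q k o ->
  @stratum R p q k o `<=` closure (stratum o `&` Defs.pi_inv (pair_locus c)) <->
  c = generic_data p q k o.
Proof.
move=> adm.
have PA := polynomial_function_algebra R p q k.
have [PA1 PV Px] := polynomial_entries R p q k.
have Pu := mx_in_usubmx Px; have Pd := mx_in_dsubmx Px.
have Pa := mx_in_rsubmx Pu; have Pb := mx_in_lsubmx Pd.
have Pv := mx_in_usubmx PV; have Pav := mx_in_row Pa Pv; have Pbv := mx_in_mul PA Pb Pv.
have [t [A [v [St lt dE]]]] : exists (t : flag_triple R p q k) A v, [/\ stratum o t, lift t A (col_mx v 0)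
    & rank_data (ursubmx t.2) (dlsubmx t.2) v = generic_data p q k o].
  by case: o adm => -[i j] pos adm; have [t [A [v [? ? ? _]]]] := stratum_generic R adm;
    exists t, A, v.
split=> [sub|cE].
  have data (t' : flag_triple R p q k) A' v' : (stratum o `&` Defs.pi_inv (pair_locus c)) t' -> lift t' A' (col_mx v' 0) ->
      rank_data (ursubmx t'.2) (dlsubmx t'.2) v' = c.
    by move=> [_ pt'] lt'; have [_] := (pi_inv_locusP c lt').1 pt'.
  apply: le_data_anti.
    have [t' [St' pt']] : @stratum R p q k o `&` Defs.pi_inv (pair_locus c) !=set0.
      apply/set0P/eqP => E; have := sub _ St; rewrite E closure0.
      by [].
    have [A' [V' lt']] := exists_lift t'; have [_ [v' vE' _]] := lift_facts lt'.
    rewrite vE' in lt'; rewrite -(data t' A' v') //; exact: stratum_bounds lt'.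
  rewrite -dE; split.
  - have := closure_rank_le (c := c.1.1.1) Pa sub _ St lt.
    rewrite /=; apply => t' A' v' S' l'.
    by rewrite -(data _ _ _ S' l').
  - have := closure_rank_le (c := c.1.1.2) Pb sub _ St lt.
    rewrite /=; apply => t' A' v' S' l'.
    by rewrite -(data _ _ _ S' l').
  - have := closure_rank_le (c := c.1.2) Pav sub _ St lt.
    rewrite /= col_mxKu; apply => t' A' v' S' l'.
    by rewrite col_mxKu -(data _ _ _ S' l').
  - have := closure_rank_le (c := c.2) Pbv sub _ St lt.
    rewrite /= col_mxKu; apply => t' A' v' S' l'.
    by rewrite col_mxKu -(data _ _ _ S' l').
have [_ _ /(_ _ adm) irrS _] := conormal_stratified R p q k.
pose g := generic_data p q k o.
(* The stratum is covered by the closure in question and the closed sets where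
   one of the four ranks is not maximal; the generic point is in none of the
   latter. *)
pose F n := match n with
  | 0 => closure (stratum o `&` Defs.pi_inv (pair_locus c))
  | 1 => [set t : flag_triple R p q k | forall A v, lift t A v -> (\rank (ursubmx t.2) < g.1.1.1)%N]
  | 2 => [set t : flag_triple R p q k | forall A v, lift t A v -> (\rank (dlsubmx t.2) < g.1.1.2)%N]
  | 3 => [set t : flag_triple R p q k | forall A v, lift t A v -> (\rank (row_mx (ursubmx t.2) (usubmx v)) < g.1.2)%N]
  | _ => [set t : flag_triple R p q k | forall A v, lift t A v -> (\rank (dlsubmx t.2 *m usubmx v) < g.2)%N]
  end%N.
have cF n : closed (F n).
  case: n => [|[|[|[|n]]]] /=; first exact: closed_closure.
  - exact: (closed_rank_lt (c := g.1.1.1) Pa).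
  - exact: (closed_rank_lt (c := g.1.1.2) Pb).
  - exact: (closed_rank_lt (c := g.1.2) Pav).
  - exact: (closed_rank_lt (c := g.2) Pbv).
have [|[|[|[|[|n]]]] SF] := irreducible_cover (s := [:: 0; 1; 2; 3; 4]%N) irrS cF; last 4 first.
- by have /(_ _ _ lt) := SF _ St; rewrite /g -dE ltnn.
- by have /(_ _ _ lt) := SF _ St; rewrite /g -dE ltnn.
- by have /(_ _ _ lt) := SF _ St; rewrite /g -dE /= col_mxKu ltnn.
- by have /(_ _ _ lt) := SF _ St; rewrite /g -dE /= col_mxKu ltnn.
- move=> t' St'.
  have [A' [V' lt']] := exists_lift t'; have [_ [v' vE' _]] := lift_facts lt'.
  rewrite vE' in lt'; have [b1 b2 b3 b4] := stratum_bounds St' lt'; rewrite -/g in b1 b2 b3 b4.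
  have dat A0 V0 : lift t' A0 V0 -> rank_data (ursubmx t'.2) (dlsubmx t'.2) (usubmx V0) =
      rank_data (ursubmx t'.2) (dlsubmx t'.2) v'.
    move=> l0; have [_ [w wE _]] := lift_facts l0; rewrite wE in l0 *; rewrite col_mxKu.
    by have [d d0 ->] := line_generator l0.2 lt'.2; exact: rank_dataZ.
  have [l1|ge1] := ltnP (rank_data (ursubmx t'.2) (dlsubmx t'.2) v').1.1.1 g.1.1.1.
    by exists 1%N => //=; tauto.
  have [l2|ge2] := ltnP (rank_data (ursubmx t'.2) (dlsubmx t'.2) v').1.1.2 g.1.1.2.
    by exists 2%N => //=; tauto.
  have [l3|ge3] := ltnP (rank_data (ursubmx t'.2) (dlsubmx t'.2) v').1.2 g.1.2.
    by exists 3%N => /=; [tauto|move=> A0 V0 /dat E; rewrite -E in l3].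
  have [l4|ge4] := ltnP (rank_data (ursubmx t'.2) (dlsubmx t'.2) v').2 g.2.
    by exists 4%N => /=; [tauto|move=> A0 V0 /dat E; rewrite -E in l4].
  exists 0%N => /=; [tauto|apply: subset_closure; split=> //].
  apply/(pi_inv_locusP c lt'); split; first by case: St'.
  by rewrite cE; apply: le_data_anti; split.
- exact: SF.
Qed.

Lemma component_over_locus (R : realType) p q k c (C : set (flag_triple R p q k)) :
  component_over (pair_locus c) C <-> exists o, [/\ admissible p q k o,
    generic_data p q k o = c & C = @conormal R p q k `&` closure (stratum o)].
Proof.
have st := conormal_stratified R p q k.
have sY : @Defs.pi_inv R p q k (pair_locus c) `<=` @conormal R p q k by move=> t [].
split=> [[/(stratum_components _ st)[o adm ->] sub]|[o [adm gE ->]]].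
  exists o; split=> //; symmetry; apply/(stratum_pi_dense R c adm).
  exact/(stratum_closure_sub st adm sY).
split; first by apply/(stratum_components _ st); exists o.
by apply/(stratum_closure_sub st adm sY)/(stratum_pi_dense R c adm).
Qed.

(** * Orbits of the exotic nilpotent cone *)

(** The ranks of a, b, (a | v), b v when L has type T. *)
Definition type_data (T : line_type) r s : nat * nat * nat * nat :=
  match T with
  | In_image => (r, s, r, 0)
  | In_kernel => (r, s, r.+1, 0)
  | Off_kernel => (r, s, r.+1, 1)
  end%N.

Lemma has_typeP (F : fieldType) p q T r s (a : 'M[F]_(p, q)) (b : 'M[F]_(q, p)) v :
  b *m a = 0 ->
  rank_data a b v = type_data T r s <-> [/\ \rank a = r, \rank b = s & has_type T a b v].
Proof.
move=> ba.
have im_ker y : v = a *m y -> b *m v = 0 by move=> ->; rewrite mulmxA ba mul0mx.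
case: T => /=; split.
- move=> [<- <- rE _]; split=> //.
  have [|u ->] := @rank_row_mx_sub _ _ _ _ a v; first by rewrite rE.
  by exists u.
- move=> [<- <- [y vy]]; congr (_, _, _, _); first by rewrite vy rank_row_mx_mul.
  by rewrite (im_ker _ vy) mxrank0.
- move=> [<- <- rE /eqP]; rewrite mxrank_eq0 => /eqP bv; split=> //; split=> //.
  by move=> [y vy]; move: rE; rewrite vy rank_row_mx_mul => /eqP; rewrite ltn_eqF.
- move=> [<- <- [bv nim]]; congr (_, _, _, _); last by rewrite bv mxrank0.
  by apply: rank_row_cV => u vu; apply: nim; exists u.
- by move=> [<- <- _ rE]; split=> // bv; move: rE; rewrite bv mxrank0.
- move=> [<- <- bv]; congr (_, _, _, _).
    by apply: rank_row_cV => u /im_ker.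
  apply/eqP; rewrite eqn_leq rank_leq_col lt0n mxrank_eq0; exact/eqP.
Qed.

Lemma exists_type (F : fieldType) p q (a : 'M[F]_(p, q)) (b : 'M[F]_(q, p)) v :
  exists T, has_type T a b v.
Proof.
have [bv|bv] := eqVneq (b *m v) 0; last by exists Off_kernel; exact/eqP.
have [im|nim] := pselect (exists y, v = a *m y); first by exists In_image.
by exists In_kernel.
Qed.

Lemma img_mul (R : realType) m n l (g : 'M[R[i]]_(m, n)) (X : 'M[R[i]]_(n, l)) :
  (mxHom g @: imgV X)%VS = imgV (g *m X).
Proof.
apply/eqP; rewrite eqEsubv; apply/andP; split; apply/subvP => u.
  move=> /memv_imgP[w /memv_imgVP[c ->] ->]; rewrite mxHomE; apply/memv_imgVP.
  by exists c; rewrite mulmxA.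
move=> /memv_imgVP[c ->]; apply/memv_imgP; exists (X *m c); last by rewrite mxHomE mulmxA.
by apply/memv_imgVP; exists c.
Qed.

Lemma exists_generator (R : realType) p q (L : PV1 R p q) :
  exists2 v, imgV (col_mx v (0 : 'cV[R[i]]_q)) = val L & v != 0.
Proof.
have /andP[/eqP dL LV] := valP L; have [V VL] := exists_imgV dL.
have [v Vv] : exists v, V = incl1 R p q *m v by apply/imgV_subP; rewrite VL.
rewrite /incl1 mul_col_mx mul1mx mul0mx in Vv; exists v; first by rewrite -Vv.
have dV : \dim (imgV V) = 1 by rewrite VL.
by apply/eqP => v0; move: dV; rewrite dim_imgV Vv v0 col_mx0 mxrank0.
Qed.

Lemma generator_neq0 (R : realType) p q (L : PV1 R p q) v :
  imgV (col_mx v (0 : 'cV[R[i]]_q)) = val L -> v != 0.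
Proof.
move=> vL; have [w wL w0] := exists_generator L; have [d d0 ->] := line_generator vL wL.
by rewrite scaler_eq0 negb_or d0.
Qed.

Lemma locus_sub_orbit (R : realType) p q c (e : PV1 R p q * 'M[R[i]]_(p + q)) :
  pair_locus c e -> pair_locus c `<=` orbitK e.
Proof.
case: e => L x [a [b [v [/= vL -> [ab ba] dE]]]] [L' x'] [a' [b' [v' [/= vL' -> [ab' ba'] dE']]]].
have [T hT] := exists_type a b v.
have cT : c = type_data T (\rank a) (\rank b) by rewrite -dE; apply/(has_typeP _ _ _ _ ba).
have [ra rb hT'] := (has_typeP T (\rank a) (\rank b) v' ba').1 (etrans dE' cT).
have [g1 [g2 [u1 u2 ga gb gv]]] := pair_transitive ab ba ab' ba' (esym ra) (esym rb)
  (generator_neq0 vL) (generator_neq0 vL') hT hT'.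
have gu : block_mx g1 0 0 g2 \in unitmx by rewrite unitmxE det_ublock unitrM -!unitmxE u1.
exists (block_mx g1 0 0 g2); first by exists g1, g2.
split=> /=.
  rewrite -vL img_mul mul_block_col !mul0mx !mulmx0 !addr0 gv.
  exact: esym.
apply: (canRL (mulmxK gu)).
by rewrite !mulmx_block !mul0mx !mulmx0 !add0r !addr0 ga gb.
Qed.

Lemma orbit_sub_locus (R : realType) p q c (e : PV1 R p q * 'M[R[i]]_(p + q)) :
  pair_locus c e -> orbitK e `<=` pair_locus c.
Proof.
case: e => L x [a [b [v [/= vL -> [ab ba] dE]]]] [L' x'] [_ [g1 [g2 [u1 u2 ->]]] [/= L'E ->]].
have iE : invmx (block_mx g1 0 0 g2) = block_mx (invmx g1) 0 0 (invmx g2).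
  have gu : block_mx g1 0 0 g2 \in unitmx by rewrite unitmxE det_ublock unitrM -!unitmxE u1.
  rewrite -[RHS](mulKmx gu) mulmx_block !mul0mx !mulmx0 !add0r !addr0 !mulmxV //.
  by rewrite -scalar_mx_block mulmx1.
exists (g1 *m a *m invmx g2), (g2 *m b *m invmx g1), (g1 *m v); split=> /=.
- by rewrite L'E -vL img_mul mul_block_col !mul0mx !mulmx0 !addr0.
- by rewrite iE !mulmx_block !mul0mx !mulmx0 !add0r !addr0 ?mul0mx.
- split; rewrite !mulmxA mulmxKV // -?(mulmxA g1 a b) -?(mulmxA g2 b a) ?ab ?ba.
    by rewrite mulmx0 mul0mx.
  by rewrite mulmx0 mul0mx.
- rewrite -dE; congr (_, _, _, _).
  + by rewrite rank_mul_unit ?unitmx_inv // rank_unit_mul.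
  + by rewrite rank_mul_unit ?unitmx_inv // rank_unit_mul.
  + have -> : row_mx (g1 *m a *m invmx g2) (g1 *m v) = g1 *m row_mx a v *m block_mx (invmx g2) 0 0 1%:M.
      by rewrite mul_mx_row mul_row_block !mulmx0 mulmx1 addr0 add0r.
    rewrite rank_mul_unit ?rank_unit_mul // unitmxE det_ublock det1 mulr1 -unitmxE.
    by rewrite unitmx_inv.
  + by rewrite mulmxA mulmxKV // -mulmxA rank_unit_mul.
Qed.

(** Orbits are loci of constant ranks by pair_transitive. *)
Lemma locus_orbit (R : realType) p q c (e : PV1 R p q * 'M[R[i]]_(p + q)) :
  pair_locus c e -> pair_locus c = orbitK e.
Proof.
move=> ce; rewrite eqEsubset; split; first exact: locus_sub_orbit.
exact: orbit_sub_locus.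
Qed.

Lemma exotic_cone_locus (R : realType) p q k (e : PV1 R p q * 'M[R[i]]_(p + q)) :
  exotic_cone k e -> exists c, pair_locus c e.
Proof.
case: e => L x [/= tx xx _]; have [v vL _] := exists_generator L.
rewrite -[x]submxK theta_block in tx xx *; move: tx xx.
move: (ulsubmx x) (ursubmx x) (dlsubmx x) (drsubmx x) => x1 a b x2.
move=> /eqP; rewrite /diag_blocks block_mx_eq0 => /and4P[/eqP -> _ _ /eqP ->].
rewrite mulmx_block !mul0mx !mulmx0 !add0r !addr0 => /eqP.
rewrite block_mx_eq0 => /and4P[/eqP ab _ _ /eqP ba].
by exists (rank_data a b v), a, b, v.
Qed.

Lemma locus_exotic_cone (R : realType) p q k (c : nat * nat * nat * nat)
    (e : PV1 R p q * 'M[R[i]]_(p + q)) :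
  (c.1.1.1 + c.1.1.2 <= minn k (p + q - k))%N -> pair_locus c e -> exotic_cone k e.
Proof.
case: e => L x le_c [a [b [v [/= vL -> [ab ba] dE]]]]; split=> /=.
- by rewrite theta_block /diag_blocks block_mx0.
- by rewrite mulmx_block !mul0mx !mulmx0 !add0r !addr0 ab ba block_mx0.
apply: leq_trans le_c; rewrite -dE /=.
have -> : block_mx 0 a b 0 = block_mx 0 a 0 0 + block_mx 0 0 b 0.
  by rewrite add_block_mx !add0r addr0.
apply: leq_trans (mxrank_add _ _) _.
by rewrite -[block_mx 0 a 0 0]/(col_mx _ _) -[block_mx 0 0 b 0]/(col_mx _ _) !row_mx0
  rank_col_mx0 rank_col_0mx rank_row_0mx rank_row_mx0.
Qed.

Lemma line_sub_image (R : realType) p q (L : PV1 R p q) v (a : 'M[R[i]]_(p, q)) :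
  imgV (col_mx v (0 : 'cV[R[i]]_q)) = val L ->
  (val L <= mxHom (incl1 R p q) @: imgV a)%VS <-> exists y, v = a *m y.
Proof.
move=> vL; rewrite img_mul -vL /incl1 mul_col_mx mul1mx mul0mx.
split=> [/imgV_subP[y]|[y vy]].
  by rewrite mul_col_mx => /eq_col_mx[vy _]; exists y.
by apply/imgV_subP; exists y; rewrite mul_col_mx vy mul0mx.
Qed.

Lemma line_sub_kernel (R : realType) p q (L : PV1 R p q) v (b : 'M[R[i]]_(q, p)) :
  imgV (col_mx v (0 : 'cV[R[i]]_q)) = val L ->
  (val L <= mxHom (incl1 R p q) @: kerV b)%VS <-> b *m v = 0.
Proof.
move=> vL; rewrite -vL; split=> [/subvP sub|bv].
  have /sub/memv_imgP[w wb] : col_mx v (0 : 'cV[R[i]]_q) \in imgV (col_mx v (0 : 'cV[R[i]]_q)).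
    by apply/memv_imgVP; exists 1%:M; rewrite mulmx1.
  rewrite mxHomE /incl1 mul_col_mx mul1mx mul0mx => /eq_col_mx[-> _].
  by move: wb; rewrite memv_ker mxHomE => /eqP.
apply/subvP => u /memv_imgVP[c ->]; apply/memv_imgP; exists (v *m c).
  by rewrite memv_ker mxHomE mulmxA bv mul0mx.
by rewrite mxHomE /incl1 !mul_col_mx mul1mx !mul0mx.
Qed.

(** * Parameters of orbits *)

(** The types (I), (II), (III) in this order. *)
Definition mu_type (T : line_type) p r s (mu : seq int) : Prop :=
  match T with
  | In_image => typeI p r mu
  | In_kernel => typeII p r s mu
  | Off_kernel => typeIII r s mu
  end.

Lemma mu_type_inj p r s mu T T' : (r + s <= p)%N ->
  mu_type T p r s mu -> mu_type T' p r s mu -> T = T'.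
Proof.
move=> le_p.
have I_II : typeI p r mu -> typeII p r s mu -> False.
  move=> h1 [np _ h2]; have := h1 (r + s + 1)%N; rewrite h2; last by lia.
  by move=> /(_ ltac:(lia)).
have I_III : typeI p r mu -> typeIII r s mu -> False.
  move=> h1 [s0 h2]; have := h1 (r + 1)%N; rewrite h2; last by lia.
  by move=> /(_ ltac:(lia)).
have II_III : typeII p r s mu -> typeIII r s mu -> False.
  by move=> [_ h1 _] [s0 h2]; have := h1 (r + 1)%N; rewrite h2; [move=> /(_ ltac:(lia))|lia].
by case: T; case: T' => //= h h'; exfalso; auto.
Qed.

Lemma orbit_of_locus (R : realType) p q r s mu T : (r + s <= p)%N -> mu_type T p r s mu ->
  @orbit_of R p q r s mu = pair_locus (type_data T r s).
Proof.
move=> le_p muT; rewrite predeqE => -[L x]; split.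
- move=> [a [b [/= xE [ab ba] [ra rb] [hI hII hIII]]]].
  have [v vL v0] := exists_generator L.
  exists a, b, v; split=> //; apply/(has_typeP _ _ _ _ ba); split=> //.
  case: T muT => /= muT.
  + exact/(line_sub_image a vL)/hI.
  + have [h1 h2] := hII muT; split; first exact/(line_sub_kernel b vL).
    by move/(line_sub_image a vL); apply/negP.
  + by move/(line_sub_kernel b vL); apply/negP/hIII.
- move=> [a [b [v [/= vL xE [ab ba] /(has_typeP _ _ _ _ ba)[ra rb hT]]]]].
  exists a, b; split=> //=.
  split=> muT'.
  + have TE := mu_type_inj (T' := In_image) le_p muT muT'; rewrite TE in hT.
    exact/(line_sub_image a vL).
  + have TE := mu_type_inj (T' := In_kernel) le_p muT muT'; rewrite TE in hT.
    case: hT => h1 h2; split; first exact/(line_sub_kernel b vL).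
    by apply/negP => /(line_sub_image a vL).
  + have TE := mu_type_inj (T' := Off_kernel) le_p muT muT'; rewrite TE in hT.
    by apply/negP => /(line_sub_kernel b vL).
Qed.

(** Some entry of mu is positive, and in type (I) it can only be one of the
    first r. *)
Lemma typeI_r_gt0 p q r s mu : Pi2 p q r s mu -> typeI p r mu -> (0 < r)%N.
Proof.
move=> [le_rs sz [_ _ _ mu0] [m mmu m1] _] hI.
move: mmu => /(nthP 0)[i lt_i mE]; rewrite sz in lt_i.
have mE' : mu_at mu i.+1 = m by [].
have [le_r|lt_r] := leqP i.+1 r; first by lia.
have [le_p|lt_p] := leqP i.+1 p.
  by have := hI i.+1 ltac:(lia); rewrite mE' => h; have := le_trans m1 h.
by have := mu0 i.+1 ltac:(lia); rewrite mE' => h; move: m1; rewrite h.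
Qed.

(** * Strata above an orbit *)

Lemma data_inj (a b c d a' b' c' d' : nat) :
  (a, b, c, d) = (a', b', c', d') -> [/\ a = a', b = b', c = c' & d = d'].
Proof. by case. Qed.

(** The solution is i = r + max(k - q, 0), less one if k > q: then Im a
    contains L thanks to the diagonal part of W, in addition to the q + i - k
    dimensions that come from V_2 / p_2(W). *)
Lemma strata_I p q k r s : (k <= p + q)%N -> (0 < r)%N ->
  (r + s <= minn p q)%N -> (r + s <= minn k (p + q - k))%N ->
  exists o, forall o',
    admissible p q k o' /\ generic_data p q k o' = type_data In_image r s <-> o' = o.
Proof.
move=> le_k r0 le1 le2.
exists (r + (k - q) - (q < k), s + (k - p), Inside)%N => -[[i j] pos].
rewrite /generic_data /generic_a /generic_b /generic_av /generic_bv /=; split.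
- case: pos => -[[? ? ? ?] /data_inj[E1 E2 E3 E4]]; try (exfalso; lia).
  by congr (_, _, _); lia.
- by move=> [-> -> ->]; split; [split; lia|congr (_, _, _, _); lia].
Qed.

Lemma strata_III p q k r s : (k <= p + q)%N -> (0 < s)%N ->
  (r + s <= minn p q)%N -> (r + s <= minn k (p + q - k))%N ->
  exists o, forall o',
    admissible p q k o' /\ generic_data p q k o' = type_data Off_kernel r s <-> o' = o.
Proof.
move=> le_k s0 le1 le2.
exists (r + (k - q), s + (k - p), Outside)%N => -[[i j] pos].
rewrite /generic_data /generic_a /generic_b /generic_av /generic_bv /=; split.
- case: pos => -[[? ? ? ?] /data_inj[E1 E2 E3 E4]]; try (exfalso; lia).
  by congr (_, _, _); lia.
- by move=> [-> -> ->]; split; [split; lia|congr (_, _, _, _); lia].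
Qed.

(** The index in type (II) that is present in all cases. If L is outside
    p_1(W), then s = 0, because b v = 0 for generic b only if j = 0. *)
Definition nonspecial_II p q k r s : nat * nat * position :=
  (if k < p then if s == 0 then (r + (k - q), 0, Outside) else (r + (k - q), s.-1, InShadow)
   else if r + s + (k - q) + (k - p) < k then (r + (k - q), s + (k - p), InShadow)
   else (r + (k - q), s + (k - p), Inside))%N.

(** For k < p the index of position Inside needs k > q and W = (W cap V_1) +
    (W cap V_2), that is r + s = q; this is the condition of type (II)^*. *)
Lemma strata_II p q k r s : (k <= p + q)%N -> (r + s)%N <> p ->
  (r + s <= minn p q)%N -> (r + s <= minn k (p + q - k))%N ->
  forall o', admissible p q k o' /\ generic_data p q k o' = type_data In_kernel r s <->
    o' = nonspecial_II p q k r s \/ star_condition p q k r s /\ o' = (r + (k - q), s, Inside)%N.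
Proof.
move=> le_k neq; rewrite !leq_min => /andP[le_rp le_rq] /andP[le_rk le_rn] [[i j] pos].
rewrite /nonspecial_II /star_condition leq_min.
have triple i' j' pos' : (i, j, pos) = (i', j', pos') <-> [/\ i = i', j = j' & pos = pos'].
  by split=> [[-> -> ->]|[-> -> ->]].
have min_gen m l n : (l <= m + n)%N -> minn (m + n - l) n = (n - (l - m))%N by lia.
have min_gen1 m l n : (l <= m + n)%N -> minn (m + n - l) n.+1 = (n - (l - m) + (l < m))%N by lia.
have min_gen2 m l n : (0 < n)%N -> (l <= m + n)%N -> minn (m + n - l).+1 n = (n - (l - m) + (m < l))%N by lia.
have min_gen3 m l n : (0 < n)%N -> (l <= m + n)%N -> minn (m + n - l + true) n = (n - (l - m) + (m < l))%N by lia.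
split.
- move=> [adm /data_inj[]]; rewrite /generic_a /generic_b /generic_av /generic_bv.
  case: pos triple adm => triple [h1 h2 h3 h4].
  + rewrite !(min_gen p) // min_gen2 //.
    have [lt_t|le_t] := ltnP (i + j) k.
      by rewrite min_gen3 // => -> _ /eqP; rewrite -addn1 -[X in X == _]addn0 eqn_add2l.
    rewrite addn0 !(min_gen q) // => E1 E2 E3 _.
    have lt_qk : (q < k)%N by move: E3; rewrite E1; case: (q < k)%N => //; lia.
    have [lt_kp|le_pk] := ltnP k p.
      right; split; first by split; lia.
      by rewrite triple; split=> //; lia.
    left; rewrite (_ : (_ < k)%N = false); last by apply/negbTE; lia.
    by rewrite triple; split=> //; lia.
  + rewrite !(min_gen q) // min_gen1 // => E1 E2 _ _; left.
    have [lt_kp|le_pk] := ltnP k p.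
      have [s0|s0] := eqVneq s 0%N; first by exfalso; lia.
      by rewrite triple; split=> //; lia.
    rewrite (_ : (_ < k)%N = true); last by lia.
    by rewrite triple; split=> //; lia.
  + rewrite !(min_gen q) // !(min_gen p) // => E1 E2 _ j0.
    have {}j0 : j = 0%N by case: j j0 {triple h1 h2 h4 E2}.
    left; rewrite (_ : (k < p)%N); last by lia.
    rewrite (_ : s == 0%N); last by lia.
    by rewrite triple; split=> //; lia.
- rewrite /generic_data /= /generic_a /generic_b /generic_av.
  move=> [|[[e1 e2 e3]]]; last first.
    by move=> [-> -> ->]; split; [split; lia|congr (_, _, _, _); lia].
  have [lt_kp|le_pk] := ltnP k p.
    by have [s0|s0] := eqVneq s 0%N => -[-> -> ->]; (split; [split; lia|congr (_, _, _, _); lia]).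
  by have [lt_t|le_t] := ltnP (r + s + (k - q) + (k - p)) k => -[-> -> ->];
    (split; [split; lia|congr (_, _, _, _); lia]).
Qed.

Lemma nonspecial_II_neq p q k r s : star_condition p q k r s ->
  nonspecial_II p q k r s <> (r + (k - q), s, Inside)%N.
Proof.
move=> [? ? ?]; rewrite /nonspecial_II (_ : (k < p)%N = true); last by lia.
by case: eqP.
Qed.

Lemma unique_component_over (R : realType) p q k c o :
  (forall o', admissible p q k o' /\ generic_data p q k o' = c <-> o' = o) ->
  exists! C : set (flag_triple R p q k), component_over (pair_locus c) C.
Proof.
move=> oP; have [adm gE] := (oP o).2 erefl.
exists (@conormal R p q k `&` closure (stratum o)); split.
  by apply/component_over_locus; exists o.
by move=> C /component_over_locus[o' [adm' gE' ->]]; rewrite ((oP o').1 (conj adm' gE')).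
Qed.

Lemma generic_data_rank p q k o : admissible p q k o ->
  ((generic_data p q k o).1.1.1 + (generic_data p q k o).1.1.2 <= minn k (p + q - k))%N.
Proof.
case: o => -[i j] pos; rewrite /generic_data /generic_a /generic_b /=.
by case: pos => -[? ? ? ?]; lia.
Qed.

Lemma generic_locus_orbit (R : realType) p q k o : admissible p q k o ->
  is_orbitK k (@pair_locus R p q (generic_data p q k o)).
Proof.
case: o => -[i j] pos adm; have [t [A [v [St lt dE _]]]] := stratum_generic R adm.
have cn : conormal t by case: St.
have [_ ce] := (pi_inv_locusP _ lt).2 (conj cn dE).
exists (pi_map t); last exact: locus_orbit.
exact: locus_exotic_cone (generic_data_rank adm) ce.
Qed.

Theorem theorem2p13 (R : realType) (p q k : nat)
    (n_gt0 : (0 < p + q)%N) (k_le_n : (k <= p + q)%N) :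
  [/\ (* (a) *)
      forall (r s : nat) (mu : seq int), Pi2k p q k r s mu ->
        typeI p r mu \/ typeII0 p q k r s mu \/ typeIII r s mu ->
        exists! C : set (flag_triple R p q k),
          component_over (@orbit_of R p q r s mu) C,
      (* (b) *)
      forall (r s : nat) (mu : seq int), Pi2k p q k r s mu ->
        typeIIstar p q k r s mu ->
        exists C1 C2 : set (flag_triple R p q k),
          C1 <> C2 /\
          forall C : set (flag_triple R p q k),
            component_over (@orbit_of R p q r s mu) C <-> C = C1 \/ C = C2
    & (* (c) *)
      forall C : set (flag_triple R p q k),
        irreducible_component (@conormal R p q k) C ->
        exists! O : set (PV1 R p q * 'M[R[i]]_(p + q))%type,
          is_orbitK k O /\ component_over O C].
Proof.
have st := conormal_stratified R p q k.
split.
- move=> r s mu [pi_mu le2] types.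
  have [le1 _ _ _ _] := pi_mu; have le_p : (r + s <= p)%N by lia.
  have [T muT [o oP]] : exists2 T, mu_type T p r s mu &
      exists o, forall o',
        admissible p q k o' /\ generic_data p q k o' = type_data T r s <-> o' = o.
    case: types => [hI|[[hII nstar]|hIII]].
    + exists In_image => //; have r0 := typeI_r_gt0 pi_mu hI.
      exact: strata_I.
    + exists In_kernel => //; exists (nonspecial_II p q k r s) => o'.
      have [neq _ _] := hII; have H := strata_II k_le_n neq le1 le2 o'.
      by split=> [/H[//|[]//]|->]; apply/strata_II => //; left.
    + exists Off_kernel => //; have [/eqP s0 _] := hIII.
      by apply: strata_III => //; rewrite lt0n.
  by rewrite (orbit_of_locus R q le_p muT); exact: unique_component_over oP.
- move=> r s mu [pi_mu le2] [hII star].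
  have [le1 _ _ _ _] := pi_mu; have le_p : (r + s <= p)%N by lia.
  have [neq _ _] := hII; have H := strata_II k_le_n neq le1 le2.
  rewrite (orbit_of_locus (T := In_kernel) R q le_p hII).
  pose o1 := nonspecial_II p q k r s; pose o2 := (r + (k - q), s, Inside)%N.
  have [adm1 g1] := (H o1).2 (or_introl erefl).
  have [adm2 g2] := (H o2).2 (or_intror (conj star erefl)).
  exists (@conormal R p q k `&` closure (stratum o1)), (@conormal R p q k `&` closure (stratum o2)).
  split.
    by move=> /(stratum_closure_inj st adm1 adm2); exact: nonspecial_II_neq.
  move=> C; split=> [/component_over_locus[o [adm gE ->]]|[->|->]].
  + by have [->|[_ ->]] := (H o).1 (conj adm gE); [left|right].
  + by apply/component_over_locus; exists o1.
  + by apply/component_over_locus; exists o2.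
- move=> C /(stratum_components _ st)[o adm CE].
  exists (pair_locus (generic_data p q k o)); split.
    split; first exact: generic_locus_orbit.
    by apply/component_over_locus; exists o.
  move=> O [[e ce ->]]; have [c lc] := exotic_cone_locus ce.
  rewrite -(locus_orbit lc) => /component_over_locus[o' [adm' <- CE']].
  by rewrite (stratum_closure_inj st adm adm' (etrans (esym CE) CE')).
Qed.
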